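(* Let $T>0$, $\mathcal U_0,\mathcal F\in\mathcal C^2(\mathcal P)$. Let $\mathcal G$ be either the Lax–Friedrichs numerical Hamiltonian $\mathcal G^{LF}$ or the Osher–Sethian numerical Hamiltonian $\mathcal G^{OS}$ defined in the context, and let $g$ be one of the three functions (average, logarithmic, harmonic) listed in the context. Let $u^h$ be the solution of the semi-discrete scheme $$\partial_tu^h(t,\xi)+\mathcal G(\xi,[D^+u^h],[D^-u^h])+\mathcal F(\xi)=0,\ t>0,\ \xi\in\mathcal P^\circ,\qquad u^h(0,\xi)=\mathcal U_0(\xi).$$ Then there exist constants $h_0\in(0,\tfrac1d)$, $R_0>0$, $K_0>0$, depending only on $T$, $\|\mathcal U_0\|_{\mathcal C^2(\mathcal P)}$, $\|\mathcal F\|_{\mathcal C^2(\mathcal P)}$ and $G$, such that for all $h\in(0,h_0)$ and $t\in[0,T]$ (with viscosity coefficients $\gamma_{i,j}=2R_0$ in the Lax–Friedrichs case): (i) $\displaystyle\sup_{\xi\in\mathcal P}\max_{(i,j)\in E}|\nabla^{e_{i,j}}u^h(t,\xi)|\le R_0$; (ii) $\displaystyle\sup_{\mathbf a\in\mathbb V}\sup_{\xi\in\mathcal P}\mathbf a^\top\nabla^2u^h(t,\xi)\,\mathbf a\le K_0$.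
   Context: **Graph and simplex.** $G=(V,E,\omega)$ is a finite undirected connected graph without self-loops or multiple edges, $V=\{1,\dots,d\}$, $d\ge2$; $\omega$ is a symmetric $d\times d$ matrix with $\omega_{i,j}>0$ if $(i,j)\in E$ and $\omega_{i,j}=0$ otherwise. $\mathcal P=\{\xi\in[0,1]^d:\sum_i\xi_i=1\}$, $\mathcal P^\circ=\{\xi\in\mathcal P:\xi_i>0\ \forall i\}$. For $i<j$, $e_{i,j}\in\mathbb R^d$ has $i$-th entry $1$, $j$-th entry $-1$, other entries $0$; $\nabla^{e_{i,j}}f(\xi)=\lim_{t\to0}(f(\xi+te_{i,j})-f(\xi))/t$. Sums and maxima over $(i,j)\in E$ count each undirected edge once, with $i<j$. $\mathbb V=\{\mathbf a\in\mathbb R^d:\|\mathbf a\|_{l^2}=1,\ \sum_k\mathbf a_k=0\}$; $\mathbf a^\top\nabla^2u\,\mathbf a$ is the second derivative of $u$ in the tangent direction $\mathbf a$. **Choices of $g$.** $g:[0,\infty)^2\to[0,\infty)$ is one of: $g_1(t,r)=\frac{t+r}2$; $g_2(t,r)=\frac{t-r}{\log t-\log r}$ if $t\ne r$ (and $t,r>0$), $g_2(t,r)=0$ if $t=0$ or $r=0$, $g_2(t,t)=t$; $g_3(t,r)=0$ if $t=0$ or $r=0$, $g_3(t,r)=\frac{2}{1/t+1/r}$ otherwise. $g_{i,j}(\xi)=g(\xi_i,\xi_j)$. **Numerical Hamiltonians.** $\mathcal I(\xi)=\sum_{i=1}^d\frac1{\xi_i}$, with $\mathcal I^{-2}(\xi)=0$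 on $\mathcal P\setminus\mathcal P^\circ$. For skew-symmetric matrices $P=(p_{i,j})$, $Q=(q_{i,j})$, $$\mathcal G^{LF}(\xi,P,Q)=\tfrac12\mathcal I^{-2}(\xi)\sum_{(i,j)\in E}g_{i,j}(\xi)\Bigl(\frac{p_{i,j}^2+q_{i,j}^2}2-\gamma_{i,j}(p_{i,j}-q_{i,j})\Bigr),$$ where the viscosity coefficients are $\gamma_{i,j}=2R_0$ with $R_0$ the gradient-bound constant of the claim, and $$\mathcal G^{OS}(\xi,P,Q)=\tfrac12\mathcal I^{-2}(\xi)\sum_{(i,j)\in E}g_{i,j}(\xi)\bigl(\max(q_{i,j},0)^2+\min(p_{i,j},0)^2\bigr).$$ **Differences.** For mesh size $h\in(0,1/d)$ and $i<j$, $D^+_{e_{i,j}}v(\xi)=v(\xi+he_{i,j})-v(\xi)$, $D^-_{e_{i,j}}v(\xi)=v(\xi)-v(\xi-he_{i,j})$, with constant extrapolation: $v(\xi\pm he_{i,j}):=v(\xi)$, hence $D^\pm_{e_{i,j}}v(\xi)=0$, if the shifted point $\xi\pm he_{i,j}$ (same sign) is not in $\mathcal P$. $[D^\pm v]$ is the $d\times d$ skew-symmetric matrix with entries $\frac{\sqrt{\omega_{i,j}}}hD^\pm_{e_{i,j}}v$ for $i<j$.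
   Formalization: The bounds (i), (ii) are asserted at all points and directions where the derivatives of u^h exist, since constant extrapolation makes u^h discontinuous at some points; the scheme is also imposed on the boundary of P, where it reads ∂_t u^h + F = 0. *)

(* Defs.v *)
From HB Require Import structures.
From mathcomp Require Import all_boot all_order all_algebra.
From mathcomp Require Import all_classical all_reals all_analysis.
Set Implicit Arguments.
Unset Strict Implicit.
Unset Printing Implicit Defensive.
Import Order.TTheory GRing.Theory Num.Theory.
Import numFieldNormedType.Exports.
Local Open Scope classical_set_scope.
Local Open Scope ring_scope.

(* Finite, undirected, connected weighted graph on 'I_d, without loops or
   multiple edges. *)
Record wgraph (R : realType) (d : nat) := WGraph {
  edge : rel 'I_d;
  weight : 'M[R]_d;
  edge_sym : symmetric edge;
  edge_irr : irreflexive edge;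
  edge_connected : forall i j, connect edge i j;
  weight_sym : weight^T = weight;
  weight_edge : forall i j, edge i j -> 0 < weight i j;
  weight_nonedge : forall i j, ~~ edge i j -> weight i j = 0 }.

Section Simplex.
Context (R : realType) (d : nat).
Implicit Types (xi a b : 'rV[R]_d) (f : 'rV[R]_d -> R).

Definition simplex : set 'rV[R]_d :=
  [set xi : 'rV[R]_d | (forall i, 0 <= xi 0 i <= 1) /\ \sum_i xi 0 i = 1].

Definition simplex_interior : set 'rV[R]_d :=
  [set xi : 'rV[R]_d | simplex xi /\ forall i, 0 < xi 0 i].

Definition evec (i j : 'I_d) : 'rV[R]_d := delta_mx 0 i - delta_mx 0 j.

Definition tangent (a : 'rV[R]_d) := \sum_k a 0 k = 0.

(* The l^2 norm is spelled out because `|a| is the sup norm on 'rV[R]_d. *)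
Definition unit_tangent : set 'rV[R]_d :=
  [set a : 'rV[R]_d | Num.sqrt (\sum_k a 0 k ^+ 2) = 1 /\ tangent a].

(* l = lim_(t -> 0) (f (xi + t a) - f xi) / t, where t ranges over the nonzero
   reals such that xi + t a lies in the simplex; the limit is thus one-sided at
   those boundary points from which only one of a, -a stays in the simplex.
   By convexity, the first conjunct says that 0 is a limit of such t, without
   which the limit would be meaningless. *)
Definition is_dderiv f a xi (l : R) :=
  (exists2 t : R, t != 0 & simplex (xi + t *: a)) /\
  (fun t : R => (f (xi + t *: a) - f xi) / t)
    @ within (fun t : R => simplex (xi + t *: a)) (0 : R)^' --> l.

(* l is the second derivative at 0 of s |-> f (xi + s a). *)
Definition is_dderiv2 f a xi (l : R) :=
  exists f1 : 'rV[R]_d -> R,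
    (\forall s \near (0 : R), simplex (xi + s *: a) ->
       is_dderiv f a (xi + s *: a) (f1 (xi + s *: a))) /\
    is_dderiv f1 a xi l.

(* C^2 up to the boundary: all tangential derivatives of order at most 2 exist
   in the interior and extend continuously to the closed simplex. Functions are
   total on 'rV[R]_d, but only their values on the simplex matter. *)
Definition C2_simplex f :=
  {within simplex, continuous f} /\
  forall a, tangent a -> exists fa : 'rV[R]_d -> R,
    [/\ {within simplex, continuous fa},
        forall xi, simplex_interior xi -> is_dderiv f a xi (fa xi) &
        forall b, tangent b -> exists fab : 'rV[R]_d -> R,
          {within simplex, continuous fab} /\
          forall xi, simplex_interior xi -> is_dderiv fa b xi (fab xi)].

(* Since the Hessian is symmetric, its operator norm on tangent vectors is the
   supremum of |a^T (Hess f) a| over unit tangent vectors a. *)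
Definition C2_norm f : R :=
  sup [set y | exists2 xi, simplex xi & y = `|f xi|] +
  sup [set y | exists xi a l, [/\ simplex xi, unit_tangent a,
                                  is_dderiv f a xi l & y = `|l|]] +
  sup [set y | exists xi a l, [/\ simplex xi, unit_tangent a,
                                  is_dderiv2 f a xi l & y = `|l|]].

End Simplex.

Variant mean_kind := Average | Logarithmic | Harmonic.

Definition gmean (R : realType) (k : mean_kind) (t r : R) : R :=
  match k with
  | Average => (t + r) / 2
  | Logarithmic =>
      if (t == 0) || (r == 0) then 0
      else if t == r then t else (t - r) / (ln t - ln r)
  | Harmonic =>
      if (t == 0) || (r == 0) then 0 else 2 / (t^-1 + r^-1)
  end.

Variant scheme_kind := LaxFriedrichs | OsherSethian.

Section Scheme.
Context (R : realType) (d : nat) (G : wgraph R d).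
Implicit Types (xi : 'rV[R]_d) (v : 'rV[R]_d -> R) (P Q gam : 'M[R]_d).

Definition gedge (k : mean_kind) xi (i j : 'I_d) : R :=
  gmean k (xi 0 i) (xi 0 j).

Definition inv_I2 xi : R :=
  if xi \in @simplex_interior R d then (\sum_i (xi 0 i)^-1) ^- 2 else 0.

Definition num_hamiltonian (s : scheme_kind) (k : mean_kind) gam xi P Q : R :=
  match s with
  | LaxFriedrichs =>
      2^-1 * inv_I2 xi *
      \sum_i \sum_(j | edge G i j && (i < j)%N)
        gedge k xi i j *
        ((P i j ^+ 2 + Q i j ^+ 2) / 2 - gam i j * (P i j - Q i j))
  | OsherSethian =>
      2^-1 * inv_I2 xi *
      \sum_i \sum_(j | edge G i j && (i < j)%N)
        gedge k xi i j *
        (Num.max (Q i j) 0 ^+ 2 + Num.min (P i j) 0 ^+ 2)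
  end.

Definition extrapolate v xi xi' : R :=
  if xi' \in @simplex R d then v xi' else v xi.

Definition Dplus (h : R) v xi (i j : 'I_d) : R :=
  extrapolate v xi (xi + h *: evec R i j) - v xi.

Definition Dminus (h : R) v xi (i j : 'I_d) : R :=
  v xi - extrapolate v xi (xi - h *: evec R i j).

Definition skew_diff (h : R) (D : 'I_d -> 'I_d -> R) : 'M[R]_d :=
  \matrix_(i, j)
    if (i < j)%N then Num.sqrt (weight G i j) / h * D i j
    else if (j < i)%N then - (Num.sqrt (weight G j i) / h * D j i)
    else 0.

(* u is a solution of the semi-discrete scheme on the time interval [0, T].
   On the boundary of the simplex inv_I2 vanishes, so that the equation
   degenerates there to u_t + F = 0; it determines the boundary values of u,
   which are used by the differences at interior points. *)
Definition semidiscrete_solution (s : scheme_kind) (k : mean_kind) gam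
    (T h : R) (U0 F : 'rV[R]_d -> R) (u : R -> 'rV[R]_d -> R) :=
  [/\ forall xi, simplex xi -> u 0 xi = U0 xi,
      forall xi, simplex xi -> {within `[0, T], continuous (fun t => u t xi)} &
      forall t xi, 0 < t < T -> simplex xi ->
        derivable (fun r : R => u r xi) t 1 /\
        derive1 (fun r : R => u r xi) t
        + num_hamiltonian s k gam xi (skew_diff h (Dplus h (u t) xi))
                                     (skew_diff h (Dminus h (u t) xi))
        + F xi = 0].

End Scheme.

(* Main.v *)
(** Both schemes have the form u_t + H(x, u) + F = 0 with
    H = sum_e a_e(x) theta(d_e), where e ranges over the ordered pairs of
    vertices, d_e = sqrt(omega_e) (u(x) - u(x + h e)) / h, and
    theta(d) = max(g + d, 0)^2 - g^2 with g = 0 for Osher-Sethian and g = 2 R0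
    for Lax-Friedrichs (as long as |d| <= g). On the finite set of points
    reached from a given point by mesh steps this is a monotone system of
    ordinary differential equations.

    The coefficients satisfy |a(x + v) - a(x)|^2 <= L a(x) |v|^2: being
    homogeneous means divided by the square of the sum of the 1/x_i, they vary
    relatively as fast as the coordinates do, and a(x) <= min_i x_i^2. The
    gradient bound is a discrete Bernstein argument: at a maximum over the
    lattice of the sum of the squared positive parts of all difference
    quotients, the variation of a is absorbed by this inequality, by the bound
    on a (theta(d) - 2 g d) that follows from bounds on u_t and on the lattice
    semiconcavity of u, and by the dissipation of the scheme. The resulting
    bound does not depend on g once h is small, so the choice g = 2 R0 is
    justified by continuity in time.

    The second estimate is the maximum principle for second differences: the
    perspective inequality for a theta(d) needs a^2 (1/a_+ + 1/a_- - 2/a) and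
    a_+ + a_- - 2 a to be at most L |v|^2. Directional derivatives are limits of
    increments between x + 2 r v and x + r v, x + 3 r v, which lie in one open
    mesh cell, so that the lattices through the three points correspond. *)

(* The main obstacle is a circle: the viscosity [g = 2 * R0] is fixed by the very gradient bound
   that it helps to prove. It is broken because in the error terms [g] appears only multiplied by
   [h]. The viscous part 2 g sum a d pairs each edge with its reverse and so becomes a sum of second
   differences, which are one order of h smaller; when the Bernstein argument takes increments of
   the coefficients, these second differences are paid by the dissipation. The constants up to [R0]
   are thus free of [g], while the semiconcavity constant K may depend on [R0], since it enters only
   through 2 R0 K h <= 1.

   A second obstacle is the boundary, where constant extrapolation destroys the commutation of mesh
   steps. Within a few steps of it the coefficients are O(h^2), and crude bounds suffice.

   The lattice sees increments of length h only. To reach shorter ones, the translate of u by a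
   small vector is carried along on the same lattice, and its difference with u, divided by the
   length, joins the sum of squares. The estimate is uniform in that length up to h. *)
Require Import Defs.
From mathcomp Require Import all_boot all_order all_algebra.
From mathcomp Require Import all_classical all_reals all_analysis.
From mathcomp Require Import ring lra.
Set Implicit Arguments.
Unset Strict Implicit.
Unset Printing Implicit Defensive.
Import Order.TTheory GRing.Theory Num.Theory.
Import numFieldNormedType.Exports.
Local Open Scope classical_set_scope.
Local Open Scope ring_scope.

(** * A maximum principle for finitely many functions of time *)

Section MaximumPrinciple.
Context {R : realType}.
Implicit Types (T C D M t : R).

Lemma derive_left_max_ge0 (g : R -> R) (tau l : R) : 0 < tau ->
  is_derive tau 1 g l -> (forall t, 0 < t < tau -> g t <= g tau) -> 0 <= l.
Proof.
move=> tau0 [dg <-] gmax.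
rewrite ['D_1 g tau]cvg_at_leftE //.
apply: limr_ge.
  rewrite -(cvg_at_leftE (fun h => h^-1 *: ((g \o shift tau) _ - g tau))) //.
  apply: cvg_trans dg; apply: cvg_app.
  move=> A [e egt0 Ae]; exists e => // x xe xgt0; apply: Ae => //.
  exact/ltr0_neq0.
near=> h.
have h0 : h < 0 by near: h; exists 1 => /=.
apply: mulr_le0; first by rewrite invr_le0 ltW.
rewrite subr_le0 [_%:A]mulr1; apply: gmax; near: h.
exists tau => // h; rewrite /= distrC subr0 => + h0.
by rewrite ltr0_norm // => ht; apply/andP; split; lra.
Unshelve. all: by end_near. Qed.

Lemma within_contM (A : set R) (f g : R -> R) :
  {within A, continuous f} -> {within A, continuous g} ->
  {within A, continuous (fun t => f t * g t)}.
Proof.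
by move=> cf cg t; apply: (@continuousM R (subspace A) f g t); [exact: cf|exact: cg].
Qed.

Lemma within_contB (A : set R) (f g : R -> R) :
  {within A, continuous f} -> {within A, continuous g} ->
  {within A, continuous (fun t => f t - g t)}.
Proof.
by move=> cf cg t; apply: (@continuousB _ _ (subspace A) f g t); [exact: cf|exact: cg].
Qed.

Lemma within_contD (A : set R) (f g : R -> R) :
  {within A, continuous f} -> {within A, continuous g} ->
  {within A, continuous (fun t => f t + g t)}.
Proof.
by move=> cf cg t; apply: (@continuousD _ _ (subspace A) f g t); [exact: cf|exact: cg].
Qed.

Lemma within_cont_cst (A : set R) (c : R) : {within A, continuous (fun=> c)}.
Proof. by move=> t; exact: cst_continuous. Qed.

Lemma within_cont_lin (A : set R) (c : R) : {within A, continuous (fun t => c * t)}.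
Proof. by apply: continuous_subspaceT => t; exact: mulrl_continuous. Qed.

Lemma within_cont_sum (A : set R) (I : finType) (f : I -> R -> R) :
  (forall i, {within A, continuous (f i)}) ->
  {within A, continuous (fun t => \sum_i f i t)}.
Proof.
move=> cf; have : forall r : seq I, {within A, continuous (fun t => \sum_(i <- r) f i t)}.
  elim=> [|i r IH].
    by under eq_fun do rewrite big_nil; exact: within_cont_cst.
  by under eq_fun do rewrite big_cons; exact: within_contD.
exact.
Qed.

Lemma is_derive_fsum (I : finType) (f : I -> R -> R) (df : I -> R) t :
  (forall i, is_derive t 1 (f i) (df i)) ->
  is_derive t 1 (fun t => \sum_i f i t) (\sum_i df i).
Proof.
move=> H; have : forall r : seq I,
    is_derive t 1 (fun t => \sum_(i <- r) f i t) (\sum_(i <- r) df i).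
  elim=> [|i r IH].
    by under eq_fun do rewrite big_nil; rewrite big_nil; exact: is_derive_cst.
  by under eq_fun do rewrite big_cons; rewrite big_cons; exact: is_deriveD.
exact.
Qed.

Lemma within_cont_eps (V : normedModType R) (A : set V) (g : V -> R) (c : V) (e : R) :
  {within A, continuous g} -> A c -> 0 < e ->
  exists2 eta, 0 < eta & forall t : V, A t -> `|t - c| < eta -> `|g t - g c| < e.
Proof.
move=> /subspace_continuousP cg Ac e0.
have /cvgr_dist_lt /(_ e e0) := cg c Ac.
rewrite near_withinE => /nbhs_ballP[eta /= eta0 H].
exists eta => // t At tc; rewrite distrC.
by apply: H => //; rewrite -ball_normE /= distrC.
Qed.

Lemma within_itv_sub (g : R -> R) (a b c d : R) : c <= a -> b <= d ->
  {within `[c, d], continuous g} -> {within `[a, b], continuous g}.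
Proof.
move=> ca bd; apply: continuous_subspaceW => x /=.
by rewrite !in_itv /= => /andP[? ?]; apply/andP; split; lra.
Qed.

Lemma within_itv_le_end (g : R -> R) (a b : R) : a < b ->
  {within `[a, b], continuous g} -> (forall t, a < t < b -> g t <= 0) ->
  g b <= 0.
Proof.
move=> ab /(continuous_within_itvP _ ab)[_ _ gb] gle.
rewrite -(cvg_lim _ gb) //; apply: limr_le; first by apply/cvg_ex; exists (g b).
near=> t; apply: gle.
by apply/andP; split; near: t; [exact: nbhs_left_gt|exact: nbhs_left_lt].
Unshelve. all: by end_near. Qed.

Lemma MVT_closed (f df : R -> R) (a b : R) : a <= b ->
  (forall t, a <= t <= b -> is_derive t 1 f (df t)) ->
  exists2 c, a <= c <= b & f b - f a = df c * (b - a).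
Proof.
move=> ab H; have [| |c] := @MVT_segment R f df a b ab.
- by move=> t; rewrite in_itv /= => /andP[/ltW h1 /ltW h2]; apply: H; rewrite h1.
- by apply: derivable_within_continuous => t; rewrite in_itv => /H[].
by rewrite in_itv; exists c.
Qed.

Lemma exists_seq_max (X : eqType) (s : seq X) (g : R -> X -> R) (a b : R) (x0 : X) :
  a <= b -> x0 \in s ->
  (forall x, x \in s -> {within `[a, b], continuous (g^~ x)}) ->
  exists x tau, [/\ x \in s, a <= tau <= b &
    forall y t, y \in s -> a <= t <= b -> g t y <= g tau x].
Proof.
move=> ab; elim: s x0 => [//|z s IH] x0 x0s cg.
have [tz tzab tzm] := EVT_max ab (cg z (mem_head _ _)).
rewrite in_itv /= in tzab.
have tzm' t : a <= t <= b -> g t z <= g tz z by move=> ?; apply: tzm; rewrite in_itv.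
case: s IH x0s cg => [|z' s] IH x0s cg.
  exists z, tz; split => //; first by rewrite mem_head.
  by move=> y t; rewrite inE => /eqP ->; exact: tzm'.
have [||x [tau [xs tauab xm]]] := IH z'; first by rewrite mem_head.
  by move=> x xs; apply: cg; rewrite in_cons xs orbT.
have [le|lt] := lerP (g tau x) (g tz z).
  exists z, tz; split; rewrite ?mem_head // => y t; rewrite in_cons => /orP[/eqP ->|ys] tab.
    exact: tzm'.
  exact: le_trans (xm _ _ ys tab) le.
exists x, tau; split => //; first exact: mem_behead.
move=> y t.
rewrite in_cons => /orP[/eqP ->|ys] tab; last exact: xm.
exact: le_trans (tzm' _ tab) (ltW lt).
Qed.

(** The differential inequality is asked only at a positive maximum over [s]. With the factor expR
    (- C t), which cancels the term C f, and the slope [D + e], the function [g e] would have a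
    negative derivative there, whereas a maximum over [s] and [0, t1] forces a nonnegative one from
    the left. *)
Lemma max_principle (X : eqType) (s : seq X) (T C D M : R) (f f' : R -> X -> R) :
  0 < T -> 0 <= D -> 0 <= M -> 0 <= C ->
  (forall x, x \in s -> {within `[0, T], continuous (f^~ x)}) ->
  (forall t x, 0 < t < T -> x \in s -> is_derive t 1 (f^~ x) (f' t x)) ->
  (forall x, x \in s -> f 0 x <= M) ->
  (forall t x, 0 < t < T -> x \in s -> (forall y, y \in s -> f t y <= f t x) ->
     0 < f t x -> f' t x <= C * f t x + D) ->
  forall t x, 0 <= t <= T -> x \in s -> f t x <= (M + D * t) * expR (C * t).
Proof.
move=> T0 D0 M0 C0 cf df f0 hf.
pose g (e t : R) (x : X) := expR (- C * t) * f t x - (D + e) * t - M.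
have cg e x : x \in s -> {within `[0, T], continuous (g e ^~ x)}.
  move=> xs; rewrite /g; apply: within_contB; last exact: within_cont_cst.
  apply: within_contB; last exact: within_cont_lin.
  apply: within_contM; last exact: cf.
  apply: continuous_subspaceT => t.
  by apply: continuous_comp; [exact: mulrl_continuous|exact: continuous_expR].
have main e : 0 < e -> forall t x, 0 < t < T -> x \in s -> g e t x <= 0.
  move=> e0 t1 x1 /andP[t10 t1T] x1s; rewrite leNgt; apply/negP => gpos.
  have cg1 x : x \in s -> {within `[0, t1], continuous (g e ^~ x)}.
    by move=> xs; apply: within_itv_sub (cg e x xs) => //; exact: ltW.
  have [x [tau [xs /andP[tau0 taut1] gm]]] := exists_seq_max (ltW t10) x1s cg1.
  have gxpos : 0 < g e tau x by apply: lt_le_trans gpos (gm _ _ x1s _); rewrite ltW //=.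
  have Ep := expR_gt0 (- C * tau).
  have taup : 0 < tau.
    rewrite lt_def tau0 andbT; apply/eqP => tau00; move: gxpos.
    rewrite /g tau00 !mulr0 expR0 mul1r subr0 subr_gt0 ltNge => /negP; apply.
    exact: f0.
  have tauT : 0 < tau < T by rewrite taup (le_lt_trans taut1).
  have fpos : 0 < f tau x.
    rewrite -(pmulr_rgt0 _ Ep); move: gxpos; rewrite /g.
    have : 0 <= (D + e) * tau by apply: mulr_ge0 => //; lra.
    by move=> ? ?; lra.
  have fm y : y \in s -> f tau y <= f tau x.
    move=> ys; rewrite -(ler_pM2l Ep).
    by have := gm y tau ys; rewrite tau0 taut1 /g => /(_ isT) ?; lra.
  have dg : is_derive tau 1 (g e ^~ x) (expR (- C * tau) * (f' tau x - C * f tau x) - (D + e)).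
    rewrite /g.
    have dE : is_derive tau 1 (fun t => expR (- C * t)) (- C * expR (- C * tau)).
      have := @is_derive1_comp _ expR (fun t => - C * t) tau _ _
        (is_derive_expR _) (is_deriveZ (- C) (is_derive_id tau 1)).
      move=> H; apply: is_derive_eq H _.
      by rewrite -[(- C) *: 1]/(- C * 1) mulr1 mulrC.
    have H := is_deriveB (is_deriveB (is_deriveM dE (df tau x tauT xs))
      (is_deriveZ (D + e) (is_derive_id tau 1))) (is_derive_cst M tau 1).
    apply: is_derive_eq H _.
    rewrite /GRing.scale /=; ring.
  have := derive_left_max_ge0 taup dg.
  have gm' t : 0 < t < tau -> g e t x <= g e tau x.
    by move=> /andP[? ?]; apply: gm => //; apply/andP; split; lra.
  move=> /(_ gm').
  have := hf tau x tauT xs fm fpos.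
  rewrite -lerBlDl.
  move=> /(ler_wpM2l (ltW Ep)) h1.
  have E1 : expR (- C * tau) <= 1.
    by rewrite expR_le1 mulNr oppr_le0 mulr_ge0.
  have := ler_wpM2r D0 E1.
  lra.
move=> t x /andP[t0 tT] xs.
have gle e : 0 < e -> g e t x <= 0.
  move=> e0.
  have [t00|tn0] := eqVneq t 0.
    rewrite t00 /g !mulr0 expR0 mul1r subr0 subr_le0; exact: f0.
  have tp : 0 < t by rewrite lt_def tn0.
  have [tT'|tT'|tT'] := ltgtP t T; first by apply: main => //; rewrite tp.
    lra.
  (* At [t = T] the inequality is not assumed; the bound arrives from the left by continuity. *)
  rewrite tT'; apply: (within_itv_le_end (g := g e ^~ x) T0); first exact: cg.
  by move=> t' ht'; exact: main.
have g0 : g 0 t x <= 0.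
  apply/ler_addgt0Pr => e e0; rewrite add0r.
  have [t00|tn0] := eqVneq t 0.
    by have := gle e e0; rewrite t00 /g !mulr0 => ?; lra.
  have tp : 0 < t by rewrite lt_def tn0.
  have := gle (e / t) (divr_gt0 e0 tp); rewrite /g mulrDl divfK // => ?; lra.
move: g0; rewrite /g addr0.
have -> : - C * t = - (C * t) by rewrite mulNr.
rewrite expRN mulrC => H.
have : f t x / expR (C * t) <= M + D * t by lra.
by rewrite ler_pdivrMr ?expR_gt0.
Qed.

(** Continuity argument: let [c] be the supremum of the times up to which the weak bound [b2] holds.
    Then [step] improves it to [b1] on [0, c], and by continuity the finitely many functions stay
    below [b2] a little longer, so [c] cannot be less than T. *)
Lemma bootstrap (X : eqType) (s : seq X) (T b1 b2 : R) (f : R -> X -> R) :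
  0 < T -> b1 < b2 ->
  (forall x, x \in s -> {within `[0, T], continuous (f^~ x)}) ->
  (forall x, x \in s -> f 0 x <= b1) ->
  (forall t1, 0 < t1 <= T ->
    (forall t x, 0 <= t <= t1 -> x \in s -> f t x <= b2) ->
    (forall t x, 0 <= t <= t1 -> x \in s -> f t x <= b1)) ->
  forall t x, 0 <= t <= T -> x \in s -> f t x <= b2.
Proof.
move=> T0 b12 cf f0 step.
have ext c : 0 <= c < T -> (forall x, x \in s -> f c x <= b1) ->
    exists2 e, 0 < e & forall t x, x \in s -> 0 <= t <= T -> `|t - c| < e -> f t x <= b2.
  move=> /andP[c0 cT] fc.
  have cT' : 0 <= c <= T by rewrite c0 ltW.
  elim: s cf fc {f0 step} => [|z r IH] cf fc; first by exists 1.
  have [||e1 e10 h1] := IH.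
  - by move=> x xr; apply: cf; exact: mem_behead.
  - by move=> x xr; apply: fc; exact: mem_behead.
  have [||e2 e20 h2] := within_cont_eps (cf z (mem_head _ _)) (c := c) (e := b2 - b1).
  - by rewrite /= in_itv.
  - by rewrite subr_gt0.
  exists (Num.min e1 e2); first by rewrite lt_min e10.
  move=> t x; rewrite in_cons => /orP[/eqP ->|xr] tT; rewrite lt_min => /andP[t1 t2].
    have := h2 t; rewrite /= in_itv /= => /(_ tT t2); rewrite ltr_norml => /andP[_ ?].
    by have := fc z (mem_head _ _); lra.
  exact: h1.
pose S := [set t | 0 <= t <= T /\ forall t' x, 0 <= t' <= t -> x \in s -> f t' x <= b2].
have S0 : S 0.
  split; first by rewrite lexx ltW.
  move=> t' x t'0 xs; have -> : t' = 0 by lra.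
  by have := f0 x xs; lra.
have supS : has_sup S by split; [exists 0|exists T => t [/andP[]]].
pose c := sup S.
have c0 : 0 <= c by apply: ub_le_sup => //; case: supS.
have cT : c <= T by apply: ge_sup => [|t [/andP[]]//]; exists 0.
have below t x : 0 <= t < c -> x \in s -> f t x <= b2.
  move=> /andP[t0 tc] xs.
  have [t' [t'T h'] tt'] := sup_adherent (eps := c - t) (E := S) ltac:(lra) supS.
  by apply: h' => //; rewrite t0 /=; rewrite -/c in tt'; lra.
have atc x : x \in s -> f c x <= b1.
  have [c00|cn0] := eqVneq c 0; first by rewrite c00; exact: f0.
  have cp : 0 < c by rewrite lt_def cn0.
  move=> xs; apply: (step c); rewrite ?cp ?c0 ?lexx //.
  move=> t y /andP[t0 tc] ys.
  have [|ge] := ltP t c; first by move=> ?; apply: below => //; rewrite t0.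
  have -> : t = c by lra.
  rewrite -subr_le0.
  apply: (within_itv_le_end (g := fun t => f t y - b2) cp).
    apply: within_contB; last exact: within_cont_cst.
    exact: within_itv_sub (cf y ys).
  by move=> t' /andP[t'0 t'c]; rewrite subr_le0; apply: below => //; rewrite ltW.
have [cT'|cT'] := ltP c T; last first.
  move=> t x /andP[t0 tT] xs.
  have [tc|tc] := ltP t c; first by apply: below => //; rewrite t0.
  have -> : t = c by lra.
  by have := atc x xs; lra.
have [|e e0 he] := ext c _ atc; first by rewrite c0.
exfalso.
pose c' := Num.min T (c + e / 2).
have cc' : c < c' by rewrite lt_min cT' ltrDl divr_gt0.
have : c' <= c; last by lra.
apply: ub_le_sup; first by case: supS.
split; first by rewrite ge_min lexx /= andbT; lra.
move=> t x /andP[t0]; rewrite le_min => /andP[tT tce] xs.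
have [tc|tc] := ltP t c; first by apply: below => //; rewrite t0.
apply: he => //; first by rewrite t0.
by rewrite ger0_norm; lra.
Qed.

End MaximumPrinciple.

(** * Squares of positive parts *)

Section PositivePart.
Context {R : realType}.
Implicit Types (x y g d : R).

Definition pos x := Num.max x 0.

Lemma pos_ge0 x : 0 <= pos x.
Proof. by rewrite /pos le_max lexx orbT. Qed.

Lemma pos_ge x : x <= pos x.
Proof. by rewrite /pos le_max lexx. Qed.

Lemma pos_id x : 0 <= x -> pos x = x.
Proof. by move=> x0; apply/max_idPl. Qed.

Lemma pos_eq0 x : x <= 0 -> pos x = 0.
Proof. by move=> x0; apply/max_idPr. Qed.

Lemma pos_le x y : x <= y -> 0 <= y -> pos x <= y.
Proof. by move=> xy y0; rewrite /pos ge_max xy. Qed.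

(** Serves the square of the positive part, whose second derivative jumps at 0 but whose first-order
    remainder is at most h^2. *)
Lemma is_derive_quadratic (F : R -> R) x l :
  (forall h, `|F (x + h) - F x - l * h| <= h ^+ 2) -> is_derive x 1 F l.
Proof.
move=> H.
have dF : h^-1 *: ((F \o shift x) h%:A - F x) @[h --> 0^'] --> l.
  apply/cvgrPdist_le => e e0; near=> h.
  have h0 : h != 0 by near: h; exact: nbhs_dnbhs_neq.
  have he : `|h| <= e.
    near: h; exists e => // h /=; rewrite sub0r normrN => he _; exact: ltW.
  have := H h; rewrite /= /GRing.scale /= mulr1 [h + x]addrC => Hh.
  have -> : l - h^-1 * (F (x + h) - F x) = - (h^-1 * (F (x + h) - F x - l * h)).
    by field.
  rewrite normrN normrM normfV ler_pdivrMl ?normr_gt0 //.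
  apply: le_trans Hh _; rewrite -real_normK ?num_real // expr2 ler_wpM2l //.
split; first by apply/cvg_ex; exists l.
exact: cvg_lim dF.
Unshelve. all: by end_near. Qed.

Lemma is_derive_possq x : is_derive x 1 (fun y => pos y ^+ 2) (2 * pos x).
Proof.
apply: is_derive_quadratic => h.
have [x0|x0] := lerP 0 x; rewrite ?(pos_id x0) ?(pos_eq0 (ltW x0));
  (have [xh|xh] := lerP 0 (x + h); rewrite ?(pos_id xh) ?(pos_eq0 (ltW xh)));
  rewrite ler_norml; apply/andP; split; nra.
Qed.

Lemma is_derive_possq_comp (f : R -> R) (t df : R) : is_derive t 1 f df ->
  is_derive t 1 (fun t => pos (f t) ^+ 2) (2 * pos (f t) * df).
Proof.
move=> H; exact: (is_derive1_comp (f := fun y => pos y ^+ 2) (is_derive_possq (f t)) H).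
Qed.

Lemma within_cont_possq (A : set R) (f : R -> R) : {within A, continuous f} ->
  {within A, continuous (fun t => pos (f t) ^+ 2)}.
Proof.
move=> cf t; apply: (@continuous_comp (subspace A) R R f (fun y => pos y ^+ 2)).
  exact: cf.
apply: differentiable_continuous; apply/derivable1_diffP.
by case: (is_derive_possq (f t)).
Qed.

Definition theta g d := pos (g + d) ^+ 2 - g ^+ 2.
Definition dtheta g d := 2 * pos (g + d).

Lemma dtheta_ge0 g d : 0 <= dtheta g d.
Proof. by rewrite mulr_ge0 ?pos_ge0. Qed.

(** Convexity of [theta g], whose derivative is [dtheta g]. *)
Lemma theta_tangent g d d' : dtheta g d * (d' - d) <= theta g d' - theta g d.
Proof.
rewrite /theta /dtheta.
have w0 := pos_ge0 (g + d'); have wge := pos_ge (g + d').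
have p0 := pos_ge0 (g + d).
have : pos (g + d) * (g + d) = pos (g + d) ^+ 2.
  have [x0|x0] := lerP 0 (g + d); rewrite ?(pos_id x0) ?(pos_eq0 (ltW x0)) //.
  by rewrite mul0r expr0n.
have := ler_wpM2l p0 wge.
have := sqr_ge0 (pos (g + d') - pos (g + d)).
nra.
Qed.

Lemma theta_mono g d d' : d <= d' -> theta g d <= theta g d'.
Proof.
move=> dd'; rewrite -subr_ge0; apply: le_trans (theta_tangent g d d').
by rewrite mulr_ge0 ?dtheta_ge0 // subr_ge0.
Qed.

(** The excess of [theta] over the viscous part 2 g d is what is left of the Hamiltonian once the
    viscosity is removed. It equals d^2 while g + d >= 0, and d^2 - (g + d)^2 otherwise. *)
Lemma theta_excess_ge0 g d : 0 <= g -> 0 <= theta g d - 2 * g * d.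
Proof.
move=> g0; rewrite /theta.
have [x0|x0] := lerP 0 (g + d); rewrite ?(pos_id x0) ?(pos_eq0 (ltW x0)); nra.
Qed.

Lemma theta_excess_le g d : theta g d - 2 * g * d <= d ^+ 2.
Proof.
rewrite /theta.
have [x0|x0] := lerP 0 (g + d); rewrite ?(pos_id x0) ?(pos_eq0 (ltW x0)); nra.
Qed.

Lemma theta_abs_le g d : 0 <= g -> `|theta g d| <= 2 * g * `|d| + d ^+ 2.
Proof.
move=> g0; have h1 := theta_excess_ge0 d g0; have h2 := theta_excess_le g d.
have a1 := ler_norm d; have a2 := ler_norm (- d); rewrite normrN in a2.
have := ler_wpM2l g0 a1; have := ler_wpM2l g0 a2.
rewrite ler_norml => *; apply/andP; split; nra.
Qed.

(** Tangent plane inequality for x^2 / b, the perspective of the square, jointly convex in x and b =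
    1 / a. Hence the difference of the reciprocals of the coefficients; the part - g^2 of [theta]
    contributes the difference of the coefficients themselves. *)
Lemma theta_perspective g d0 d1 a0 a1 : 0 < a0 -> 0 < a1 ->
  a0 * theta g d0 + a0 * dtheta g d0 * (d1 - d0)
    - pos (g + d0) ^+ 2 * (a0 ^+ 2 * (a1^-1 - a0^-1)) + g ^+ 2 * (a0 - a1)
  <= a1 * theta g d1.
Proof.
move=> a00 a10; rewrite /theta /dtheta.
set x0 := pos (g + d0); set x1 := pos (g + d1).
have key : 2 * a0 * x0 * (g + d1) - x0 ^+ 2 * a0 ^+ 2 / a1 <= a1 * x1 ^+ 2.
  have x00 : 0 <= x0 := pos_ge0 _; have x1ge : g + d1 <= x1 := pos_ge _.
  apply: le_trans (_ : 2 * a0 * x0 * x1 - x0 ^+ 2 * a0 ^+ 2 / a1 <= _).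
    by rewrite lerD2r ler_wpM2l // !mulr_ge0 // ltW.
  rewrite -subr_ge0.
  have -> : a1 * x1 ^+ 2 - (2 * a0 * x0 * x1 - x0 ^+ 2 * a0 ^+ 2 / a1) =
    (a1 * x1 - a0 * x0) ^+ 2 / a1 by field; rewrite gt_eqF.
  by rewrite divr_ge0 ?sqr_ge0 // ltW.
have tang : 2 * a0 * x0 * (d1 - d0) = 2 * a0 * x0 * (g + d1) - 2 * a0 * x0 ^+ 2.
  have : x0 * (g + d0) = x0 ^+ 2.
    rewrite /x0; have [h0|h0] := lerP 0 (g + d0); rewrite ?(pos_id h0) ?(pos_eq0 (ltW h0)) //.
    by rewrite mul0r expr0n.
  by move=> E; rewrite -E; ring.
have E2 : x0 ^+ 2 * (a0 ^+ 2 * (a1^-1 - a0^-1)) = x0 ^+ 2 * a0 ^+ 2 / a1 - a0 * x0 ^+ 2.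
  by field; rewrite !gt_eqF.
rewrite E2; lra.
Qed.

(** Two tangent plane inequalities at the same base point add up to the second difference of [d]
    with a nonnegative factor, and to the second differences of [a] and of its reciprocal. *)
Lemma theta_second_diff g rho a0 a1 a2 d0 d1 d2 : 0 < a0 -> 0 < a1 -> 0 < a2 ->
  a0 ^+ 2 * (a1^-1 + a2^-1 - 2 * a0^-1) <= rho -> a1 + a2 - 2 * a0 <= rho ->
  0 <= d1 + d2 - 2 * d0 ->
  - rho * (pos (g + d0) ^+ 2 + g ^+ 2) <=
    a1 * theta g d1 + a2 * theta g d2 - 2 * (a0 * theta g d0).
Proof.
move=> a00 a10 a20 h1 h2 hd.
have p1 := theta_perspective g d0 d1 a00 a10.
have p2 := theta_perspective g d0 d2 a00 a20.
have q1 := ler_wpM2l (sqr_ge0 (pos (g + d0))) h1.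
have q2 := ler_wpM2l (sqr_ge0 g) h2.
have q3 : 0 <= a0 * dtheta g d0 * (d1 + d2 - 2 * d0).
  by apply: mulr_ge0 => //; apply: mulr_ge0; [exact: ltW|exact: dtheta_ge0].
nra.
Qed.

(* The loss [z - y] of the positive parts is kept: it is the dissipation that
   absorbs the viscosity terms. *)
Lemma weighted_transport y z a a' r : 0 <= a -> 0 <= a' -> 0 <= r ->
  (a' - a) ^+ 2 <= r * a ->
  2 * pos y * a' * (z - y) <=
    a * (pos z ^+ 2 - pos y ^+ 2 - (pos z - pos y) ^+ 2 / 2) + 2 * r * pos y ^+ 2.
Proof.
move=> a0 a'0 r0 ha.
have zz := pos_ge z; have z0 := pos_ge0 z; move: (pos z) zz z0 => w zw w0.
have [y0|y0] := lerP 0 y; last first.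
  rewrite (pos_eq0 (ltW y0)); have : 0 <= a * w ^+ 2 by rewrite mulr_ge0 ?sqr_ge0.
  lra.
rewrite (pos_id y0).
apply: le_trans (_ : 2 * y * a' * (w - y) <= _).
  by rewrite ler_wpM2l ?lerD2r // !mulr_ge0.
rewrite -subr_ge0.
have -> : a * (w ^+ 2 - y ^+ 2 - (w - y) ^+ 2 / 2) + 2 * r * y ^+ 2 - 2 * y * a' * (w - y)
  = a / 2 * (w - y) ^+ 2 + 2 * r * y ^+ 2 - 2 * (a' - a) * y * (w - y) by field.
have [a00|an0] := eqVneq a 0.
  have : (a' - a) ^+ 2 <= 0 by rewrite (le_trans ha) // a00 mulr0.
  rewrite le_eqVlt ltNge sqr_ge0 orbF sqrf_eq0 => /eqP ->.
  by rewrite a00 !mulr0 !mul0r subr0 add0r mulr_ge0 ?sqr_ge0 ?mulr_ge0.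
have ap : 0 < a by rewrite lt_def an0.
(* Times [a], the claim reads A^2 / 2 - 2 A B + 2 r a y^2 >= 0 with A = a (w - y) and B = (a' - a)
   y. Since r a y^2 >= B^2, the left side is at least half the square of A - 2 B. *)
rewrite -(pmulr_rge0 _ ap).
have : (a' - a) ^+ 2 * y ^+ 2 <= r * a * y ^+ 2 by rewrite ler_wpM2r ?sqr_ge0.
have : 0 <= (a * (w - y) / 2 - (a' - a) * y) ^+ 2 by exact: sqr_ge0.
have : 0 <= (a * (w - y)) ^+ 2 by exact: sqr_ge0.
have : 0 <= ((a' - a) * y) ^+ 2 by exact: sqr_ge0.
nra.
Qed.

End PositivePart.

(** * The Bernstein estimate at a point *)

Ltac ge0 := repeat match goal with
  | |- is_true (0 <= _ ^+ 2) => exact: sqr_ge0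
  | |- is_true (0 <= _ * _) => apply: mulr_ge0
  | |- is_true (0 <= _ + _) => apply: addr_ge0
  | |- is_true (0 <= _^-1) => rewrite invr_ge0
  | |- is_true (0 <= _%:R) => exact: ler0n
  | |- is_true (0 <= pos _) => exact: pos_ge0
  | |- is_true (0 <= dtheta _ _) => exact: dtheta_ge0
  | |- _ => first [assumption | by apply: ltW | done | exact: dtheta_ge0 | exact: sqr_ge0]
  end.

Ltac le_ring := rewrite le_eqVlt; apply/orP; left; apply/eqP; ring.

(** An edge and its reverse carry the same coefficient, so a weighted sum of first differences is
    half a weighted sum of second differences. *)
Lemma sum_sym (R : realType) (E : finType) (rev : E -> E) (b f : E -> R) : involutive rev ->
  (forall e, b (rev e) = b e) -> \sum_e b e * f e = 2^-1 * \sum_e b e * (f e + f (rev e)).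
Proof.
move=> revK hb.
have -> : \sum_e b e * (f e + f (rev e)) = \sum_e b e * f e + \sum_e b e * f e.
  under eq_bigr do rewrite mulrDr.
  rewrite big_split /=; congr (_ + _).
  by rewrite (reindex_inj (inv_inj revK)) /=; apply: eq_bigr => e _; rewrite revK hb.
by field.
Qed.

Section Bernstein.
Context {R : realType} {X : eqType} {E : finType}.
Context (rev : E -> E) (nb : E -> X -> X) (wt : E -> R) (h g : R).
Implicit Types (a : X -> E -> R) (U V F : X -> R) (x : X) (e : E).

Definition ndiff U x e := wt e * ((U x - U (nb e x)) / h).
Definition ham a U x := \sum_e a x e * theta g (ndiff U x e).

Context (sg : R) (a ap : X -> E -> R) (U V F Fp : X -> R).

(* [None] stands for the additional direction, in which [V] is the translate of [U]. *)
Definition shiftU (i : option E) x := if i is Some e then U (nb e x) else V x.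
Definition shiftF (i : option E) x := if i is Some e then F (nb e x) else Fp x.
Definition shiftA (i : option E) x := if i is Some e then a (nb e x) else ap x.
Definition step (i : option E) := if i is Some e then h else sg.
Definition shiftH (i : option E) x := if i is Some e then ham a U (nb e x) else ham ap V x.
Definition slope i x := (shiftU i x - U x) / step i.
(** The time derivative of [slope] along a solution, each time derivative being replaced through the
    equation by minus Hamiltonian minus source. *)
Definition slope_dot i x :=
  - ((shiftH i x + shiftF i x) - (ham a U x + F x)) / step i.
Definition gradsq x := \sum_i pos (slope i x) ^+ 2.

Context (x : X) (L LF E2 Om Thb Ca : R).
Let N : R := #|E|%:R.
Let m := gradsq x.

Hypothesis h0 : 0 < h.
Hypothesis g0 : 0 <= g.
Hypothesis sg0 : 0 < sg.
Hypothesis sgh : sg <= h.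
Hypothesis L0 : 0 <= L.
Hypothesis Om0 : 0 <= Om.
Hypothesis Ca0 : 0 <= Ca.
Hypothesis wt0 : forall e, 0 <= wt e.
Hypothesis wtOm : forall e, wt e <= Om.
Hypothesis wtrev : forall e, wt (rev e) = wt e.
Hypothesis revK : involutive rev.
Hypothesis a0 : forall e, 0 <= a x e.
Hypothesis sA0 : forall i e, 0 <= shiftA i x e.
Hypothesis arev : forall e, a x (rev e) = a x e.
Hypothesis sArev : forall i e, shiftA i x (rev e) = shiftA i x e.
Hypothesis FL : forall i, `|shiftF i x - F x| <= LF * step i.
Hypothesis mmax : forall e, gradsq (nb e x) <= m.
Hypothesis dsmall : forall e, h * (g + `|ndiff U x e|) <= 1.

Lemma pos_slope_le i : pos (slope i x) ^+ 2 <= m.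
Proof.
rewrite /m /gradsq (bigD1 i) //= lerDl sumr_ge0 // => *; exact: sqr_ge0.
Qed.

Lemma pos_slope_nb_le i e : pos (slope i (nb e x)) ^+ 2 <= m.
Proof.
apply: le_trans (mmax e).
rewrite /gradsq (bigD1 i) //= lerDl sumr_ge0 // => *; exact: sqr_ge0.
Qed.

Lemma gradsq_ge0 : 0 <= m.
Proof. by rewrite /m /gradsq sumr_ge0 // => *; exact: sqr_ge0. Qed.

Lemma step_gt0 i : 0 < step i.
Proof. by case: i. Qed.

Lemma step_le i : step i <= h.
Proof. by case: i. Qed.

Lemma dtheta_step_le e : dtheta g (ndiff U x e) * h <= 2.
Proof.
have := dsmall e; have : pos (g + ndiff U x e) <= g + `|ndiff U x e|.
  by apply: pos_le; rewrite ?addr_ge0 // lerD2l ler_norm.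
move=> /(ler_wpM2l (ltW h0)) H1 H2; rewrite /dtheta.
have : h * pos (g + ndiff U x e) <= 1 by exact: le_trans H1 H2.
lra.
Qed.

Section Interior.
Hypothesis nbC : forall e e', nb e (nb e' x) = nb e' (nb e x).
Hypothesis nbK : forall e, nb (rev e) (nb e x) = x.
Hypothesis AL : forall i e, (shiftA i x e - a x e) ^+ 2 <= L * a x e * step i ^+ 2.
Hypothesis energy : forall e,
  a x e * (theta g (ndiff U x e) - 2 * g * ndiff U x e) <= E2.
Hypothesis dissip : forall e, g <= dtheta g (ndiff U x e).

Let d e := ndiff U x e.
Let dt e := dtheta g (d e).
Let y i := slope i x.
Let ye i e := slope i (nb e x).
Local Notation dth i e :=
  (theta g (d e + wt e * (step i / h) * (y i - ye i e)) - theta g (d e)).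

Lemma nbK' e : nb e (nb (rev e) x) = x.
Proof. by rewrite -{1}[e]revK nbK. Qed.

(** Since mesh steps commute here, the shifted Hamiltonian can be read on the edges at [x], each
    difference being perturbed by the variation of the slope [i] along the edge. *)
Lemma shift_ham i : shiftH i x =
  \sum_e shiftA i x e * theta g (d e + wt e * (step i / h) * (y i - ye i e)).
Proof.
have st := lt0r_neq0 (step_gt0 i).
have hn := lt0r_neq0 h0.
case: i st => [e'|] st /=; apply: eq_bigr => e _; congr (_ * theta g _);
  rewrite /d /y /ye /ndiff /slope /= ?(nbC e e'); field => //.
by rewrite st.
Qed.

Lemma y_rev e : ye (Some e) (rev e) = - y (Some (rev e)).
Proof. by rewrite /ye /y /slope /= nbK' -mulNr opprB. Qed.

(** [gradsq] controls positive parts only. A negative slope along [e] is, up to sign, a positive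
    slope along [rev e] at the neighbour, where [gradsq] is at most [m] as well. *)
Lemma d_sq_le e : d e ^+ 2 <= Om ^+ 2 * m.
Proof.
have -> : d e = - (wt e * y (Some e)).
  by rewrite /d /y /slope /ndiff /= -mulrN -mulNr opprB.
rewrite sqrrN exprMn.
have W : wt e ^+ 2 <= Om ^+ 2 by rewrite ler_sqr ?nnegrE.
apply: ler_pM => //; rewrite ?sqr_ge0 //.
have [y0|y0] := lerP 0 (y (Some e)).
  by rewrite -{1}(pos_id y0) pos_slope_le.
have : 0 <= - y (Some e) by rewrite oppr_ge0 ltW.
rewrite -sqrrN => yn; rewrite -(pos_id yn).
by have := y_rev (rev e); rewrite revK => <-; exact: pos_slope_nb_le.
Qed.

Let De i e := pos (ye i e) - pos (y i).
(** The part of the dissipation that is kept: along each edge [e], the jump of the slope in the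
    reverse direction alone. *)
Let S := \sum_e wt e * a x e * De (Some (rev e)) e ^+ 2.
(** Weight in Young's inequality, chosen so that the viscosity errors of all [N + 1] directions add
    up to (2 h)^-1 g S, the amount that the dissipation supplies. *)
Let lam := (4 * (N + 1) * h)^-1.

Lemma N_ge0 : 0 <= N. Proof. exact: ler0n. Qed.

Lemma lam_gt0 : 0 < lam.
Proof. by rewrite invr_gt0 !mulr_gt0 // ltr_wpDl ?ler0n. Qed.

(** Because pos (- z) - pos z = - z, a second difference of [U] is a sum of two jumps of positive
    parts, which are the quantities that the dissipation controls. *)
Lemma d_rev e : d e + d (rev e) = wt e * (De (Some e) (rev e) + De (Some (rev e)) e).
Proof.
have y2 : ye (Some (rev e)) e = - y (Some e) by have := y_rev (rev e); rewrite revK.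
rewrite /De y_rev y2 /d /ndiff wtrev -mulrDr; congr (_ * _).
rewrite /y /slope /=.
have P (z : R) : pos (- z) = pos z - z.
  have [z0|z0] := lerP 0 z.
    by rewrite (pos_id z0) pos_eq0 ?subrr // oppr_le0.
  by rewrite (pos_eq0 (ltW z0)) pos_id ?sub0r // oppr_ge0 ltW.
rewrite !P; field; exact: lt0r_neq0.
Qed.

Let Xe i e := (shiftA i x e - a x e) / step i.

Lemma X_sq i e : Xe i e ^+ 2 <= L * a x e.
Proof. by rewrite /Xe expr_div_n ler_pdivrMr ?AL // exprn_gt0 // step_gt0. Qed.

(** After pairing edges with their reverses, [d_rev] and Young's inequality with weight [lam] apply;
    [X_sq] makes the coefficient [a] appear next to the squared jumps. *)
Lemma viscosity_term i :
  - (2 * pos (y i)) * (2 * g * \sum_e Xe i e * d e) <=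
    2 * g * lam * S + 2 * g * Om * N * L / lam * pos (y i) ^+ 2.
Proof.
have l0 := lam_gt0.
rewrite (sum_sym _ revK) => [|e]; last by rewrite /Xe sArev arev.
have -> : - (2 * pos (y i)) * (2 * g * (2^-1 * \sum_e Xe i e * (d e + d (rev e))))
  = \sum_e - (2 * pos (y i)) * (g * (Xe i e * (d e + d (rev e)))).
  by rewrite -mulr_sumr -mulr_sumr; field.
apply: le_trans (_ : \sum_e (g * lam * (wt e * a x e * De (Some e) (rev e) ^+ 2
   + wt e * a x e * De (Some (rev e)) e ^+ 2) + 2 * g * Om * L / lam * pos (y i) ^+ 2) <= _).
  apply: ler_sum => e _; rewrite d_rev.
  have X2 := X_sq i e.
  have P0 := pos_ge0 (y i).
  have A (D : R) : - (2 * pos (y i)) * (Xe i e * D) <=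
      lam * a x e * D ^+ 2 + L / lam * pos (y i) ^+ 2.
    have [Lz|Ln] := eqVneq L 0.
      have X0 : Xe i e = 0.
        have : Xe i e ^+ 2 <= 0 by rewrite (le_trans X2) // Lz mul0r.
        by rewrite le_eqVlt ltNge sqr_ge0 orbF sqrf_eq0 => /eqP.
      rewrite X0 Lz !mul0r mulr0 addr0; ge0.
    have Lp : 0 < L by rewrite lt_def Ln.
    have Lla : 0 < lam / L by rewrite divr_gt0.
    have H1 : lam / L * Xe i e ^+ 2 * D ^+ 2 <= lam * a x e * D ^+ 2.
      rewrite ler_wpM2r ?sqr_ge0 //; have := ler_wpM2l (ltW Lla) X2.
      by have -> : lam / L * (L * a x e) = lam * a x e by field; rewrite gt_eqF.
    have H2 : 0 <= lam / L * (Xe i e * D + L / lam * pos (y i)) ^+ 2.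
      ge0.
    have H3 : lam / L * (Xe i e * D + L / lam * pos (y i)) ^+ 2 =
      lam / L * Xe i e ^+ 2 * D ^+ 2 + 2 * pos (y i) * (Xe i e * D) + L / lam * pos (y i) ^+ 2.
      by field; rewrite !gt_eqF.
    lra.
  have A1 := A (De (Some e) (rev e)); have A2 := A (De (Some (rev e)) e).
  have gw : 0 <= g * wt e by rewrite mulr_ge0.
  have B1 := ler_wpM2l gw (lerD A1 A2).
  have B2 : g * wt e * (2 * (L / lam * pos (y i) ^+ 2)) <= g * Om * (2 * (L / lam * pos (y i) ^+ 2)).
    apply: ler_wpM2r; last by rewrite ler_wpM2l.
    ge0.
  lra.
rewrite big_split /= -mulr_sumr big_split /=.
have -> : \sum_e wt e * a x e * De (Some e) (rev e) ^+ 2 = S.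
  rewrite /S (reindex_inj (inv_inj revK)) /=; apply: eq_bigr => e _.
  by rewrite revK wtrev arev.
rewrite sumr_const -[X in _ + X]mulr_natr -/N.
by rewrite -/S; le_ring.
Qed.

(** The excess of [theta] is quadratic in the slopes, so its product with [pos (y i)] is cubic. In
    its square, one factor is absorbed by [energy] together with the coefficient, and only the other
    is bounded by [m]; the growth stays linear in [m]. *)
Lemma quadratic_term i :
  - (2 * pos (y i)) * (\sum_e Xe i e * (theta g (d e) - 2 * g * d e)) <=
    N * pos (y i) ^+ 2 + N * (L * E2 * Om ^+ 2) * m.
Proof.
rewrite mulr_sumr.
apply: le_trans (_ : \sum_e (pos (y i) ^+ 2 + (L * E2 * Om ^+ 2) * m) <= _); last first.
  by rewrite sumr_const -mulr_natr -/N; le_ring.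
apply: ler_sum => e _.
set ps := _ - _ * d e.
have ps0 : 0 <= ps := theta_excess_ge0 (d e) g0.
have ps1 : ps <= Om ^+ 2 * m := le_trans (theta_excess_le g (d e)) (d_sq_le e).
have H1 : (Xe i e * ps) ^+ 2 <= L * E2 * (Om ^+ 2 * m).
  rewrite exprMn; apply: le_trans (_ : L * (a x e * ps) * ps <= _).
    have -> : L * (a x e * ps) * ps = L * a x e * ps ^+ 2 by ring.
    by apply: ler_wpM2r; rewrite ?sqr_ge0 ?X_sq.
  apply: ler_pM => //; first by ge0.
  by rewrite ler_wpM2l // energy.
have := sqr_ge0 (pos (y i) + Xe i e * ps).
lra.
Qed.

(** Convexity replaces the increment of [theta] by [dtheta] times the variation of the slope. Then
    [weighted_transport] exchanges the shifted coefficient for [a x e], which is the same for all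
    directions, and leaves half a squared jump as dissipation. *)
Lemma transport_term i :
  - (2 * pos (y i)) * (\sum_e shiftA i x e * dth i e / step i) <=
  \sum_e dt e * (wt e / h) * a x e * (pos (ye i e) ^+ 2 - pos (y i) ^+ 2)
  - (2 * h)^-1 * (\sum_e dt e * wt e * a x e * De i e ^+ 2)
  + 4 * N * L * Om * pos (y i) ^+ 2.
Proof.
have st := step_gt0 i.
rewrite !mulr_sumr -sumrB.
apply: le_trans (_ : \sum_e (dt e * (wt e / h) * a x e * (pos (ye i e) ^+ 2 - pos (y i) ^+ 2) -
  (2 * h)^-1 * (dt e * wt e * a x e * De i e ^+ 2) + 4 * L * Om * pos (y i) ^+ 2) <= _); last first.
  rewrite big_split /= sumr_const -[X in _ + X]mulr_natr -/N.
  by le_ring.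
apply: ler_sum => e _.
have T := theta_tangent g (d e) (d e + wt e * (step i / h) * (y i - ye i e)).
have dt0 : 0 <= dt e := dtheta_ge0 _ _.
have P0 := pos_ge0 (y i).
have c0 : 0 <= 2 * pos (y i) * shiftA i x e / step i.
  ge0.
have T1 := ler_wpM2l c0 T.
have r0 : 0 <= L * step i ^+ 2 by ge0.
have AL' : (shiftA i x e - a x e) ^+ 2 <= (L * step i ^+ 2) * a x e.
  by rewrite mulrAC; exact: AL.
have W := weighted_transport (y i) (ye i e) (a0 e) (sA0 i e) r0 AL'.
have c1 : 0 <= dt e * (wt e / h) by ge0.
have W1 := ler_wpM2l c1 W.
(* The error carries step^2 / h <= h, and h times [dtheta] is at most 2 by [dsmall]. *)
have W2 : dt e * (wt e / h) * (2 * (L * step i ^+ 2) * pos (y i) ^+ 2) <= 4 * L * Om * pos (y i) ^+ 2.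
  have -> : dt e * (wt e / h) * (2 * (L * step i ^+ 2) * pos (y i) ^+ 2) =
    (dt e * (step i * (step i / h))) * (wt e * (2 * L * pos (y i) ^+ 2)).
    by field; exact: lt0r_neq0.
  have -> : 4 * L * Om * pos (y i) ^+ 2 = 2 * (Om * (2 * L * pos (y i) ^+ 2)) by ring.
  apply: ler_pM; ge0.
    apply: le_trans (dtheta_step_le e); rewrite -/(dt e); apply: ler_wpM2l => //.
    rewrite mulrA ler_pdivrMr //; apply: ler_pM => //; rewrite ?step_le //; exact: ltW.
  by apply: ler_wpM2r; ge0.
have e1 : 2 * pos (y i) * shiftA i x e / step i *
     (dtheta g (d e) * (d e + wt e * (step i / h) * (y i - ye i e) - d e))
  = - (dt e * (wt e / h) * (2 * pos (y i) * shiftA i x e * (ye i e - y i))).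
  by rewrite /dt; field; rewrite !lt0r_neq0.
have e2 : - (2 * pos (y i)) *
    (shiftA i x e * dth i e / step i)
  = - (2 * pos (y i) * shiftA i x e / step i *
     dth i e) by ring.
rewrite e2 /De.
apply: le_trans (_ : dt e * (wt e / h) * (a x e * (pos (ye i e) ^+ 2 - pos (y i) ^+ 2 -
          (pos (ye i e) - pos (y i)) ^+ 2 / 2) + 2 * (L * step i ^+ 2) * pos (y i) ^+ 2) <= _).
  by apply: le_trans W1; rewrite e1 in T1; lra.
have -> : (2 * h)^-1 = h^-1 / 2 by field; exact: lt0r_neq0.
lra.
Qed.

Lemma bernstein_interior :
  \sum_i 2 * pos (slope i x) * slope_dot i x <=
  (N + 1) * (4 * N * L * Om + N + 8 * N * (N + 1) * Om * L + 1 + N * (L * E2 * Om ^+ 2)) * m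
  + (N + 1) * LF ^+ 2.
Proof.
have m0 := gradsq_ge0.
have l0 := lam_gt0.
have N0 := N_ge0.
pose K1 := 4 * N * L * Om + N + 8 * N * (N + 1) * Om * L + 1.
have K1_0 : 0 <= K1.
  rewrite /K1; ge0.
pose K2 := N * (L * E2 * Om ^+ 2).
(* For empty [E] the hypothesis [dsmall] says nothing about g h, but then the factor [N]
   vanishes. *)
have gh : g * h <= 1 \/ N = 0.
  have [N0'|] := eqVneq #|E| 0%N; first by right; rewrite /N N0'.
  rewrite -lt0n => /card_gt0P[e _]; left.
  have := dsmall e; rewrite mulrDr; have : 0 <= h * `|ndiff U x e| by rewrite mulr_ge0 // ltW.
  lra.
have per i : 2 * pos (slope i x) * slope_dot i x <=
   (\sum_e dt e * (wt e / h) * a x e * (pos (ye i e) ^+ 2 - pos (y i) ^+ 2)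
   - (2 * h)^-1 * (\sum_e dt e * wt e * a x e * De i e ^+ 2))
   + (K1 * m + K2 * m + 2 * g * lam * S + LF ^+ 2).
  have T := transport_term i; have Q := quadratic_term i; have V' := viscosity_term i.
  have Fi : - (2 * pos (y i)) * ((shiftF i x - F x) / step i) <= pos (y i) ^+ 2 + LF ^+ 2.
    have : ((shiftF i x - F x) / step i) ^+ 2 <= LF ^+ 2.
      have FL' : `|(shiftF i x - F x) / step i| <= LF.
        by rewrite normrM normfV (gtr0_norm (step_gt0 i)) ler_pdivrMr ?FL // step_gt0.
      rewrite -real_normK ?num_real // ler_sqr ?nnegrE //; exact: le_trans FL'.
    have := sqr_ge0 (pos (y i) + (shiftF i x - F x) / step i); lra.
  have pm := pos_slope_le i; rewrite -/(y i) in pm.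
  have visc : 2 * g * Om * N * L / lam <= 8 * N * (N + 1) * Om * L.
    have -> : 2 * g * Om * N * L / lam = (g * h) * (8 * N * (N + 1) * Om * L).
      by rewrite /lam invrK; ring.
    have c0 : 0 <= 8 * N * (N + 1) * Om * L by ge0.
    by case: gh => [gh|->]; [rewrite ler_piMl|rewrite !(mulr0,mul0r)].
  have visc' := ler_wpM2r (sqr_ge0 (pos (y i))) visc.
  have K1m := ler_wpM2l K1_0 pm.
  have split : 2 * pos (y i) * slope_dot i x =
    - (2 * pos (y i)) * (\sum_e shiftA i x e * dth i e / step i)
    + - (2 * pos (y i)) * (\sum_e Xe i e * (theta g (d e) - 2 * g * d e))
    + - (2 * pos (y i)) * (2 * g * \sum_e Xe i e * d e)
    + - (2 * pos (y i)) * ((shiftF i x - F x) / step i).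
    have Hs : (shiftH i x - ham a U x) / step i =
       \sum_e shiftA i x e * dth i e / step i
       + \sum_e Xe i e * (theta g (d e) - 2 * g * d e) + 2 * g * \sum_e Xe i e * d e.
      rewrite shift_ham /ham mulr_sumr -sumrB mulr_suml -!big_split /=.
      by apply: eq_bigr => e _; rewrite /Xe -/(d e); field; exact: lt0r_neq0 (step_gt0 i).
    have -> : slope_dot i x = - ((shiftH i x - ham a U x) / step i + (shiftF i x - F x) / step i).
      by rewrite /slope_dot; ring.
    by rewrite Hs; ring.
  rewrite -/(y i) split /K2; rewrite /K1 in K1m *; lra.
apply: le_trans (ler_sum _ (fun i _ => per i)) _.
rewrite big_split /= sumr_const card_option -mulr_natr natr1.
rewrite sumrB exchange_big /= -mulr_sumr.
(* The factor is independent of [i], so the sum over directions produces the increment of [gradsq]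
   along [e], which is nonpositive at a maximum. *)
have T1 : \sum_e \sum_i dt e * (wt e / h) * a x e * (pos (ye i e) ^+ 2 - pos (y i) ^+ 2) <= 0.
  apply: sumr_le0 => e _; rewrite -mulr_sumr sumrB; apply: mulr_ge0_le0; first by ge0.
  by rewrite subr_le0; exact: mmax.
have T2 : g * S <= \sum_i \sum_e dt e * wt e * a x e * De i e ^+ 2.
  rewrite exchange_big /= /S mulr_sumr; apply: ler_sum => e _.
  rewrite (bigD1 (Some (rev e))) //=; apply: ler_wpDr.
    by apply: sumr_ge0 => i _; ge0.
  have c0 : 0 <= wt e * a x e * De (Some (rev e)) e ^+ 2 by ge0.
  by have := ler_wpM2r c0 (dissip e); rewrite -/(d e) -/(dt e); lra.
have h20 : 0 <= (2 * h)^-1 by ge0.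
have T3 := ler_wpM2l h20 T2.
have T4 : 2 * g * lam * S * (N + 1) = (2 * h)^-1 * (g * S).
  have N1 : N + 1 != 0 by rewrite lt0r_neq0 // ltr_wpDl.
  by rewrite /lam; field; rewrite ?N1 ?lt0r_neq0.
rewrite -[#|E|.+1%:R]natr1 -/N.
rewrite -/K2 -/K1 in K1_0 *; rewrite /K2 in per *.
rewrite -/N; rewrite /K1; lra.
Qed.

End Interior.

Section Layer.
Hypothesis Thb0 : 0 <= Thb.
Hypothesis hThb : h * Thb <= 1.
Hypothesis thx : forall e, `|theta g (ndiff U x e)| <= Thb.
Hypothesis thnb : forall e' e, `|theta g (ndiff U (nb e' x) e)| <= Thb.
Hypothesis aLay : forall e, a x e <= Ca * h ^+ 2.
Hypothesis sALay : forall i e, shiftA i x e <= Ca * h ^+ 2.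
Hypothesis apL : forall e, (ap x e - a x e) ^+ 2 <= L * a x e * sg ^+ 2.

Let dt e := dtheta g (ndiff U x e).
Let K := N + 1 + 4 * N * Ca * Om.
Let K' := (2 * N * Ca + LF) ^+ 2 + N * L * Ca + LF ^+ 2.

Lemma ham_layer (b : E -> R) (th : E -> R) : (forall e, 0 <= b e <= Ca * h ^+ 2) ->
  (forall e, `|th e| <= Thb) -> `|\sum_e b e * th e| <= N * Ca * h.
Proof.
move=> hb hth; apply: le_trans (ler_norm_sum _ _ _) _.
apply: le_trans (_ : \sum_(e : E) Ca * h <= _).
  apply: ler_sum => e _; rewrite normrM; have /andP[b0 b1] := hb e.
  rewrite (ger0_norm b0); apply: le_trans (ler_pM b0 (normr_ge0 _) b1 (hth e)) _.
  have -> : Ca * h ^+ 2 * Thb = Ca * h * (h * Thb) by ring.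
  by rewrite ler_piMr //; ge0.
by rewrite sumr_const -mulr_natr -/N; le_ring.
Qed.

(** In the layer mesh steps need not commute. Along lattice directions this is harmless, as each
    Hamiltonian is O(h) and the quotient by h is bounded. The quotient by [sg] is not bounded in
    this way, so the direction [None] keeps the convexity argument, which uses no commutation for
    the translate [V]. *)
Lemma layer_slope i : 2 * pos (slope i x) * slope_dot i x <= K * m + K'.
Proof.
have m0 := gradsq_ge0.
have N0 : 0 <= N := ler0n _ _.
have h1 : 0 <= N * m by ge0.
have h2 : 0 <= N * Ca * Om * m by ge0.
have h3 : 0 <= N * L * Ca by ge0.
have FL' i' : `|(shiftF i' x - F x) / step i'| <= LF.
  by rewrite normrM normfV (gtr0_norm (step_gt0 i')) ler_pdivrMr ?FL // step_gt0.
have LF0 : 0 <= LF by exact: le_trans (FL' i).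
have sq (z w : R) : `|z| <= w -> z ^+ 2 <= w ^+ 2.
  by move=> zw; rewrite -real_normK ?num_real // ler_sqr ?nnegrE //; exact: le_trans zw.
case: i => [e'|].
  have pm := pos_slope_le (Some e').
  set p := pos (slope (Some e') x) in pm *.
  have H1 := @ham_layer (a (nb e' x)) _ (fun e => introT andP (conj (sA0 (Some e') e) (sALay (Some e') e))) (thnb e').
  have H2 := @ham_layer (a x) _ (fun e => introT andP (conj (a0 e) (aLay e))) thx.
  have : `|slope_dot (Some e') x| <= 2 * N * Ca + LF.
    have -> : slope_dot (Some e') x = - ((ham a U (nb e' x) - ham a U x) / h) - (F (nb e' x) - F x) / h.
      by rewrite /slope_dot /=; ring.
    apply: le_trans (ler_normB _ _) _; rewrite normrN lerD //; last exact: (FL' (Some e')).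
    rewrite normrM normfV (gtr0_norm h0) ler_pdivrMr //.
    apply: le_trans (ler_normB _ _) _; rewrite /ham; lra.
  move=> /sq Hs; have := sqr_ge0 (p - slope_dot (Some e') x).
  have := sqr_ge0 LF.
  rewrite /K /K'; lra.
have pm := pos_slope_le None.
set y := slope None x; pose ye e := slope None (nb e x).
rewrite -/y in pm; set p := pos y in pm *.
have p0 : 0 <= p by exact: pos_ge0.
have EV : ham ap V x = \sum_e ap x e * theta g (ndiff U x e + wt e * (sg / h) * (y - ye e)).
  apply: eq_bigr => e _; congr (_ * theta g _); rewrite /y /ye /ndiff /slope /=.
  by field; rewrite !lt0r_neq0.
have -> : slope_dot None x =
  - \sum_e (ap x e * (theta g (ndiff U x e + wt e * (sg / h) * (y - ye e)) - theta g (ndiff U x e)) / sg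
     + (ap x e - a x e) / sg * theta g (ndiff U x e)) - (Fp x - F x) / sg.
  have -> : slope_dot None x = - ((ham ap V x - ham a U x) / sg) - (Fp x - F x) / sg.
    by rewrite /slope_dot /=; ring.
  congr (- _ - _); rewrite EV /ham -sumrB mulr_suml; apply: eq_bigr => e _; ring.
have Fi : - (2 * p) * ((Fp x - F x) / sg) <= p ^+ 2 + LF ^+ 2.
  by have := sq _ _ (FL' None); have := sqr_ge0 (p + (Fp x - F x) / sg); rewrite /=; lra.
have per e : - (2 * p) * (ap x e * (theta g (ndiff U x e + wt e * (sg / h) * (y - ye e)) - theta g (ndiff U x e)) / sg
     + (ap x e - a x e) / sg * theta g (ndiff U x e)) <= m + L * Ca + 4 * Ca * Om * m.
  have T := theta_tangent g (ndiff U x e) (ndiff U x e + wt e * (sg / h) * (y - ye e)).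
  have ap0 : 0 <= ap x e := sA0 None e.
  have dt0 : 0 <= dt e := dtheta_ge0 _ _.
  have c0 : 0 <= 2 * p * ap x e / sg by ge0.
  have T1 := ler_wpM2l c0 T.
  have e1 : 2 * p * ap x e / sg * (dtheta g (ndiff U x e) * (ndiff U x e + wt e * (sg / h) * (y - ye e) - ndiff U x e))
    = - (dt e * wt e * ap x e / h * (2 * p * (ye e - y))).
    by rewrite /dt; field; rewrite !lt0r_neq0.
  have T2 : 2 * p * (ye e - y) <= m.
    have zz := pos_ge (ye e); have q := pos_slope_nb_le None e; rewrite -/(ye e) in q.
    apply: le_trans q; have [y0|y0] := lerP 0 y; last first.
      by rewrite /p (pos_eq0 (ltW y0)) mulr0 mul0r sqr_ge0.
    have py : p = y by rewrite /p pos_id.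
    have := ler_wpM2l p0 zz; have := sqr_ge0 (pos (ye e) - p); have := sqr_ge0 p; rewrite -py; nra.
  have c1 : 0 <= dt e * wt e * ap x e / h by ge0.
  have T3 := ler_wpM2l c1 T2.
  have c2 : dt e * wt e * ap x e / h <= 4 * Ca * Om.
    rewrite ler_pdivrMr //.
    have q1 : ap x e <= Ca * h ^+ 2 := sALay None e.
    have q2 : dt e * h <= 2 := dtheta_step_le e.
    have d1 : 0 <= dt e * wt e by ge0.
    apply: le_trans (ler_wpM2l d1 q1) _.
    have -> : dt e * wt e * (Ca * h ^+ 2) = (dt e * h) * (wt e * (Ca * h)) by ring.
    have -> : 4 * Ca * Om * h = 4 * (Om * (Ca * h)) by ring.
    apply: ler_pM; try ge0; first lra.
    by apply: ler_wpM2r; ge0.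
  have T4 := ler_wpM2r m0 c2.
  set X0 := (ap x e - a x e) / sg.
  have X2 : X0 ^+ 2 <= L * a x e by rewrite /X0 expr_div_n ler_pdivrMr ?apL // exprn_gt0.
  have Xt : (X0 * theta g (ndiff U x e)) ^+ 2 <= L * Ca.
    rewrite exprMn.
    have t2 := sq _ _ (thx e).
    apply: le_trans (ler_pM (sqr_ge0 _) (sqr_ge0 _) X2 t2) _.
    have La : L * a x e <= L * (Ca * h ^+ 2) by rewrite ler_wpM2l.
    apply: le_trans (ler_wpM2r (sqr_ge0 Thb) La) _.
    have -> : L * (Ca * h ^+ 2) * Thb ^+ 2 = L * Ca * (h * Thb) ^+ 2 by ring.
    have c3 : 0 <= L * Ca by ge0.
    rewrite ler_piMr // expr_le1 //; ge0.
  have := sqr_ge0 (p + X0 * theta g (ndiff U x e)).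
  rewrite e1 in T1; lra.
rewrite mulrBr mulrN -mulNr mulr_sumr.
have S1 : \sum_e - (2 * p) * (ap x e * (theta g (ndiff U x e + wt e * (sg / h) * (y - ye e)) - theta g (ndiff U x e)) / sg
     + (ap x e - a x e) / sg * theta g (ndiff U x e)) <= N * (m + L * Ca + 4 * Ca * Om * m).
  apply: le_trans (ler_sum _ (fun e _ => per e)) _.
  by rewrite sumr_const -[X in X <= _]mulr_natr -/N mulrC.
have := sqr_ge0 (2 * N * Ca + LF).
rewrite /K /K'; lra.
Qed.

Lemma bernstein_layer :
  \sum_i 2 * pos (slope i x) * slope_dot i x <= (N + 1) * K * m + (N + 1) * K'.
Proof.
apply: le_trans (ler_sum _ (fun i _ => layer_slope i)) _.
rewrite sumr_const card_option -mulr_natr -natr1 -/N.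
by le_ring.
Qed.

End Layer.
End Bernstein.

(** * Comparison and time derivatives *)

Section MonotoneScheme.
Context {R : realType} {X : eqType} {E : finType}.
Context (nb : E -> X -> X) (wt : E -> R) (h g : R).
Implicit Types (a : X -> E -> R) (U V F : X -> R) (x : X) (e : E) (s : seq X).

Let H := ham nb wt h g.
Let nd := ndiff nb wt h.

Hypothesis h0 : 0 < h.
Hypothesis g0 : 0 <= g.
Hypothesis wt0 : forall e, 0 <= wt e.

Lemma ham_mono a U V x : (forall e, 0 <= a x e) ->
  (forall e, U (nb e x) - V (nb e x) <= U x - V x) -> H a V x <= H a U x.
Proof.
move=> a0 UV; apply: ler_sum => e _; apply: ler_wpM2l => //; apply: theta_mono.
apply: ler_wpM2l => //; rewrite ler_pM2r ?invr_gt0 //; have := UV e; lra.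
Qed.

(** The hypothesis on U1 + U2 - 2 U0 holds at a maximum and gives the second difference of [nd] its
    sign. The alternative with vanishing coefficients covers boundary points of the simplex. *)
Lemma ham_second_diff a0 a1 a2 U0 U1 U2 x rho Q : 0 <= rho ->
  (forall e, [/\ a0 x e = 0, a1 x e = 0 & a2 x e = 0] \/
     [/\ 0 < a0 x e, 0 < a1 x e, 0 < a2 x e,
       a0 x e ^+ 2 * ((a1 x e)^-1 + (a2 x e)^-1 - 2 * (a0 x e)^-1) <= rho &
       a1 x e + a2 x e - 2 * a0 x e <= rho]) ->
  (forall e, U1 (nb e x) + U2 (nb e x) - 2 * U0 (nb e x) <= U1 x + U2 x - 2 * U0 x) ->
  (forall e, pos (g + nd U0 x e) ^+ 2 + g ^+ 2 <= Q) ->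
  - (#|E|%:R * rho * Q) <= H a1 U1 x + H a2 U2 x - 2 * H a0 U0 x.
Proof.
move=> rho0 ha hU hQ.
rewrite /H /ham mulr_sumr -big_split -sumrB /=.
have -> : - (#|E|%:R * rho * Q) = \sum_(e : E) - (rho * Q).
  by rewrite sumr_const -[in RHS]mulr_natr mulNr; congr (- _); ring.
apply: ler_sum => e _.
have Q0 : 0 <= Q by apply: le_trans (hQ e); rewrite addr_ge0 ?sqr_ge0.
have rQ : - rho * Q <= - rho * (pos (g + nd U0 x e) ^+ 2 + g ^+ 2).
  by rewrite !mulNr lerN2 ler_wpM2l.
case: (ha e) => [[-> -> ->]|[p0 p1 p2 r1 r2]].
  by rewrite !mul0r mulr0 addr0 subr0 oppr_le0 mulr_ge0.
rewrite -mulNr; apply: le_trans rQ _; apply: theta_second_diff => //.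
have -> : nd U1 x e + nd U2 x e - 2 * nd U0 x e =
  wt e * ((U1 x + U2 x - 2 * U0 x - (U1 (nb e x) + U2 (nb e x) - 2 * U0 (nb e x))) / h).
  by rewrite /nd /ndiff; ring.
by rewrite mulr_ge0 // divr_ge0 ?(ltW h0) // subr_ge0.
Qed.

Section OnLattice.
Context (s : seq X).
Hypothesis nb_s : forall e x, x \in s -> nb e x \in s.

Definition solves (T : R) a F (u : R -> X -> R) :=
  (forall x, x \in s -> {within `[0, T], continuous (u^~ x)}) /\
  (forall t x, 0 < t < T -> x \in s ->
     is_derive t 1 (u^~ x) (- (H a (u t) x + F x))).

(** At a spatial maximum of u1 - u2 the Hamiltonians are ordered by monotonicity, so only [D]
    remains. The functions need not solve the equation, which allows comparison with constants in
    time. *)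
Lemma comparison (T : R) a (u1 u2 l1 l2 : R -> X -> R) (D M : R) : 0 < T -> 0 <= D -> 0 <= M ->
  (forall x e, x \in s -> 0 <= a x e) ->
  (forall x, x \in s -> {within `[0, T], continuous (u1^~ x)}) ->
  (forall x, x \in s -> {within `[0, T], continuous (u2^~ x)}) ->
  (forall t x, 0 < t < T -> x \in s -> is_derive t 1 (u1^~ x) (l1 t x)) ->
  (forall t x, 0 < t < T -> x \in s -> is_derive t 1 (u2^~ x) (l2 t x)) ->
  (forall t x, 0 < t < T -> x \in s ->
     l1 t x - l2 t x <= D - (H a (u1 t) x - H a (u2 t) x)) ->
  (forall x, x \in s -> u1 0 x - u2 0 x <= M) ->
  forall t x, 0 <= t <= T -> x \in s -> u1 t x - u2 t x <= M + D * t.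
Proof.
move=> T0 D0 M0 a0 c1 c2 d1 d2 hl hM t x tT xs.
have -> : M + D * t = (M + D * t) * expR (0 * t) by rewrite mul0r expR0 mulr1.
apply: (@max_principle R X s T 0 D M (fun t x => u1 t x - u2 t x)
  (fun t x => l1 t x - l2 t x)) => //.
- by move=> y ys; apply: within_contB; [exact: c1|exact: c2].
- by move=> t' y ht' ys; apply: is_deriveB; [exact: d1|exact: d2].
move=> t' y ht' ys ymax _; rewrite mul0r add0r.
apply: le_trans (hl _ _ ht' ys) _; rewrite gerBl subr_ge0.
by apply: ham_mono => [e|e]; [exact: a0|apply: ymax; exact: nb_s].
Qed.

Lemma is_derive_translate (f : R -> R) (t c l : R) : is_derive (t + c) 1 f l ->
  is_derive t 1 (fun t => f (t + c)) l.
Proof.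
move=> df.
have := @is_derive1_comp _ f (fun t => t + c) t l (1 + 0) df
  (is_deriveD (is_derive_id t 1) (is_derive_cst c t 1)).
by rewrite addr0 mulr1.
Qed.

Lemma within_cont_shift (f : R -> R) (T c : R) : 0 <= c ->
  {within `[0, T], continuous f} -> {within `[0, T - c], continuous (fun t => f (t + c))}.
Proof.
move=> c0 cf; apply/subspace_continuousP => t; rewrite /= in_itv /= => /andP[t0 tT].
apply/cvgrPdist_lt => e e0.
have [|eta eta0 hcf] := within_cont_eps (c := t + c) cf _ e0.
  by rewrite /= in_itv /=; apply/andP; split; lra.
rewrite near_withinE; apply/nbhs_ballP; exists eta => //= y.
rewrite -ball_normE /= => yt; rewrite in_itv /= => /andP[y0 yT].
rewrite distrC; apply: hcf; first by rewrite /= in_itv /=; apply/andP; split; lra.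
rewrite (_ : y + c - (t + c) = - (t - y)) ?normrN; [exact: yt|ring].
Qed.

Lemma derive_bound (f : R -> R) (t l D eps : R) : 0 < eps -> is_derive t 1 f l ->
  (forall c, 0 < c < eps -> `|f (t + c) - f t| <= D * c) -> `|l| <= D.
Proof.
move=> eps0 [df <-] hf.
rewrite ['D_1 f t]cvg_at_rightE //.
rewrite -lim_norm; last first.
  rewrite -(cvg_at_rightE (fun h => h^-1 *: ((f \o shift t) _ - f t))) //.
  apply: cvg_trans df; apply: cvg_app.
  move=> A [e egt0 Ae]; exists e => // x xe xgt0; apply: Ae => //.
  exact/lt0r_neq0.
apply: limr_le.
  apply: is_cvg_norm.
  rewrite -(cvg_at_rightE (fun h => h^-1 *: ((f \o shift t) _ - f t))) //.
  apply: cvg_trans df; apply: cvg_app.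
  move=> A [e egt0 Ae]; exists e => // x xe xgt0; apply: Ae => //.
  exact/lt0r_neq0.
near=> c.
have c0 : 0 < c by near: c; exists 1 => /=.
have ce : c < eps.
  near: c; exists eps => //= x; rewrite /= distrC subr0 => xe x0.
  exact: le_lt_trans (ler_norm _) xe.
rewrite /= normrM normfV (gtr0_norm c0) ler_pdivrMl // mulrC.
by rewrite [_%:A]mulr1 [c + t]addrC; apply: hf; rewrite c0.
Unshelve. all: by end_near. Qed.

(** Comparison with the initial datum gives |u(c) - u(0)| <= D c; comparison of u with its translate
    in time, a solution of the same equation, propagates this to |u(t + c) - u(t)| <= D c. *)
Lemma time_derivative_bound (T : R) a F (u : R -> X -> R) (D : R) : 0 < T -> 0 <= D ->
  (forall x e, x \in s -> 0 <= a x e) -> solves T a F u ->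
  (forall x, x \in s -> `|H a (u 0) x + F x| <= D) ->
  forall t x, 0 < t < T -> x \in s -> `|H a (u t) x + F x| <= D.
Proof.
move=> T0 D0 a0 [cu du] hD.
have hu0 x : x \in s -> - D <= H a (u 0) x + F x <= D.
  by move=> /hD; rewrite ler_norml.
have cst (t : R) x : is_derive t 1 (fun=> u 0 x : R) 0 by exact: is_derive_cst.
have ccst (x : X) (A : set R) : {within A, continuous (fun=> u 0 x : R)} by exact: within_cont_cst.
have first_ t x : 0 <= t <= T -> x \in s -> `|u t x - u 0 x| <= D * t.
  move=> tT xs; rewrite ler_norml -(add0r (D * t)).
  rewrite lerNl opprB; apply/andP; split.
    apply: (@comparison T a (fun=> u 0) u (fun _ _ => 0)
      (fun t x => - (H a (u t) x + F x)) D 0) => //; last by move=> *; rewrite subrr.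
    by move=> t' y _ /hu0 /andP[h1 h2]; lra.
  apply: (@comparison T a u (fun=> u 0) (fun t x => - (H a (u t) x + F x))
    (fun _ _ => 0) D 0) => //; last by move=> *; rewrite subrr.
  by move=> t' y _ /hu0 /andP[h1 h2]; lra.
move=> t x /andP[t0 tT] xs.
have tT0 : 0 < t < T by rewrite t0.
rewrite -normrN; apply: (@derive_bound (u^~ x) t _ D (T - t) _ (du t x tT0 xs)).
  by rewrite subr_gt0.
move=> c /andP[c0 ctT].
have Tc : 0 < T - c by lra.
have Dc : 0 <= D * c by rewrite mulr_ge0 // ltW.
have cu1 y : y \in s -> {within `[0, T - c], continuous (fun t => u (t + c) y)}.
  by move=> ys; apply: (@within_cont_shift (u ^~ y)); [exact: ltW|exact: cu].
have cu2 y : y \in s -> {within `[0, T - c], continuous (u ^~ y)}.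
  by move=> ys; apply: within_itv_sub (cu y ys) => //; lra.
have du1 t' y : 0 < t' < T - c -> y \in s ->
    is_derive t' 1 (fun t => u (t + c) y) (- (H a (u (t' + c)) y + F y)).
  by move=> /andP[? ?] ys; apply: (@is_derive_translate (u ^~ y)); apply: du => //; apply/andP; split; lra.
have du2 t' y : 0 < t' < T - c -> y \in s ->
    is_derive t' 1 (u ^~ y) (- (H a (u t') y + F y)).
  by move=> /andP[? ?] ys; apply: du => //; apply/andP; split; lra.
have f0 y : y \in s -> - (D * c) <= u c y - u 0 y <= D * c.
  by move=> ys; rewrite -ler_norml; apply: first_ => //; apply/andP; split; lra.
have tT' : 0 <= t <= T - c by apply/andP; split; lra.
rewrite ler_norml lerNl opprB; apply/andP; split.
  have := @comparison (T - c) a u (fun t => u (t + c)) (fun t x => - (H a (u t) x + F x))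
    (fun t x => - (H a (u (t + c)) x + F x)) 0 (D * c) Tc (lexx 0) Dc a0 cu2 cu1 du2 du1.
  move=> E0; have := E0 _ _ t x tT' xs; rewrite mul0r addr0; apply.
    by move=> *; lra.
  by move=> y /f0 /andP[? ?]; rewrite add0r; lra.
have := @comparison (T - c) a (fun t => u (t + c)) u (fun t x => - (H a (u (t + c)) x + F x))
    (fun t x => - (H a (u t) x + F x)) 0 (D * c) Tc (lexx 0) Dc a0 cu1 cu2 du1 du2.
move=> E0; have := E0 _ _ t x tT' xs; rewrite mul0r addr0; apply.
  by move=> *; lra.
by move=> y /f0 /andP[? ?]; rewrite add0r; lra.
Qed.

End OnLattice.
End MonotoneScheme.

(** * Gradient bound on a lattice *)

Section GradientBound.
Context {R : realType} {X : eqType} {E : finType}.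
Context (rev : E -> E) (nb : E -> X -> X) (wt : E -> R) (h g sg : R).
Context (s : seq X) (inn : pred X) (a ap : X -> E -> R) (F Fp : X -> R).
Context (T L LF E2 Om Thb Ca M : R) (u v : R -> X -> R).
Let N : R := #|E|%:R.

(** The rates at interior points and in the layer are added, here and in [bern_source], so that one
    differential inequality serves both. *)
Definition bern_rate : R :=
  (N + 1) * (4 * N * L * Om + N + 8 * N * (N + 1) * Om * L + 1 + N * (L * E2 * Om ^+ 2))
  + (N + 1) * (N + 1 + 4 * N * Ca * Om).

Definition bern_source : R :=
  (N + 1) * LF ^+ 2 + (N + 1) * ((2 * N * Ca + LF) ^+ 2 + N * L * Ca + LF ^+ 2).

Hypothesis T0 : 0 < T.
Hypothesis h0 : 0 < h.
Hypothesis g0 : 0 <= g.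
Hypothesis sg0 : 0 < sg.
Hypothesis sgh : sg <= h.
Hypothesis L0 : 0 <= L.
Hypothesis Om0 : 0 <= Om.
Hypothesis Ca0 : 0 <= Ca.
Hypothesis E20 : 0 <= E2.
Hypothesis M0 : 0 <= M.
Hypothesis Thb0 : 0 <= Thb.
Hypothesis wt0 : forall e, 0 <= wt e.
Hypothesis wtOm : forall e, wt e <= Om.
Hypothesis wtrev : forall e, wt (rev e) = wt e.
Hypothesis revK : involutive rev.
Hypothesis nb_s : forall e x, x \in s -> nb e x \in s.
Hypothesis a0 : forall x e, x \in s -> 0 <= a x e.
Hypothesis ap0 : forall x e, x \in s -> 0 <= ap x e.
Hypothesis arev : forall x e, a x (rev e) = a x e.
Hypothesis aprev : forall x e, ap x (rev e) = ap x e.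
Hypothesis FL : forall e x, x \in s -> `|F (nb e x) - F x| <= LF * h.
Hypothesis FpL : forall x, x \in s -> `|Fp x - F x| <= LF * sg.
Hypothesis nbC : forall e e' x, x \in s -> inn x -> nb e (nb e' x) = nb e' (nb e x).
Hypothesis nbK : forall e x, x \in s -> inn x -> nb (rev e) (nb e x) = x.
Hypothesis aL : forall e' e x, x \in s -> inn x ->
  (a (nb e' x) e - a x e) ^+ 2 <= L * a x e * h ^+ 2.
Hypothesis apL : forall e x, x \in s -> (ap x e - a x e) ^+ 2 <= L * a x e * sg ^+ 2.
Hypothesis aLay : forall e x, x \in s -> ~~ inn x -> a x e <= Ca * h ^+ 2.
Hypothesis anbLay : forall e' e x, x \in s -> ~~ inn x -> a (nb e' x) e <= Ca * h ^+ 2.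
Hypothesis apLay : forall e x, x \in s -> ~~ inn x -> ap x e <= Ca * h ^+ 2.
Hypothesis hThb : h * Thb <= 1.
Hypothesis su : solves nb wt h g s T a F u.
Hypothesis sv : solves nb wt h g s T ap Fp v.

Let nd t x e := ndiff nb wt h (u t) x e.

Hypothesis dsmall : forall t x e, 0 < t < T -> x \in s -> h * (g + `|nd t x e|) <= 1.
Hypothesis dissip : forall t x e, 0 < t < T -> x \in s -> g <= dtheta g (nd t x e).
Hypothesis thb : forall t x e, 0 < t < T -> x \in s -> `|theta g (nd t x e)| <= Thb.
Hypothesis energy : forall t x e, 0 < t < T -> x \in s -> inn x ->
  a x e * (theta g (nd t x e) - 2 * g * nd t x e) <= E2.

Hypothesis init : forall x, x \in s -> gradsq nb h sg (u 0) (v 0) x <= M.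

Lemma bern_rate_ge0 : 0 <= bern_rate.
Proof. rewrite /bern_rate; ge0. Qed.

Lemma bern_source_ge0 : 0 <= bern_source.
Proof. rewrite /bern_source; ge0. Qed.

Lemma gradient_bound t x : 0 <= t <= T -> x \in s ->
  gradsq nb h sg (u t) (v t) x <= (M + bern_source * t) * expR (bern_rate * t).
Proof.
case: su sv => cu du [cv dv].
have hn := lt0r_neq0 h0; have sgn := lt0r_neq0 sg0.
apply: (@max_principle R X s T bern_rate bern_source M
  (fun t x => gradsq nb h sg (u t) (v t) x)
  (fun t x => \sum_i 2 * pos (slope nb h sg (u t) (v t) i x) *
     slope_dot nb wt h g sg a ap (u t) (v t) F Fp i x)) => //.
- exact: bern_source_ge0.
- exact: bern_rate_ge0.
- move=> y ys; rewrite /gradsq; apply: within_cont_sum => i.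
  apply: within_cont_possq; rewrite /slope.
  apply: within_contM; last exact: within_cont_cst.
  apply: within_contB; last exact: cu.
  by case: i => [e|] /=; [apply: cu; exact: nb_s|exact: cv].
- move=> t' y ht ys; rewrite /gradsq; apply: is_derive_fsum => i.
  apply: (is_derive_possq_comp (f := fun t => slope nb h sg (u t) (v t) i y)).
  have dU : is_derive t' 1 (fun t => shiftU nb (u t) (v t) i y)
      (- (shiftH nb wt h g a ap (u t') (v t') i y + shiftF nb F Fp i y)).
    by case: i => [e|] /=; [apply: du => //; exact: nb_s|exact: dv].
  have := is_deriveZ (step h sg i)^-1 (is_deriveB dU (du t' y ht ys)).
  set lhs := (X in is_derive _ _ X _) => H.
  have -> : (fun t => slope nb h sg (u t) (v t) i y) = lhs.
    by apply/funext => t0; rewrite /lhs /slope /= mulrC.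
  apply: is_derive_eq H _; rewrite /slope_dot /GRing.scale /=; ring.
move=> t' y ht ys ymax gpos.
have m0 : 0 <= gradsq nb h sg (u t') (v t') y by exact: ltW.
have sA0 i e : 0 <= shiftA nb a ap i y e.
  by case: i => [e'|] /=; [apply: a0; exact: nb_s|exact: ap0].
have sArev i e : shiftA nb a ap i y (rev e) = shiftA nb a ap i y e.
  by case: i => [e'|] /=.
have FL' i : `|shiftF nb F Fp i y - F y| <= LF * step h sg i.
  by case: i => [e'|] /=; [exact: FL|exact: FpL].
have mmax e : gradsq nb h sg (u t') (v t') (nb e y) <= gradsq nb h sg (u t') (v t') y.
  by apply: ymax; exact: nb_s.
have ds e : h * (g + `|ndiff nb wt h (u t') y e|) <= 1 by exact: dsmall.
have N0 : 0 <= N by exact: ler0n.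
have [iy|niy] := boolP (inn y).
  have AL i e : (shiftA nb a ap i y e - a y e) ^+ 2 <= L * a y e * step h sg i ^+ 2.
    by case: i => [e'|] /=; [exact: aL|exact: apL].
  have := @bernstein_interior R X E rev nb wt h g sg a ap (u t') (v t') F Fp y L LF E2 Om
    h0 g0 sg0 sgh L0 Om0 wt0 wtOm wtrev revK (fun e => a0 e ys) sA0 (fun e => arev y e)
    sArev FL' mmax ds (fun e e' => nbC e e' ys iy) (fun e => nbK e ys iy) AL
    (fun e => energy e ht ys iy) (fun e => dissip e ht ys).
  move=> /le_trans; apply; rewrite /bern_rate /bern_source -/N.
  have c1 : 0 <= (N + 1) * (N + 1 + 4 * N * Ca * Om) * gradsq nb h sg (u t') (v t') y by ge0.
  have c2 : 0 <= (N + 1) * ((2 * N * Ca + LF) ^+ 2 + N * L * Ca + LF ^+ 2) by ge0.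
  lra.
have sALay i e : shiftA nb a ap i y e <= Ca * h ^+ 2.
  by case: i => [e'|] /=; [exact: anbLay|exact: apLay].
have := @bernstein_layer R X E nb wt h g sg a ap (u t') (v t') F Fp y L LF Om Thb Ca
   h0 g0 sg0 L0 Om0 Ca0 wt0 wtOm (fun e => a0 e ys) sA0 FL' mmax ds Thb0 hThb
   (fun e => thb e ht ys) (fun e' e => thb e ht (nb_s e' ys))
   (fun e => aLay e ys niy) sALay (fun e => apL e ys).
move=> /le_trans; apply; rewrite /bern_rate /bern_source -/N.
have c1 : 0 <= (N + 1) * (4 * N * L * Om + N + 8 * N * (N + 1) * Om * L + 1 + N * (L * E2 * Om ^+ 2)) *
  gradsq nb h sg (u t') (v t') y by ge0.
have c2 : 0 <= (N + 1) * LF ^+ 2 by ge0.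
lra.
Qed.

End GradientBound.

(** * Relative variation of the coefficients *)

Section RelativeVariation.
Context {R : realType}.
Implicit Types (C D eps c t r : R).

(* [p1] and [p2] are the values of a positive function at [x + delta] and
   [x - delta], [p0] its value at [x], and [eps] is the relative size of [delta]. *)
Definition rel3 C eps (p0 p1 p2 : R) :=
  [/\ 0 < p0, - (C * eps * p0) <= p1 - p0 <= C * eps * p0,
      - (C * eps * p0) <= p2 - p0 <= C * eps * p0,
      - (C * eps ^+ 2 * p0) <= p1 + p2 - 2 * p0 <= C * eps ^+ 2 * p0 &
      p0 <= C * p1 /\ p0 <= C * p2].

Lemma rel3_sym C eps p0 p1 p2 : rel3 C eps p0 p1 p2 -> rel3 C eps p0 p2 p1.
Proof. by case=> a b c d [e f]; split => //; rewrite [p2 + p1]addrC. Qed.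

Lemma rel3_pos C eps p0 p1 p2 : 0 < C -> rel3 C eps p0 p1 p2 -> 0 < p1.
Proof.
by move=> C0 [p00 _ _ _ [+ _]] => /(lt_le_trans p00); rewrite pmulr_rgt0.
Qed.

Lemma rel3_mono C D eps p0 p1 p2 : 0 < C -> C <= D -> 0 <= eps ->
  rel3 C eps p0 p1 p2 -> rel3 D eps p0 p1 p2.
Proof.
move=> C0 CD eps0 H; have p10 := rel3_pos C0 H; have p20 := rel3_pos C0 (rel3_sym H).
case: H => p00 /andP[b1 b2] /andP[b3 b4] /andP[b5 b6] [b7 b8].
have a1 : C * eps * p0 <= D * eps * p0 by rewrite !ler_wpM2r // ltW.
have a2 : C * eps ^+ 2 * p0 <= D * eps ^+ 2 * p0.
  by rewrite !ler_wpM2r ?sqr_ge0 // ltW.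
have a3 : C * p1 <= D * p1 by rewrite ler_wpM2r // ltW.
have a4 : C * p2 <= D * p2 by rewrite ler_wpM2r // ltW.
by split => //; [apply/andP; split; lra..|split; lra].
Qed.

Lemma rel3D C eps p0 p1 p2 q0 q1 q2 :
  rel3 C eps p0 p1 p2 -> rel3 C eps q0 q1 q2 ->
  rel3 C eps (p0 + q0) (p1 + q1) (p2 + q2).
Proof.
case=> p00 /andP[b1 b2] /andP[b3 b4] /andP[b5 b6] [b7 b8].
case=> q00 /andP[c1 c2] /andP[c3 c4] /andP[c5 c6] [c7 c8].
by split; [exact: addr_gt0|apply/andP; split; lra..|split; lra].
Qed.

Lemma rel3Z C eps c p0 p1 p2 : 0 < c ->
  rel3 C eps p0 p1 p2 -> rel3 C eps (c * p0) (c * p1) (c * p2).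
Proof.
move=> c0 [p00 /andP[b1 b2] /andP[b3 b4] /andP[b5 b6] [b7 b8]].
have m (x y : R) : x <= y -> c * x <= c * y by apply: ler_wpM2l; exact: ltW.
move: (m _ _ b1) (m _ _ b2) (m _ _ b3) (m _ _ b4) (m _ _ b5) (m _ _ b6) (m _ _ b7) (m _ _ b8).
move=> *; split; [exact: mulr_gt0|apply/andP; split; lra..|split; lra].
Qed.

Lemma rel3_sum (I : finType) (i0 : I) C eps (p0 p1 p2 : I -> R) :
  (forall i, rel3 C eps (p0 i) (p1 i) (p2 i)) ->
  rel3 C eps (\sum_i p0 i) (\sum_i p1 i) (\sum_i p2 i).
Proof.
move=> H.
have le (f g : I -> R) : (forall i, f i <= g i) -> \sum_i f i <= \sum_i g i.
  by move=> fg; exact: ler_sum.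
have p0pos i : 0 < p0 i by case: (H i).
split.
- rewrite (bigD1 i0) //= ltr_pwDl // sumr_ge0 // => i _; exact: ltW.
- by rewrite mulr_sumr -sumrB -sumrN; apply/andP; split; apply: le => i;
     case: (H i) => _ /andP[].
- by rewrite mulr_sumr -sumrB -sumrN; apply/andP; split; apply: le => i;
     case: (H i) => _ _ /andP[].
- rewrite mulr_sumr [2 * _]mulr_sumr -big_split -sumrB -sumrN /=.
  by apply/andP; split; apply: le => i; case: (H i) => _ _ _ /andP[].
- by rewrite !mulr_sumr; split; apply: le => i; case: (H i) => _ _ _ _ [].
Qed.

(** The 4 counts the terms of the second difference of a product: two with a second difference of
    one factor and two products of first differences. *)
Lemma rel3M C D eps p0 p1 p2 q0 q1 q2 : 1 <= C -> 1 <= D -> 0 <= eps <= 1 ->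
  rel3 C eps p0 p1 p2 -> rel3 D eps q0 q1 q2 ->
  rel3 (4 * C * D) eps (p0 * q0) (p1 * q1) (p2 * q2).
Proof.
move=> C1 D1 /andP[e0 e1].
case=> p00 b1 b2 b3 [b4 b5]; case=> q00 c1 c2 c3 [c4 c5].
have n (x y : R) : - y <= x <= y -> `|x| <= y by rewrite ler_norml.
have n' (x y : R) : `|x| <= y -> - y <= x <= y by rewrite ler_norml.
have pq0 : 0 < p0 * q0 by exact: mulr_gt0.
have p0' := ltW p00; have q0' := ltW q00.
have C0 : 0 <= C by lra. have D0 : 0 <= D by lra.
have CD : 1 <= C * D by rewrite -[1]mulr1 ler_pM.
have CCD : C <= C * D by rewrite ler_peMr.
have DCD : D <= C * D by rewrite ler_peMl.
have crossM (x y : R) : `|x| <= C * eps * p0 -> `|y| <= D * eps * q0 ->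
    `|x * y| <= C * D * eps ^+ 2 * (p0 * q0).
  move=> hx hy; rewrite normrM.
  have -> : C * D * eps ^+ 2 * (p0 * q0) = (C * eps * p0) * (D * eps * q0) by ring.
  exact: ler_pM.
have e2 : eps ^+ 2 <= eps by rewrite expr2 ler_piMr.
have one p q : - (C * eps * p0) <= p - p0 <= C * eps * p0 ->
    - (D * eps * q0) <= q - q0 <= D * eps * q0 ->
    - (4 * C * D * eps * (p0 * q0)) <= p * q - p0 * q0 <= 4 * C * D * eps * (p0 * q0).
  move=> /n hp /n hq; apply: n'.
  have -> : p * q - p0 * q0 = (p - p0) * q0 + p0 * (q - q0) + (p - p0) * (q - q0) by ring.
  apply: le_trans (ler_normD _ _) _; apply: le_trans (lerD (ler_normD _ _) (lexx _)) _.
  have h1 : `|(p - p0) * q0| <= C * D * eps * (p0 * q0).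
    rewrite normrM (ger0_norm q0'); apply: le_trans (ler_wpM2r q0' hp) _.
    have -> : C * D * eps * (p0 * q0) = D * (C * eps * p0 * q0) by ring.
    by rewrite ler_peMl // !mulr_ge0.
  have h2 : `|p0 * (q - q0)| <= C * D * eps * (p0 * q0).
    rewrite normrM (ger0_norm p0') mulrC; apply: le_trans (ler_wpM2r p0' hq) _.
    have -> : C * D * eps * (p0 * q0) = C * (D * eps * q0 * p0) by ring.
    by rewrite ler_peMl // !mulr_ge0.
  have h3 := crossM _ _ hp hq.
  have h4 : C * D * eps ^+ 2 * (p0 * q0) <= C * D * eps * (p0 * q0).
    by rewrite ler_wpM2r ?(ltW pq0) // ler_wpM2l // mulr_ge0.
  have h5 : 0 <= C * D * eps * (p0 * q0) by rewrite !mulr_ge0.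
  lra.
split => //; [exact: one|exact: one| |].
  apply: n'.
  have -> : p1 * q1 + p2 * q2 - 2 * (p0 * q0) =
    ((p1 + p2 - 2 * p0) * q0 + p0 * (q1 + q2 - 2 * q0)) + ((p1 - p0) * (q1 - q0)
     + (p2 - p0) * (q2 - q0)) by ring.
  apply: le_trans (ler_normD _ _) _.
  apply: le_trans (lerD (ler_normD _ _) (ler_normD _ _)) _.
  have e20 := sqr_ge0 eps.
  have h1 : `|(p1 + p2 - 2 * p0) * q0| <= C * D * eps ^+ 2 * (p0 * q0).
    rewrite normrM (ger0_norm q0'); apply: le_trans (ler_wpM2r q0' (n _ _ b3)) _.
    have -> : C * D * eps ^+ 2 * (p0 * q0) = D * (C * eps ^+ 2 * p0 * q0) by ring.
    by rewrite ler_peMl // !mulr_ge0.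
  have h2 : `|p0 * (q1 + q2 - 2 * q0)| <= C * D * eps ^+ 2 * (p0 * q0).
    rewrite normrM (ger0_norm p0') mulrC; apply: le_trans (ler_wpM2r p0' (n _ _ c3)) _.
    have -> : C * D * eps ^+ 2 * (p0 * q0) = C * (D * eps ^+ 2 * q0 * p0) by ring.
    by rewrite ler_peMl // !mulr_ge0.
  have h3 := crossM _ _ (n _ _ b1) (n _ _ c1).
  have h4 := crossM _ _ (n _ _ b2) (n _ _ c2).
  lra.
have fin p q : p0 <= C * p -> q0 <= D * q -> p0 * q0 <= 4 * C * D * (p * q).
  move=> hp hq; have := ler_pM p0' q0' hp hq.
  have : 0 <= C * p * (D * q) by apply: mulr_ge0; [exact: le_trans hp|exact: le_trans hq].
  lra.
by split; apply: fin.
Qed.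

(** The last clause of [rel3] bounds 1 / p1 and 1 / p2 by C / p0. With it, the second difference of
    the reciprocals is that of [p] divided by p0^2, up to squares of first differences. *)
Lemma rel3V C eps p0 p1 p2 : 1 <= C -> 0 <= eps <= 1 ->
  rel3 C eps p0 p1 p2 -> rel3 (3 * C ^+ 3) eps p0^-1 p1^-1 p2^-1.
Proof.
move=> C1 /andP[e0 e1] H.
have C0 : 0 < C by lra.
have p10 := rel3_pos C0 H; have p20 := rel3_pos C0 (rel3_sym H).
case: H => p00 b1 b2 b3 [b4 b5].
have n (x y : R) : - y <= x <= y -> `|x| <= y by rewrite ler_norml.
have n' (x y : R) : `|x| <= y -> - y <= x <= y by rewrite ler_norml.
have iv p : 0 < p -> p0 <= C * p -> p^-1 <= C * p0^-1.
  by move=> p0' h; rewrite -[p^-1]mul1r ler_pdivrMr // mulrAC ler_pdivlMr // mul1r.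
have CC : C <= C ^+ 2 by rewrite expr2 ler_peMr // ltW.
have CCC : C ^+ 2 <= C ^+ 3 by rewrite [C ^+ 3]exprS ler_peMl // sqr_ge0.
have C30 : 0 <= C ^+ 3 by rewrite exprn_ge0 // ltW.
have i0 : 0 <= p0^-1 by rewrite invr_ge0 ltW.
have first_ p : 0 < p -> p0 <= C * p -> `|p - p0| <= C * eps * p0 ->
    `|p^-1 - p0^-1| <= C ^+ 2 * eps * p0^-1.
  move=> p0' h1 h2.
  have -> : p^-1 - p0^-1 = - ((p - p0) * p0^-1 * p^-1) by field; rewrite !gt_eqF.
  rewrite normrN normrM normrM (ger0_norm i0) (gtr0_norm (_ : 0 < p^-1)) ?invr_gt0 //.
  have -> : C ^+ 2 * eps * p0^-1 = (C * eps * p0) * p0^-1 * (C * p0^-1).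
    by field; rewrite gt_eqF.
  apply: ler_pM; rewrite ?mulr_ge0 ?invr_ge0 //; try exact: ltW.
    by apply: ler_wpM2r.
  exact: iv.
split.
- by rewrite invr_gt0.
- apply: n'; apply: le_trans (first_ _ p10 b4 (n _ _ b1)) _.
  by rewrite !ler_wpM2r //; lra.
- apply: n'; apply: le_trans (first_ _ p20 b5 (n _ _ b2)) _.
  by rewrite !ler_wpM2r //; lra.
- apply: n'.
  have -> : p1^-1 + p2^-1 - 2 * p0^-1 = - ((p1 + p2 - 2 * p0) * (p0^-1 * p0^-1)) +
     ((p1 - p0) ^+ 2 * (p0^-1 * p0^-1) * p1^-1 + (p2 - p0) ^+ 2 * (p0^-1 * p0^-1) * p2^-1).
    by field; rewrite !gt_eqF.
  have sq p : 0 < p -> p0 <= C * p -> `|p - p0| <= C * eps * p0 ->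
      `|(p - p0) ^+ 2 * (p0^-1 * p0^-1) * p^-1| <= C ^+ 3 * eps ^+ 2 * p0^-1.
    move=> p0' h1 h2; rewrite ger0_norm; last first.
      by ge0.
    have -> : C ^+ 3 * eps ^+ 2 * p0^-1 = (C * eps * p0) ^+ 2 * (p0^-1 * p0^-1) * (C * p0^-1).
      by field; rewrite gt_eqF.
    apply: ler_pM; [ge0|ge0| |exact: iv].
    apply: ler_wpM2r; first exact: mulr_ge0.
    rewrite -real_normK ?num_real // ler_sqr ?nnegrE //; exact: le_trans h2.
  apply: le_trans (ler_normD _ _) _; rewrite normrN.
  apply: le_trans (lerD (lexx _) (ler_normD _ _)) _.
  have h1 := sq _ p10 b4 (n _ _ b1); have h2 := sq _ p20 b5 (n _ _ b2).
  have h3 : `|(p1 + p2 - 2 * p0) * (p0^-1 * p0^-1)| <= C ^+ 3 * eps ^+ 2 * p0^-1.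
    rewrite normrM (ger0_norm (mulr_ge0 i0 i0)).
    apply: le_trans (ler_wpM2r (mulr_ge0 i0 i0) (n _ _ b3)) _.
    have -> : C * eps ^+ 2 * p0 * (p0^-1 * p0^-1) = C * eps ^+ 2 * p0^-1.
      by field; rewrite gt_eqF.
    by rewrite !ler_wpM2r ?sqr_ge0 // (le_trans CC).
  lra.
have lw p : 0 < p -> `|p - p0| <= C * eps * p0 -> p0^-1 <= 3 * C ^+ 3 * p^-1.
  move=> p0'; rewrite ler_norml => /andP[_ h].
  have : p <= 3 * C ^+ 3 * p0.
    have : C * eps * p0 <= C ^+ 3 * p0.
      rewrite ler_wpM2r ?(ltW p00) //; apply: le_trans (le_trans CC CCC).
      by rewrite ler_piMr // ltW.
    have : p0 <= C ^+ 3 * p0 by rewrite ler_peMl ?(ltW p00) //; lra.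
    lra.
  by move=> hp; rewrite -[p0^-1]mul1r ler_pdivrMr // mulrAC ler_pdivlMr // mul1r.
by split; apply: lw; rewrite ?n.
Qed.

Lemma rel3_affine x eps d0 : 0 < x -> 0 <= eps <= 2^-1 -> `|d0| <= eps * x ->
  rel3 2 eps x (x + d0) (x - d0).
Proof.
move=> x0 /andP[e0 e1]; rewrite ler_norml => /andP[h1 h2].
have ex0 : 0 <= eps * x by rewrite mulr_ge0 // ltW.
have ex1 : eps * x <= 2^-1 * x by rewrite ler_wpM2r // ltW.
have e2 : 0 <= 2 * eps ^+ 2 * x by rewrite !mulr_ge0 ?sqr_ge0 // ltW.
by split => //; [apply/andP; split; lra..|split; lra].
Qed.

End RelativeVariation.

(** * Relative variation of the three means *)

Section LogarithmicMean.
Context {R : realType}.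
Implicit Types (t r th eps : R).

Let aff t r th := r + th * (t - r).

Definition log_slope t r := if t == r then t^-1 else (ln t - ln r) / (t - r).

Lemma aff_gt0 t r th : 0 < t -> 0 < r -> 0 <= th <= 1 -> 0 < aff t r th.
Proof.
move=> t0 r0 /andP[h0 h1]; rewrite /aff.
have [->|thn] := eqVneq th 0; first by rewrite mul0r addr0.
have thp : 0 < th by rewrite lt_def thn.
have := mulr_gt0 thp t0; have : 0 <= (1 - th) * r by rewrite mulr_ge0 ?subr_ge0 // ltW.
lra.
Qed.

(** The integral over [0, 1] is represented by the increment of a primitive, so the mean value
    theorem can replace integration. *)
Lemma log_slope_primitive t r : 0 < t -> 0 < r ->
  exists Nf : R -> R, Nf 1 - Nf 0 = log_slope t r /\
    forall th, 0 <= th <= 1 -> is_derive th 1 Nf (aff t r th)^-1.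
Proof.
move=> t0 r0; rewrite /log_slope; have [<-|tr] := eqVneq t r.
  exists (fun th => t^-1 * th); split; first by rewrite mulr1 mulr0 subr0.
  move=> th _; rewrite /aff subrr mulr0 addr0.
  by have := is_deriveZ t^-1 (is_derive_id th 1); rewrite /GRing.scale /= mulr1.
exists (fun th => (t - r)^-1 * ln (aff t r th)); split.
  rewrite /aff mul1r mul0r addr0 subrKC; ring.
move=> th th01; have ap := aff_gt0 t0 r0 th01.
have da : is_derive th 1 (aff t r) (t - r).
  have := is_deriveD (is_derive_cst r th 1) (is_deriveM (is_derive_id th 1) (is_derive_cst (t - r) th 1)).
  by move=> H; apply: is_derive_eq H _; rewrite /GRing.scale /=; ring.
have := is_deriveZ (t - r)^-1 (is_derive1_comp (f := @ln R) (is_derive1_ln ap) da).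
move=> H; apply: is_derive_eq H _; rewrite /GRing.scale /=.
by field; rewrite subr_eq0 tr (gt_eqF ap).
Qed.

(* Since [log_slope t r] is the integral of [1 / (th t + (1 - th) r)] over [0, 1],
   linear inequalities between reciprocals pass to logarithmic slopes. *)
Lemma log_slope_comb (al0 al1 al2 t0 r0 t1 r1 t2 r2 : R) :
  0 < t0 -> 0 < r0 -> 0 < t1 -> 0 < r1 -> 0 < t2 -> 0 < r2 ->
  (forall th, 0 <= th <= 1 ->
     0 <= al0 * (aff t0 r0 th)^-1 + al1 * (aff t1 r1 th)^-1 + al2 * (aff t2 r2 th)^-1) ->
  0 <= al0 * log_slope t0 r0 + al1 * log_slope t1 r1 + al2 * log_slope t2 r2.
Proof.
move=> t00 r00 t10 r10 t20 r20 H.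
have [N0 [<- d0]] := log_slope_primitive t00 r00.
have [N1 [<- d1]] := log_slope_primitive t10 r10.
have [N2 [<- d2]] := log_slope_primitive t20 r20.
pose f th := al0 * N0 th + al1 * N1 th + al2 * N2 th.
pose df th := al0 * (aff t0 r0 th)^-1 + al1 * (aff t1 r1 th)^-1 + al2 * (aff t2 r2 th)^-1.
have dF th : 0 <= th <= 1 -> is_derive th 1 f (df th).
  move=> h; exact: (is_deriveD (is_deriveD (is_deriveZ al0 (d0 th h))
    (is_deriveZ al1 (d1 th h))) (is_deriveZ al2 (d2 th h))).
have [c cc E] := MVT_closed ler01 dF.
have -> : al0 * (N0 1 - N0 0) + al1 * (N1 1 - N1 0) + al2 * (N2 1 - N2 0) = f 1 - f 0.
  by rewrite /f; ring.
by rewrite E subr0 mulr1; exact: H.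
Qed.

(** Every clause of [rel3] is linear in the three values. It holds for the integrands, which are
    reciprocals of affine functions, and passes to their integrals by [log_slope_comb]. *)
Lemma rel3_log_slope eps t r dt dr : 0 < t -> 0 < r -> 0 <= eps <= 2^-1 ->
  `|dt| <= eps * t -> `|dr| <= eps * r ->
  rel3 (3 * 2 ^+ 3) eps (log_slope t r) (log_slope (t + dt) (r + dr))
    (log_slope (t - dt) (r - dr)).
Proof.
move=> t0 r0 e01 ht hr.
have /andP[e0 e1] := e01.
have bt := rel3_affine t0 e01 ht; have br := rel3_affine r0 e01 hr.
have two : (0 : R) < 2 by [].
have t1 := rel3_pos two bt; have t2 := rel3_pos two (rel3_sym bt).
have r1 := rel3_pos two br; have r2 := rel3_pos two (rel3_sym br).
set C := 3 * 2 ^+ 3.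
have pt th : 0 <= th <= 1 -> rel3 C eps (aff t r th)^-1
    (aff (t + dt) (r + dr) th)^-1 (aff (t - dt) (r - dr) th)^-1.
  move=> h; have /andP[h0 h1] := h; apply: rel3V; [lra|by apply/andP; split; lra|].
  have -> : aff (t + dt) (r + dr) th = aff t r th + (dr + th * (dt - dr)).
    by rewrite /aff; ring.
  have -> : aff (t - dt) (r - dr) th = aff t r th - (dr + th * (dt - dr)).
    by rewrite /aff; ring.
  apply: rel3_affine => //; first exact: aff_gt0.
  move: ht hr; rewrite !ler_norml /aff => /andP[a1 a2] /andP[b1 b2].
  have th1 : 0 <= 1 - th by lra.
  have := ler_wpM2l h0 a1; have := ler_wpM2l h0 a2.
  have := ler_wpM2l th1 b1; have := ler_wpM2l th1 b2.
  by move=> *; apply/andP; split; lra.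
have comb a0 a1 a2 : (forall th, 0 <= th <= 1 ->
     0 <= a0 * (aff t r th)^-1 + a1 * (aff (t + dt) (r + dr) th)^-1 + a2 * (aff (t - dt) (r - dr) th)^-1) ->
   0 <= a0 * log_slope t r + a1 * log_slope (t + dt) (r + dr) + a2 * log_slope (t - dt) (r - dr).
  exact: log_slope_comb.
split.
- rewrite /log_slope; have [_|tr] := eqVneq t r; first by rewrite invr_gt0.
  have [lt|gt|E] := ltgtP t r; last by rewrite E eqxx in tr.
    by rewrite -mulrNN -invrN !opprB divr_gt0 // subr_gt0 // ltr_ln.
  by rewrite divr_gt0 // subr_gt0 // ltr_ln.
- have A := comb (C * eps - 1) 1 0; have B := comb (C * eps + 1) (- 1) 0.
  apply/andP; split.
    suff : 0 <= (C * eps - 1) * log_slope t r + 1 * log_slope (t + dt) (r + dr) +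
      0 * log_slope (t - dt) (r - dr) by lra.
    by apply: A => th /pt[_ /andP[? ?] _ _ _]; lra.
  suff : 0 <= (C * eps + 1) * log_slope t r + (- 1) * log_slope (t + dt) (r + dr) +
      0 * log_slope (t - dt) (r - dr) by lra.
  by apply: B => th /pt[_ /andP[? ?] _ _ _]; lra.
- have A := comb (C * eps - 1) 0 1; have B := comb (C * eps + 1) 0 (- 1).
  apply/andP; split.
    suff : 0 <= (C * eps - 1) * log_slope t r + 0 * log_slope (t + dt) (r + dr) +
      1 * log_slope (t - dt) (r - dr) by lra.
    by apply: A => th /pt[_ _ /andP[? ?] _ _]; lra.
  suff : 0 <= (C * eps + 1) * log_slope t r + 0 * log_slope (t + dt) (r + dr) +
      (- 1) * log_slope (t - dt) (r - dr) by lra.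
  by apply: B => th /pt[_ _ /andP[? ?] _ _]; lra.
- have A := comb (C * eps ^+ 2 - 2) 1 1; have B := comb (C * eps ^+ 2 + 2) (- 1) (- 1).
  apply/andP; split.
    suff : 0 <= (C * eps ^+ 2 - 2) * log_slope t r + 1 * log_slope (t + dt) (r + dr) +
      1 * log_slope (t - dt) (r - dr) by lra.
    by apply: A => th /pt[_ _ _ /andP[? ?] _]; lra.
  suff : 0 <= (C * eps ^+ 2 + 2) * log_slope t r + (- 1) * log_slope (t + dt) (r + dr) +
      (- 1) * log_slope (t - dt) (r - dr) by lra.
  by apply: B => th /pt[_ _ _ /andP[? ?] _]; lra.
- have A := comb (- 1) C 0; have B := comb (- 1) 0 C.
  split.
    suff : 0 <= (- 1) * log_slope t r + C * log_slope (t + dt) (r + dr) +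
      0 * log_slope (t - dt) (r - dr) by lra.
    by apply: A => th /pt[_ _ _ _ [? ?]]; lra.
  suff : 0 <= (- 1) * log_slope t r + 0 * log_slope (t + dt) (r + dr) +
      C * log_slope (t - dt) (r - dr) by lra.
  by apply: B => th /pt[_ _ _ _ [? ?]]; lra.
Qed.

Lemma log_slope_ge1 t r : 0 < t <= 1 -> 0 < r <= 1 -> 1 <= log_slope t r.
Proof.
move=> /andP[t0 t1] /andP[r0 r1].
have E : log_slope 1 1 = 1 :> R by rewrite /log_slope eqxx invr1.
have := @log_slope_comb 1 (- 1) 0 t r 1 1 1 1 t0 r0 ltr01 ltr01 ltr01 ltr01.
rewrite E => H; suff : 0 <= 1 * log_slope t r + -1 * 1 + 0 * 1 by lra.
apply: H => th h; have ap := aff_gt0 t0 r0 h; have /andP[h0 h1] := h.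
have -> : aff 1 1 th = 1 by rewrite /aff subrr mulr0 addr0.
have : 1 <= (aff t r th)^-1.
  rewrite invf_ge1 // /aff.
  have th1 : 0 <= 1 - th by lra.
  have := ler_wpM2l h0 t1; have := ler_wpM2l th1 r1; lra.
rewrite invr1; lra.
Qed.

Lemma gmean_log t r : 0 < t -> 0 < r -> gmean Logarithmic t r = (log_slope t r)^-1.
Proof.
move=> t0 r0; rewrite /gmean /log_slope (gt_eqF t0) (gt_eqF r0) /=.
case: ifP => _; first by rewrite invrK.
by rewrite invf_div.
Qed.

Lemma gmean_sym k t r : gmean k t r = gmean k r t.
Proof.
case: k; rewrite /gmean.
- by rewrite addrC.
- rewrite orbC; case: ifP => // _.
  rewrite [r == t]eq_sym; case: ifP => [/eqP//|_].
  by rewrite -[t - r]opprB -[ln t - _]opprB invrN mulrNN.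
- by rewrite orbC addrC.
Qed.

Lemma gmean_rel3 : exists2 C : R, 1 <= C &
  forall k eps t r dt dr, 0 < t -> 0 < r -> 0 <= eps <= 2^-1 ->
  `|dt| <= eps * t -> `|dr| <= eps * r ->
  rel3 C eps (gmean k t r) (gmean k (t + dt) (r + dr)) (gmean k (t - dt) (r - dr)).
Proof.
have C1 : (1 : R) <= 3 * 2 ^+ 3.
  by rewrite -[1]mulr1 ler_pM // ?exprn_ege1 //; lra.
(* Two successive reciprocals, starting from the constant 2 of [rel3_affine]: the logarithmic and
   harmonic means are reciprocals of averages of reciprocals. *)
exists (3 * (3 * 2 ^+ 3) ^+ 3).
  by rewrite -[1]mulr1 ler_pM // ?exprn_ege1 //; lra.
have C2 : (3 : R) * 2 ^+ 3 <= 3 * (3 * 2 ^+ 3) ^+ 3.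
  apply: ler_pM => //; apply: ler_pM => //; lra.
move=> k eps t r dt dr t0 r0 e01 ht hr.
have /andP[e0 e1] := e01.
have e02 : 0 <= eps <= 1 by apply/andP; split; lra.
have bt := rel3_affine t0 e01 ht; have br := rel3_affine r0 e01 hr.
have two : (0 : R) < 2 by [].
have two1 : (1 : R) <= 2 by lra.
have t1 := rel3_pos two bt; have t2 := rel3_pos two (rel3_sym bt).
have r1 := rel3_pos two br; have r2 := rel3_pos two (rel3_sym br).
case: k.
- rewrite /gmean ![_ / 2]mulrC; apply: rel3Z; first by rewrite invr_gt0.
  apply: (rel3_mono (C := 2)) => //; first lra.
  exact: rel3D.
- rewrite !gmean_log //; apply: rel3V => //; exact: rel3_log_slope.
- rewrite /gmean !gt_eqF //=; apply: rel3Z => //; apply: rel3V => //.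
  by apply: rel3D; exact: rel3V.
Qed.

Lemma gmean_ge0_le1 k t r : 0 < t <= 1 -> 0 < r <= 1 -> 0 <= gmean k t r <= 1.
Proof.
move=> ht hr; have /andP[t0 t1] := ht; have /andP[r0 r1] := hr; case: k.
- by rewrite /gmean; apply/andP; split; lra.
- rewrite gmean_log //; have L1 := log_slope_ge1 ht hr.
  have L0 : 0 < log_slope t r by lra.
  by rewrite invr_ge0 ltW // invf_le1.
- rewrite /gmean !gt_eqF //=.
  have h1 : 1 <= t^-1 by rewrite invf_ge1.
  have h2 : 1 <= r^-1 by rewrite invf_ge1.
  have h3 : 0 < t^-1 + r^-1 by lra.
  by rewrite divr_ge0 ?(ltW h3) //= ler_pdivrMr // mul1r; lra.
Qed.

End LogarithmicMean.

(** * Coefficients of the Hamiltonian *)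

Section Coefficients.
Context {R : realType} {d : nat}.
Implicit Types (x y dx : 'rV[R]_d) (c eps sg : R) (e : 'I_d * 'I_d).

Lemma simplexP x : simplex x <-> (forall i, 0 <= x 0 i) /\ \sum_i x 0 i = 1.
Proof.
split=> [[h s1]|[h s1]]; split => // i; first by case/andP: (h i).
rewrite h /= -s1 (bigD1 i) //= lerDl sumr_ge0 //.
Qed.

Lemma simplex_interiorP x :
  simplex_interior x <-> (forall i, 0 < x 0 i) /\ \sum_i x 0 i = 1.
Proof.
split=> [[[_ s1] h]|[h s1]]; first by [].
by split => //; apply/simplexP; split => // i; exact: ltW.
Qed.

Lemma inv_I2_in x : simplex_interior x -> inv_I2 x = (\sum_i (x 0 i)^-1) ^- 2.
Proof. by move=> h; rewrite /inv_I2 mem_set. Qed.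

Lemma inv_I2_out x i : x 0 i = 0 -> inv_I2 x = 0.
Proof.
move=> x0; rewrite /inv_I2; case: ifPn => // /set_mem [_ /(_ i)].
by rewrite x0 ltxx.
Qed.

(** The factor [c] is later [scheme_scale]. Edge weights are kept out of the coefficient and placed
    in the differences [ndiff]. *)
Definition coef c k x e : R := c * inv_I2 x * gedge k x e.1 e.2.

Lemma inv_I2_ge0 x : 0 <= inv_I2 x.
Proof. by rewrite /inv_I2; case: ifP => // _; rewrite invr_ge0 sqr_ge0. Qed.

Lemma simplex_dichotomy x : simplex x -> simplex_interior x \/ exists i, x 0 i = 0.
Proof.
move=> sx; have [x0 _] := (simplexP x).1 sx.
have [/existsP[i /eqP xi]|] := boolP [exists i, x 0 i == 0]; first by right; exists i.
rewrite negb_exists => /forallP h; left; split => // i.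
by rewrite lt_def h x0.
Qed.

Lemma interior_coord x i : simplex_interior x -> 0 < x 0 i <= 1.
Proof. by move=> [[h _] h']; rewrite h' /=; case/andP: (h i). Qed.

Lemma inv_I2_mul x : simplex_interior x -> inv_I2 x * (\sum_i (x 0 i)^-1) ^+ 2 <= 1.
Proof.
move=> h; rewrite inv_I2_in //.
have [->|s0] := eqVneq (\sum_i (x 0 i)^-1) 0; first by rewrite expr0n /= mulr0.
by rewrite mulVf // expf_neq0.
Qed.

Lemma sum_inv_ge x i : simplex_interior x -> (x 0 i)^-1 <= \sum_i (x 0 i)^-1.
Proof.
move=> [_ h]; rewrite (bigD1 i) //= lerDl sumr_ge0 // => j _.
by rewrite invr_ge0 ltW.
Qed.

Lemma inv_I2_le x i (y0 : R) : simplex x -> x 0 i <= y0 -> inv_I2 x <= y0 ^+ 2.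
Proof.
move=> sx xy.
have [ix|[j xj]] := simplex_dichotomy sx; last by rewrite (inv_I2_out xj) sqr_ge0.
have /andP[x0 _] := interior_coord i ix.
rewrite inv_I2_in // -exprVn.
have S0 : 0 < \sum_i (x 0 i)^-1.
  by apply: lt_le_trans (sum_inv_ge i ix); rewrite invr_gt0.
have S1 : (\sum_i (x 0 i)^-1)^-1 <= y0.
  apply: le_trans xy; rewrite -[x 0 i]invrK lef_pV2 ?posrE ?invr_gt0 //.
  exact: sum_inv_ge.
rewrite ler_sqr // nnegrE ?invr_ge0 ?(ltW S0) //.
by apply: ltW; apply: lt_le_trans xy.
Qed.

Lemma inv_I2_le1 x : simplex x -> inv_I2 x <= 1.
Proof.
move=> sx; have [ix|[j xj]] := simplex_dichotomy sx; last by rewrite (inv_I2_out xj).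
have [/existsP[i _]|no] := boolP [exists i : 'I_d, true].
  have /andP[_ x1] := interior_coord i ix.
  by have := inv_I2_le sx x1; rewrite expr1n.
have [_] := (simplexP x).1 sx; rewrite big1 => [/eqP|i _].
  by rewrite eq_sym oner_eq0.
by move/existsP: no => -[]; exists i.
Qed.

Lemma coef_bounds c k x e (b : R) : 0 <= c <= 1 -> simplex x -> inv_I2 x <= b ->
  0 <= coef c k x e <= b.
Proof.
move=> /andP[c0 c1] sx Ib; have I0 := inv_I2_ge0 x; rewrite /coef.
have [ix|[j xj]] := simplex_dichotomy sx; last first.
  by rewrite (inv_I2_out xj) mulr0 mul0r lexx (le_trans I0).
have /andP[g0 g1] := gmean_ge0_le1 k (interior_coord e.1 ix) (interior_coord e.2 ix).
have b0 := le_trans I0 Ib.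
rewrite !mulr_ge0 //=; apply: le_trans (_ : 1 * b * 1 <= _); last by rewrite mul1r mulr1.
by apply: ler_pM => //; [exact: mulr_ge0|exact: ler_pM].
Qed.

Lemma coef_sym c k x e : coef c k x (e.2, e.1) = coef c k x e.
Proof. by rewrite /coef /gedge gmean_sym. Qed.

Lemma coef_rel3 : exists2 C : R, 1 <= C & forall c k x dx e eps, 0 < c ->
  simplex_interior x -> simplex_interior (x + dx) -> simplex_interior (x - dx) ->
  0 <= eps <= 2^-1 -> (forall i, `|dx 0 i| <= eps * x 0 i) ->
  rel3 C eps (coef c k x e) (coef c k (x + dx) e) (coef c k (x - dx) e).
Proof.
have [Cg Cg1 Hg] := @gmean_rel3 R.
(* [C2] is for the reciprocals of the coordinates and their sum, [C3] for its square, [C4] for the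
   reciprocal of the square. *)
pose C2 : R := 3 * 2 ^+ 3.
have C21 : 1 <= C2 by rewrite -[1]mulr1 ler_pM // ?exprn_ege1 //; lra.
pose C3 := 4 * C2 * C2.
have C31 : 1 <= C3.
  rewrite /C3 -[1]mulr1 ler_pM // ?mulr_ge0 //.
  by rewrite -[1]mulr1 ler_pM //; lra.
pose C4 := 3 * C3 ^+ 3.
have C41 : 1 <= C4 by rewrite -[1]mulr1 ler_pM // ?exprn_ege1 //; lra.
exists (4 * C4 * Cg).
  rewrite -[1]mulr1 ler_pM // ?mulr_ge0 //.
  by rewrite -[1]mulr1 ler_pM //; lra.
move=> c k x dx e eps c0 ix ix1 ix2 e01 he.
have /andP[e0 e1] := e01.
have e02 : 0 <= eps <= 1 by apply/andP; split; lra.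
rewrite /coef -!(mulrA c); apply: rel3Z => //; apply: rel3M => //; last first.
  rewrite /gedge !mxE; apply: Hg => //.
    by have /andP[] := interior_coord e.1 ix.
  by have /andP[] := interior_coord e.2 ix.
rewrite !inv_I2_in //; apply: rel3V => //.
have S : rel3 C2 eps (\sum_i (x 0 i)^-1) (\sum_i ((x + dx) 0 i)^-1) (\sum_i ((x - dx) 0 i)^-1).
  apply: (rel3_sum e.1) => i; rewrite !mxE; apply: rel3V => //; first lra.
  by apply: rel3_affine => //; have /andP[] := interior_coord i ix.
by rewrite !expr2; exact: rel3M.
Qed.

(** The first conclusion serves the gradient bound, the second the estimates of second differences.
    The condition on 2 |dx_i| keeps x, x + dx and x - dx on the same open face. *)
Definition coef_regular (L : R) := forall c k x dx e sg, 0 < c <= 1 ->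
  simplex x -> tangent dx ->
  (forall i, 2 * `|dx 0 i| <= x 0 i) -> (forall i, `|dx 0 i| <= sg) ->
  (coef c k (x + dx) e - coef c k x e) ^+ 2 <= L * coef c k x e * sg ^+ 2 /\
  ([/\ coef c k x e = 0, coef c k (x + dx) e = 0 & coef c k (x - dx) e = 0] \/
   [/\ 0 < coef c k x e, 0 < coef c k (x + dx) e, 0 < coef c k (x - dx) e,
     coef c k x e ^+ 2 * ((coef c k (x + dx) e)^-1 + (coef c k (x - dx) e)^-1
       - 2 * (coef c k x e)^-1) <= L * sg ^+ 2 &
     coef c k (x + dx) e + coef c k (x - dx) e - 2 * coef c k x e <= L * sg ^+ 2]).

(** A relative displacement eps costs eps^2 a, and a <= I^-2 with I the sum of the 1 / x_i. As eps
    <= sg I, the cost is at most sg^2, uniformly up to the boundary. *)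
Lemma coef_variation : exists2 L : R, 1 <= L & coef_regular L.
Proof.
have [C C1 H] := coef_rel3.
have C0 : 0 < C by lra.
have CC : C <= C ^+ 2 by rewrite expr2 ler_peMr // ltW.
have CCC : C ^+ 2 <= C ^+ 3 by rewrite [C ^+ 3]exprS ler_peMl // sqr_ge0.
exists (3 * C ^+ 3); first lra.
move=> c k x dx e sg /andP[c0 c1] sx tdx h1 h2.
have [x0 xs] := (simplexP x).1 sx.
have [ix|[j xj]] := simplex_dichotomy sx; last first.
  (* A vanishing coordinate stays zero under [dx], so all three coefficients vanish. *)
  have dj : dx 0 j = 0.
    have := h1 j; rewrite xj => hh; apply/eqP; rewrite -normr_le0; lra.
  have z1 : coef c k (x + dx) e = 0.
    by rewrite /coef (@inv_I2_out _ j) ?mulr0 ?mul0r // !mxE xj dj addr0.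
  have z2 : coef c k (x - dx) e = 0.
    by rewrite /coef (@inv_I2_out _ j) ?mulr0 ?mul0r // !mxE xj dj subr0.
  have z0 : coef c k x e = 0 by rewrite /coef (inv_I2_out xj) mulr0 mul0r.
  by rewrite z0 z1 z2 subr0 expr0n /= mulr0 mul0r; split => //; left.
have [xp _] := (simplex_interiorP x).1 ix.
have ixd s : (s = 1 \/ s = -1) -> simplex_interior (x + s *: dx).
  move=> hs; apply/simplex_interiorP; split; last first.
    under eq_bigr do rewrite !mxE.
    by rewrite big_split /= -mulr_sumr tdx mulr0 addr0.
  move=> i; rewrite !mxE; have := h1 i; have := xp i.
  have := ler_norm (dx 0 i); have := ler_norm (- dx 0 i); rewrite normrN.
  by case: hs => ->; lra.
have ix1 : simplex_interior (x + dx) by have := ixd 1; rewrite scale1r; apply; left.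
have ix2 : simplex_interior (x - dx) by have := ixd (-1); rewrite scaleN1r; apply; right.
pose I := \sum_i (x 0 i)^-1.
have I0 i : (x 0 i)^-1 <= I by exact: sum_inv_ge.
have sg0 : 0 <= sg := le_trans (normr_ge0 _) (h2 e.1).
have Ip : 0 < I by apply: lt_le_trans (I0 e.1); rewrite invr_gt0.
(* Both entries bound every |dx_i| / x_i: the first by the hypothesis on 2 |dx_i|, the second
   because 1 / x_i <= I. *)
pose eps := Num.min 2^-1 (sg * I).
have e01 : 0 <= eps <= 2^-1.
  by rewrite /eps le_min ge_min lexx /= andbT invr_ge0 ler0n /= mulr_ge0 // ltW.
have /andP[e0 e1] := e01.
have he i : `|dx 0 i| <= eps * x 0 i.
  rewrite -ler_pdivrMr // /eps le_min; apply/andP; split.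
    by rewrite ler_pdivrMr //; have := h1 i; lra.
  by apply: ler_pM => //; rewrite invr_ge0 ltW.
have := H c k x dx e eps c0 ix ix1 ix2 e01 he.
set a0 := coef c k x e; set a1 := coef _ _ (x + dx) _; set a2 := coef _ _ (x - dx) _.
move=> r.
have e02 : 0 <= eps <= 1 by apply/andP; split; lra.
have rV := rel3V C1 e02 r.
have a1p := rel3_pos C0 r; have a2p := rel3_pos C0 (rel3_sym r).
case: r rV => a0p /andP[b1 b2] _ /andP[b3 b4] _ [_ _ _ /andP[_ b5] _].
have key : eps ^+ 2 * a0 <= sg ^+ 2.
  have e2 : eps ^+ 2 <= (sg * I) ^+ 2.
    by rewrite ler_sqr ?nnegrE ?mulr_ge0 ?(ltW Ip) // ge_min lexx orbT.
  apply: le_trans (ler_wpM2r (ltW a0p) e2) _.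
  rewrite exprMn -mulrA ler_piMr ?sqr_ge0 //.
  have cb : c <= 1 := c1.
  have /andP[g0 g1] := gmean_ge0_le1 k (interior_coord e.1 ix) (interior_coord e.2 ix).
  have -> : I ^+ 2 * a0 = c * (inv_I2 x * I ^+ 2) * gedge k x e.1 e.2.
    by rewrite /a0 /coef; ring.
  have II := inv_I2_mul ix; rewrite -/I in II.
  have II0 : 0 <= inv_I2 x * I ^+ 2 by rewrite mulr_ge0 ?inv_I2_ge0 ?sqr_ge0.
  rewrite -[X in _ <= X]mulr1; apply: ler_pM => //; first by rewrite mulr_ge0 // ltW.
  by rewrite -[X in _ <= X]mulr1; apply: ler_pM => //; exact: ltW.
have key2 D : 0 <= D -> D * eps ^+ 2 * a0 <= D * sg ^+ 2.
  by move=> D0; rewrite -mulrA ler_wpM2l.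
have sg2 := sqr_ge0 sg.
have m1 : C * sg ^+ 2 <= 3 * C ^+ 3 * sg ^+ 2 by rewrite ler_wpM2r //; lra.
have m2 : C ^+ 2 * sg ^+ 2 <= 3 * C ^+ 3 * sg ^+ 2 by rewrite ler_wpM2r //; lra.
split.
  have h : (a1 - a0) ^+ 2 <= (C * eps * a0) ^+ 2.
    have h0 : `|a1 - a0| <= C * eps * a0 by rewrite ler_norml b1 b2.
    rewrite -real_normK ?num_real // ler_sqr ?nnegrE //; exact: le_trans h0.
  apply: le_trans h _.
  have -> : (C * eps * a0) ^+ 2 = C ^+ 2 * eps ^+ 2 * a0 * a0 by ring.
  have -> : 3 * C ^+ 3 * a0 * sg ^+ 2 = 3 * C ^+ 3 * sg ^+ 2 * a0 by ring.
  apply: ler_wpM2r; first exact: ltW.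
  by apply: le_trans (key2 _ (sqr_ge0 _)) m2.
right; split => //; last first.
  by apply: le_trans b4 _; apply: le_trans (key2 _ (ltW C0)) m1.
apply: le_trans (ler_wpM2l (sqr_ge0 a0) b5) _.
have -> : a0 ^+ 2 * (3 * C ^+ 3 * eps ^+ 2 * a0^-1) = 3 * C ^+ 3 * eps ^+ 2 * a0.
  by field; rewrite gt_eqF.
by apply: key2; lra.
Qed.

End Coefficients.

(** * Directional derivatives on the simplex *)

Section SimplexGeometry.
Context {R : realType} {d : nat}.
Implicit Types (x y a v : 'rV[R]_d) (f : 'rV[R]_d -> R).

Definition l1 a : R := \sum_i `|a 0 i|.

Lemma l1_ge0 a : 0 <= l1 a.
Proof. by apply: sumr_ge0. Qed.

Lemma l1Z (c : R) a : l1 (c *: a) = `|c| * l1 a.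
Proof. by rewrite /l1 mulr_sumr; apply: eq_bigr => i _; rewrite mxE normrM. Qed.

Lemma coord_le_l1 a i : `|a 0 i| <= l1 a.
Proof. by rewrite /l1 (bigD1 i) //= lerDl sumr_ge0. Qed.

Lemma normr_le_l1 a : `|a| <= l1 a.
Proof.
rewrite [leLHS]/Num.Def.normr /= mx_normrE; apply: bigmax_le; first exact: l1_ge0.
by move=> [i j] _ /=; rewrite (ord1 i); exact: coord_le_l1.
Qed.

Lemma l1_le a (c : R) : (forall i, `|a 0 i| <= c) -> l1 a <= d%:R * c.
Proof.
move=> h; apply: le_trans (_ : \sum_(i < d) c <= _); first exact: ler_sum.
by rewrite sumr_const card_ord -[leLHS]mulr_natr mulrC.
Qed.

Lemma l1_scale_lt a (rho : R) : 0 < rho ->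
  exists2 eta : R, 0 < eta & forall t : R, `|t| < eta -> l1 (t *: a) < rho.
Proof.
move=> rho0; have l0 : 0 < l1 a + 1 by rewrite ltr_wpDl ?l1_ge0.
exists (rho / (l1 a + 1)); first by rewrite divr_gt0.
move=> t; rewrite l1Z ltr_pdivlMr // mulrDr mulr1; apply: le_lt_trans.
by rewrite lerDl.
Qed.

Lemma tangentZ (c : R) a : tangent a -> tangent (c *: a).
Proof.
by move=> ta; rewrite /tangent; under eq_bigr do rewrite mxE; rewrite -mulr_sumr ta mulr0.
Qed.

Lemma tangentN a : tangent a -> tangent (- a).
Proof. by rewrite -scaleN1r; exact: tangentZ. Qed.

Lemma tangentB x y : simplex x -> simplex y -> tangent (y - x).
Proof.
move=> [_ sx] [_ sy]; rewrite /tangent; under eq_bigr do rewrite !mxE.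
by rewrite sumrB sx sy subrr.
Qed.

Lemma sum_addt x a : tangent a -> \sum_i (x + a) 0 i = \sum_i x 0 i.
Proof. by move=> ta; under eq_bigr do rewrite mxE; rewrite big_split /= ta addr0. Qed.

Lemma tangent_of_simplex x a : simplex x -> simplex (x + a) -> tangent a.
Proof. by move=> sx sy; have := tangentB sx sy; rewrite addrAC subrr add0r. Qed.

Lemma simplex_convex x y (th : R) : simplex x -> simplex y -> 0 <= th <= 1 ->
  simplex (x + th *: (y - x)).
Proof.
move=> sx sy /andP[h0 h1]; have [x0 x1] := (simplexP x).1 sx.
have [y0 y1] := (simplexP y).1 sy.
apply/simplexP; split; last by rewrite sum_addt //; apply: tangentZ; exact: tangentB.
move=> i; rewrite !mxE.
have := mulr_ge0 h0 (y0 i); have : 0 <= (1 - th) * x 0 i by rewrite mulr_ge0 // subr_ge0.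
lra.
Qed.

Lemma interior_convex x y (th : R) : simplex x -> simplex_interior y -> 0 < th <= 1 ->
  simplex_interior (x + th *: (y - x)).
Proof.
move=> sx iy /andP[h0 h1]; have [x0 x1] := (simplexP x).1 sx.
have [y0 y1] := (simplex_interiorP y).1 iy.
apply/simplex_interiorP; split; last first.
  by rewrite sum_addt //; apply: tangentZ; apply: tangentB => //; case: iy.
move=> i; rewrite !mxE.
have := mulr_gt0 h0 (y0 i); have : 0 <= (1 - th) * x 0 i by rewrite mulr_ge0 // subr_ge0.
lra.
Qed.

Lemma interior_segment x a (th : R) : simplex_interior x -> simplex_interior (x + a) ->
  0 <= th <= 1 -> simplex_interior (x + th *: a).
Proof.
move=> ix iy /andP[h0 h1].
have [->|hn] := eqVneq th 0; first by rewrite scale0r addr0.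
have := @interior_convex x (x + a) th (proj1 ix) iy.
by rewrite addrAC subrr add0r lt_def hn h0 h1; apply.
Qed.

Lemma line_cont f x v (A : set R) : {within @simplex R d, continuous f} ->
  (forall th, A th -> simplex (x + th *: v)) ->
  {within A, continuous (fun th => f (x + th *: v))}.
Proof.
move=> cf H; apply/subspace_continuousP => th Ath.
apply/cvgrPdist_lt => e e0.
have [eta eta0 He] := within_cont_eps cf (H _ Ath) e0.
have [rho rho0 Hv] := l1_scale_lt v eta0.
rewrite near_withinE; apply/nbhs_ballP; exists rho => //=.
move=> y; rewrite -ball_normE /= => yt Ay; rewrite distrC; apply: He; first exact: H.
have -> : x + y *: v - (x + th *: v) = (y - th) *: v.
  by rewrite scalerBl opprD addrACA subrr add0r.
by apply: le_lt_trans (normr_le_l1 _) _; apply: Hv; rewrite distrC.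
Qed.

Lemma within_itv_le_start (g : R -> R) (a b : R) : a < b ->
  {within `[a, b], continuous g} -> (forall t, a < t <= b -> g t <= 0) ->
  g a <= 0.
Proof.
move=> ab /(continuous_within_itvP _ ab)[_ ga _] gle.
rewrite -(cvg_lim _ ga) //; apply: limr_le; first by apply/cvg_ex; exists (g a).
near=> t; apply: gle.
by apply/andP; split; near: t; [exact: nbhs_right_gt|exact: nbhs_right_le].
Unshelve. all: by end_near. Qed.

Lemma within_itv_norm_start (g : R -> R) (a b c : R) : a < b ->
  {within `[a, b], continuous g} -> (forall t, a < t <= b -> `|g t| <= c) ->
  `|g a| <= c.
Proof.
move=> ab cg h; rewrite ler_norml; apply/andP; split.
  rewrite -subr_le0; apply: (within_itv_le_start (g := fun t => - c - g t) ab).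
    by apply: within_contB => //; exact: within_cont_cst.
  by move=> t /h; rewrite ler_norml subr_le0 => /andP[].
rewrite -subr_le0; apply: (within_itv_le_start (g := fun t => g t - c) ab).
  by apply: within_contB => //; exact: within_cont_cst.
by move=> t /h; rewrite ler_norml subr_le0 => /andP[].
Qed.

Lemma simplex_compact : compact (@simplex R d).
Proof.
pose B := [set v : 'rV[R]_d | forall i : 'I_d, `[0, 1]%classic (v ord0 i)].
have cB : compact B.
  by apply: (@rV_compact R d (fun=> `[0, 1]%classic)) => i; exact: segment_compact.
have -> : @simplex R d = B `&` ((fun v : 'rV[R]_d => \sum_i v 0 i) @^-1` [set 1]).
  apply/seteqP; split=> v.
    by move=> [h s1]; split => //= i; rewrite /= in_itv /= h.
  by move=> [h s1]; split => // i; have := h i; rewrite /= in_itv.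
apply: compact_closedI => //.
apply: preimage_closed; last exact: closed_eq.
move=> v _; move: v; apply: continuous_big => [|i _]; [exact: add_continuous|exact: coord_continuous].
Qed.

Lemma cont_bounded f : {within @simplex R d, continuous f} ->
  exists2 B : R, 0 <= B & forall x, simplex x -> `|f x| <= B.
Proof.
move=> cf.
have [[x0 sx0]|no] := pselect (exists x, @simplex R d x); last first.
  by exists 0 => // x sx; case: no; exists x.
have cfn : {within @simplex R d, continuous (fun x => `|f x|)}.
  move=> x; apply: (@continuous_comp (subspace (@simplex R d)) R R f Num.norm); first exact: cf.
  exact: norm_continuous.
have [c _ H] := compact_EVT_max (ex_intro _ x0 sx0) simplex_compact cfn.
by exists `|f c| => // x sx; apply: H; rewrite inE.
Qed.

Lemma dderiv_lim f a x (l e : R) : is_dderiv f a x l -> 0 < e ->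
  exists2 dl, 0 < dl & forall t : R, t != 0 -> `|t| < dl -> simplex (x + t *: a) ->
    `|f (x + t *: a) - f x - l * t| <= e * `|t|.
Proof.
move=> [_ /cvgrPdist_lt H] e0; have := H e e0.
rewrite near_withinE /= => /nbhs_ballP[dl /= dl0 Hd].
exists dl => // t t0 tdl st.
have := Hd t; rewrite -ball_normE /= sub0r normrN => /(_ tdl t0 st) h.
have -> : f (x + t *: a) - f x - l * t = - ((l - (f (x + t *: a) - f x) / t) * t).
  by field.
by rewrite normrN normrM ler_wpM2r // ltW.
Qed.

Lemma dderiv_small f a x (l dl : R) : simplex x -> is_dderiv f a x l -> 0 < dl ->
  exists t : R, [/\ t != 0, `|t| < dl & simplex (x + t *: a)].
Proof.
move=> sx [[t t0 st] _] dl0.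
have tp : 0 < `|t| by rewrite normr_gt0.
pose th := Num.min 1 (dl / (2 * `|t|)).
have th0 : 0 < th by rewrite lt_min ltr01 divr_gt0 // mulr_gt0.
exists (th * t); split.
- by rewrite mulf_neq0 // gt_eqF.
- rewrite normrM (gtr0_norm th0); apply: le_lt_trans (_ : dl / (2 * `|t|) * `|t| < dl).
    by rewrite ler_wpM2r // ge_min lexx orbT.
  by rewrite invfM mulrA divfK ?gt_eqF // ltr_pdivrMr //; lra.
- have -> : x + (th * t) *: a = x + th *: (x + t *: a - x).
    by rewrite addrAC subrr add0r scalerA.
  by apply: simplex_convex => //; rewrite (ltW th0) ge_min lexx.
Qed.

Lemma dderiv_bound f a x (l C : R) : simplex x -> is_dderiv f a x l ->
  (exists2 rho, 0 < rho & forall t : R, `|t| < rho -> simplex (x + t *: a) ->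
     `|f (x + t *: a) - f x| <= C * `|t|) -> `|l| <= C.
Proof.
move=> sx dl [rho rho0 H]; apply/ler_addgt0Pr => e e0.
have [dlt dl0 Hd] := dderiv_lim dl e0.
have m0 : 0 < Num.min dlt rho by rewrite lt_min dl0.
have [t [t0]] := dderiv_small sx dl m0.
rewrite lt_min => /andP[td tr] st.
have tp : 0 < `|t| by rewrite normr_gt0.
rewrite -(ler_pM2r tp) -normrM.
have -> : l * t = (f (x + t *: a) - f x) - (f (x + t *: a) - f x - l * t) by ring.
by apply: le_trans (ler_normB _ _) _; rewrite mulrDl lerD ?H ?Hd.
Qed.

(** Identifies a derivative from a second-order expansion, also at boundary points where only one
    sign of t may be admissible. *)
Lemma dderiv_unique f a x (l g C : R) : simplex x -> is_dderiv f a x l ->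
  (exists2 rho, 0 < rho & forall t : R, `|t| < rho -> simplex (x + t *: a) ->
     `|f (x + t *: a) - f x - g * t| <= C * t ^+ 2) -> l = g.
Proof.
move=> sx dl [rho rho0 H]; apply/eqP; rewrite -subr_eq0 -normr_le0.
apply/ler_addgt0Pr => e e0; rewrite add0r.
have e20 : 0 < e / 2 by rewrite divr_gt0.
have C1 : 0 < `|C| + 1 by rewrite ltr_wpDl.
have [dlt dl0 Hd] := dderiv_lim dl e20.
have m0 : 0 < Num.min (Num.min dlt rho) (e / 2 / (`|C| + 1)).
  by rewrite !lt_min dl0 rho0 divr_gt0.
have [t [t0]] := dderiv_small sx dl m0.
rewrite !lt_min => /andP[/andP[td tr] te] st.
have tp : 0 < `|t| by rewrite normr_gt0.
rewrite -(ler_pM2r tp) -normrM.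
have -> : (l - g) * t = (f (x + t *: a) - f x - g * t) - (f (x + t *: a) - f x - l * t) by ring.
apply: le_trans (ler_normB _ _) _.
apply: le_trans (lerD (H t tr st) (Hd t t0 td st)) _.
have : C * t ^+ 2 <= e / 2 * `|t|.
  rewrite -real_normK ?num_real // expr2 mulrA ler_wpM2r //.
  move: te; rewrite ltr_pdivlMr // mulrDr mulr1 => te.
  have := ler_norm C; have := ler_wpM2r (ltW tp) (ler_norm C); lra.
lra.
Qed.

Lemma interior_gap x : simplex_interior x -> exists2 rho : R, 0 < rho & forall i, rho <= x 0 i.
Proof.
move=> ix; have [xp _] := (simplex_interiorP x).1 ix.
have [/existsP[i0 _]|no] := boolP [exists i : 'I_d, true].
  have [i _ Hi] := arg_minP (fun i => x 0 i) (isT : xpredT i0).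
  by exists (x 0 i) => // j; exact: Hi.
by exists 1 => // i; move/existsP: no => -[]; exists i.
Qed.

Lemma interior_small x : simplex_interior x ->
  exists2 rho : R, 0 < rho & forall a, tangent a -> l1 a < rho -> simplex_interior (x + a).
Proof.
move=> ix; have [xp xs] := (simplex_interiorP x).1 ix.
have [rho rho0 H] := interior_gap ix.
exists rho => // a ta la; apply/simplex_interiorP; split; last by rewrite sum_addt.
move=> i; rewrite mxE; have := coord_le_l1 a i; have := H i.
have := ler_norm (- a 0 i); rewrite normrN; lra.
Qed.

Lemma line_is_derive f a x (s l : R) :
  (exists2 rho, 0 < rho & forall t : R, `|t| < rho -> simplex (x + s *: a + t *: a)) ->
  is_dderiv f a (x + s *: a) l -> is_derive s 1 (fun s => f (x + s *: a)) l.
Proof.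
move=> [rho rho0 Hr] dl.
have dF : h^-1 *: (((fun s => f (x + s *: a)) \o shift s) h%:A - f (x + s *: a)) @[h --> 0^'] --> l.
  apply/cvgrPdist_le => e e0.
  have [dlt dl0 Hd] := dderiv_lim dl e0.
  near=> h.
  have h0 : h != 0 by near: h; exact: nbhs_dnbhs_neq.
  have hd : `|h| < dlt.
    by near: h; exists dlt => // h /=; rewrite sub0r normrN.
  have hr : `|h| < rho.
    by near: h; exists rho => // h /=; rewrite sub0r normrN.
  have := Hd h h0 hd (Hr h hr); rewrite /= /GRing.scale /= mulr1 => Hh.
  have -> : x + (h + s) *: a = x + s *: a + h *: a.
    by rewrite scalerDl [h *: a + _]addrC addrA.
  have -> : l - h^-1 * (f (x + s *: a + h *: a) - f (x + s *: a)) =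
    - (h^-1 * (f (x + s *: a + h *: a) - f (x + s *: a) - l * h)) by field.
  rewrite normrN normrM normfV ler_pdivrMl ?normr_gt0 //.
  by rewrite [leRHS]mulrC.
split; first by apply/cvg_ex; exists l.
exact: cvg_lim dF.
Unshelve. all: by end_near. Qed.

Lemma interior_is_derive f a x (s l : R) : tangent a -> simplex_interior (x + s *: a) ->
  is_dderiv f a (x + s *: a) l -> is_derive s 1 (fun s => f (x + s *: a)) l.
Proof.
move=> ta ix; apply: line_is_derive.
have [rho rho0 Hr] := interior_small ix.
have [eta eta0 Ha] := l1_scale_lt a rho0.
by exists eta => // t /Ha ht; have [] := Hr (t *: a) (tangentZ t ta) ht.
Qed.

Lemma interior_MVT f fa a x (r : R) : tangent a ->
  (forall xi, simplex_interior xi -> is_dderiv f a xi (fa xi)) ->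
  simplex_interior x -> simplex_interior (x + r *: a) ->
  exists2 c : R, 0 <= c <= 1 & f (x + r *: a) - f x = r * fa (x + (r * c) *: a).
Proof.
move=> ta Hf ix iy.
pose phi s := f (x + (r * s) *: a).
have seg (s : R) : 0 <= s <= 1 -> simplex_interior (x + (r * s) *: a).
  by move=> hs; rewrite mulrC -scalerA; exact: interior_segment.
have dphi (s : R) : 0 <= s <= 1 -> is_derive s 1 phi (r * fa (x + (r * s) *: a)).
  move=> hs.
  have D := interior_is_derive ta (seg s hs) (Hf _ (seg s hs)).
  have := is_derive1_comp (f := fun u => f (x + u *: a)) (g := fun s => r * s) D
    (is_deriveZ r (is_derive_id s 1)).
  by move=> H; apply: is_derive_eq H _; rewrite /GRing.scale /= mulr1 mulrC.
have [c hc] := MVT_closed ler01 dphi.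
by rewrite /phi mulr1 mulr0 scale0r addr0 subr0 mulr1 => E; exists c.
Qed.

End SimplexGeometry.

(** * Lipschitz bounds and expansions from directional derivatives *)

Section C2Functions.
Context {R : realType} {d : nat} (k0 : 'I_d).
Implicit Types (x y a v : 'rV[R]_d) (f : 'rV[R]_d -> R) (r : seq 'I_d).
Local Notation P := (@simplex R d).

(** For [k] other than [k0] these vectors form a basis of the tangent space; [eb k0] is zero. *)
Let eb k := evec R k k0.

Lemma tangent_evec (i j : 'I_d) : tangent (evec R i j).
Proof.
rewrite /tangent /evec; under eq_bigr do rewrite !mxE !eqxx /=.
rewrite sumrB (bigD1 i) //= eqxx big1 => [|k /negbTE ->//].
by rewrite (bigD1 j) //= eqxx big1 ?subrr // => k /negbTE ->.
Qed.

Lemma evec_coord (i j k : 'I_d) : `|evec R i j 0 k| <= 1.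
Proof.
rewrite /evec !mxE !eqxx /=; case: (k == i); case: (k == j);
  by rewrite ?subrr ?subr0 ?sub0r ?normrN ?normr0 ?normr1.
Qed.

Lemma tangent_decomp a : tangent a -> a = \sum_k a 0 k *: eb k.
Proof.
move=> ta; under eq_bigr do rewrite /eb /evec scalerBr.
rewrite sumrB -scaler_suml ta scale0r subr0.
by apply/rowP => j; rewrite {1}(row_sum_delta a).
Qed.

Lemma l1_evec (i j : 'I_d) : l1 (evec R i j) <= 2.
Proof.
rewrite /l1 /evec; apply: le_trans (_ : \sum_k ((k == i)%:R + (k == j)%:R) <= _).
  apply: ler_sum => k _; rewrite !mxE !eqxx /=; apply: le_trans (ler_normB _ _) _.
  by rewrite !normr_nat.
rewrite big_split /= (bigD1 i) //= eqxx big1 => [|k /negbTE ->//].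
by rewrite (bigD1 j) //= eqxx big1 => [|k /negbTE ->//]; rewrite !addr0.
Qed.

Lemma interior_step x (c : R) k : simplex_interior x -> (forall i, `|c| < x 0 i) ->
  simplex_interior (x + c *: eb k).
Proof.
move=> ix hc; have [x0 xs] := (simplex_interiorP x).1 ix.
apply/simplex_interiorP; split; last by rewrite sum_addt // ; apply: tangentZ; exact: tangent_evec.
move=> i; rewrite !mxE -[X in c * X](_ : eb k 0 i = _); last by rewrite /eb /evec !mxE.
have := ler_norm (- (c * eb k 0 i)); rewrite normrN normrM.
have := ler_wpM2l (normr_ge0 c) (evec_coord k k0 i); have := hc i.
rewrite -/(eb k); lra.
Qed.

Lemma coord_step x (c : R) k i : x 0 i - `|c| <= (x + c *: eb k) 0 i.
Proof.
rewrite mxE [X in _ <= _ + X]mxE.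
have := ler_norm (- (c * eb k 0 i)); rewrite normrN normrM.
have := ler_wpM2l (normr_ge0 c) (evec_coord k k0 i).
rewrite -/(eb k); lra.
Qed.

Section Path.
Context (f : 'rV[R]_d -> R) (gk : 'I_d -> 'rV[R]_d -> R).
Hypothesis dgk : forall k xi, simplex_interior xi -> is_dderiv f (eb k) xi (gk k xi).

(** The path follows one vector [eb k] at a time, since only these derivatives are controlled. Its
    parameters sum to less than every coordinate, which keeps it in the interior. *)
Lemma path_lipschitz (B : R) r (a : 'I_d -> R) x : simplex_interior x ->
  (forall k xi, simplex_interior xi -> `|gk k xi| <= B) ->
  (forall i, \sum_(k <- r) `|a k| < x 0 i) ->
  `|f (x + \sum_(k <- r) a k *: eb k) - f x| <= B * \sum_(k <- r) `|a k|.
Proof.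
move=> + hB; elim: r x => [|k r IH] x ix hx.
  by rewrite !big_nil addr0 subrr normr0 mulr0.
have S0 : 0 <= \sum_(k <- r) `|a k| by apply: sumr_ge0.
have hk i : `|a k| < x 0 i by have := hx i; rewrite big_cons; lra.
have iy := interior_step k ix hk.
rewrite !big_cons addrA.
have h1 : `|f (x + a k *: eb k + \sum_(j <- r) a j *: eb j) - f (x + a k *: eb k)|
    <= B * \sum_(j <- r) `|a j|.
  by apply: IH => // i; have := hx i; have := coord_step x (a k) k i; rewrite big_cons; lra.
have [c c01 E] := interior_MVT (tangent_evec k k0) (@dgk k) ix iy.
have h2 : `|f (x + a k *: eb k) - f x| <= B * `|a k|.
  rewrite E normrM mulrC ler_wpM2r // hB //.
  by rewrite mulrC -scalerA; exact: interior_segment.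
have -> : f (x + a k *: eb k + \sum_(j <- r) a j *: eb j) - f x =
  (f (x + a k *: eb k + \sum_(j <- r) a j *: eb j) - f (x + a k *: eb k)) +
  (f (x + a k *: eb k) - f x) by ring.
apply: le_trans (ler_normD _ _) _; lra.
Qed.

Lemma path_taylor (Lam : R) r (a : 'I_d -> R) x : simplex_interior x -> 0 <= Lam ->
  (forall k xi eta, simplex_interior xi -> simplex_interior eta ->
     `|gk k xi - gk k eta| <= Lam * l1 (xi - eta)) ->
  (forall i, \sum_(k <- r) `|a k| < x 0 i) ->
  `|f (x + \sum_(k <- r) a k *: eb k) - f x - \sum_(k <- r) a k * gk k x|
    <= 2 * Lam * (\sum_(k <- r) `|a k|) ^+ 2.
Proof.
move=> + Lam0 hL; elim: r x => [|k r IH] x ix hx.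
  by rewrite !big_nil addr0 !subrr normr0 expr0n mulr0.
set S := \sum_(k <- r) `|a k|.
have S0 : 0 <= S by apply: sumr_ge0.
have hk i : `|a k| < x 0 i by have := hx i; rewrite big_cons -/S; lra.
have iy := interior_step k ix hk.
rewrite !big_cons addrA -/S.
set y := x + a k *: eb k in iy *; set z := y + _.
have h1 : `|f z - f y - \sum_(j <- r) a j * gk j y| <= 2 * Lam * S ^+ 2.
  by apply: IH => // i; have := hx i; have := coord_step x (a k) k i; rewrite big_cons -/S -/y; lra.
have [c /andP[c0 c1] E] := interior_MVT (tangent_evec k k0) (@dgk k) ix iy.
have lk (t : R) : l1 (t *: eb k) <= 2 * `|t|.
  by rewrite l1Z mulrC ler_wpM2r // l1_evec.
have h2 : `|f y - f x - a k * gk k x| <= 2 * Lam * `|a k| ^+ 2.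
  rewrite E -mulrBr normrM.
  have iz : simplex_interior (x + (a k * c) *: eb k).
    by rewrite mulrC -scalerA; apply: interior_segment => //; rewrite c0.
  apply: le_trans (ler_wpM2l (normr_ge0 _) (hL k _ _ iz ix)) _.
  rewrite addrAC subrr add0r.
  have q : l1 ((a k * c) *: eb k) <= 2 * `|a k|.
    apply: le_trans (lk _) _; rewrite normrM (ger0_norm c0) ler_wpM2l // ler_piMr //.
  have := ler_wpM2l Lam0 q => /(ler_wpM2l (normr_ge0 (a k))); lra.
have h3 : `|\sum_(j <- r) a j * gk j y - \sum_(j <- r) a j * gk j x| <= 2 * Lam * `|a k| * S.
  rewrite -sumrB; apply: le_trans (ler_norm_sum _ _ _) _.
  rewrite mulr_sumr; apply: ler_sum => j _; rewrite -mulrBr normrM mulrC ler_wpM2r //.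
  apply: le_trans (hL j _ _ iy ix) _; rewrite /y addrAC subrr add0r.
  by have := ler_wpM2l Lam0 (lk (a k)); lra.
have -> : f z - f x - (a k * gk k x + \sum_(j <- r) a j * gk j x) =
  (f z - f y - \sum_(j <- r) a j * gk j y) +
  ((f y - f x - a k * gk k x) +
  (\sum_(j <- r) a j * gk j y - \sum_(j <- r) a j * gk j x)) by ring.
apply: le_trans (ler_normD _ _) _; apply: le_trans (lerD h1 (ler_normD _ _)) _.
have : 0 <= Lam * `|a k| * S by rewrite !mulr_ge0.
lra.
Qed.

End Path.

Definition bary : 'rV[R]_d := const_mx d%:R^-1.

Lemma bary_interior : simplex_interior bary.
Proof.
have d0 : (0 < d)%N by case: d k0 => [[]|].
have dR : 0 < d%:R :> R by rewrite ltr0n.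
apply/simplex_interiorP; split=> [i|]; first by rewrite mxE invr_gt0.
under eq_bigr do rewrite mxE.
by rewrite sumr_const card_ord -[LHS]mulr_natr mulVf // gt_eqF.
Qed.

(** Contraction towards the barycentre, which maps the closed simplex into its interior for 0 < th
    <= 1; estimates proved in the interior pass to the boundary as th tends to 0. *)
Definition toward x (th : R) := x + th *: (bary - x).

Lemma toward_interior x th : simplex x -> 0 < th <= 1 -> simplex_interior (toward x th).
Proof. by move=> sx h; apply: interior_convex => //; exact: bary_interior. Qed.

Lemma toward_cont f x : {within P, continuous f} -> simplex x ->
  {within `[0, 1], continuous (fun th => f (toward x th))}.
Proof.
move=> cf sx; apply: line_cont => // th; rewrite /= in_itv /= => h.
by apply: simplex_convex => //; case: bary_interior.
Qed.

Lemma toward0 x : toward x 0 = x. Proof. by rewrite /toward scale0r addr0. Qed.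

Lemma towardB x y th : toward y th - toward x th = (1 - th) *: (y - x).
Proof.
rewrite /toward; apply/rowP => i; rewrite !mxE; ring.
Qed.

Lemma lipschitz_closure f (C : R) : 0 <= C -> {within P, continuous f} ->
  (forall x y, simplex_interior x -> simplex_interior y -> `|f y - f x| <= C * l1 (y - x)) ->
  forall x y, simplex x -> simplex y -> `|f y - f x| <= C * l1 (y - x).
Proof.
move=> C0 cf H x y sx sy.
have half u v : simplex u -> simplex v -> f v - f u <= C * l1 (v - u).
  move=> su sv; rewrite -subr_le0 -[in f v](toward0 v) -[in f u](toward0 u).
  apply: (within_itv_le_start (g := fun th => f (toward v th) - f (toward u th) - C * l1 (v - u)) ltr01).
    apply: within_contB; last exact: within_cont_cst.
    by apply: within_contB; exact: toward_cont.
  move=> th h; rewrite subr_le0; apply: le_trans (ler_norm _) _.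
  apply: le_trans (H _ _ (toward_interior su h) (toward_interior sv h)) _.
  rewrite towardB l1Z ler_wpM2l // ler_piMl ?l1_ge0 //.
  by have /andP[h1 h2] := h; rewrite ger0_norm; lra.
rewrite ler_norml; apply/andP; split; last exact: half.
have := half y x sy sx; have -> : l1 (x - y) = l1 (y - x).
  by rewrite -opprB -scaleN1r l1Z normrN1 mul1r.
lra.
Qed.

(** The direction y - x varies with the points, and [D] comes with no bound uniform in the
    direction. Paths along the [eb k] bound it by finitely many continuous functions on a compact
    set. *)
Lemma C1_lipschitz f (D : 'rV[R]_d -> 'rV[R]_d -> R) : {within P, continuous f} ->
  (forall a, tangent a -> {within P, continuous (D a)}) ->
  (forall a xi, tangent a -> simplex_interior xi -> is_dderiv f a xi (D a xi)) ->
  exists2 C : R, 0 <= C & (forall x y, simplex x -> simplex y -> `|f y - f x| <= C * l1 (y - x)).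
Proof.
move=> cf cD dD.
have /choice[Bk HBk] : forall k, exists B : R, 0 <= B /\ forall x, simplex x -> `|D (eb k) x| <= B.
  by move=> k; have [B B0 HB] := cont_bounded (cD _ (tangent_evec k k0)); exists B.
pose B := \sum_k Bk k.
have B0 : 0 <= B by apply: sumr_ge0 => k _; case: (HBk k).
have HB k xi : simplex_interior xi -> `|D (eb k) xi| <= B.
  move=> [sxi _]; apply: le_trans ((HBk k).2 _ sxi) _; rewrite /B (bigD1 k) //= lerDl.
  by apply: sumr_ge0 => j _; case: (HBk j).
exists B => //; apply: lipschitz_closure => // x y ix iy.
have ta : tangent (y - x) by apply: tangentB; [case: ix|case: iy].
have iy' : simplex_interior (x + 1 *: (y - x)) by rewrite scale1r subrKC.
have [c c01] := interior_MVT ta (fun xi => @dD _ xi ta) ix iy'.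
rewrite scale1r subrKC !mul1r => ->.
set xi := x + _.
have ixi : simplex_interior xi.
  by apply: interior_segment => //; rewrite subrKC.
have [rho rho0 Hr] := interior_gap ixi.
apply: (dderiv_bound (proj1 ixi) (dD _ _ ta ixi)).
have [eta eta0 Ha] := l1_scale_lt (y - x) rho0.
exists eta => // t /Ha tl _.
rewrite [t *: _](tangent_decomp (tangentZ t ta)).
apply: le_trans (path_lipschitz (fun k xi => @dD (eb k) xi (tangent_evec k k0))
  (a := fun k => (t *: (y - x)) 0 k) ixi HB _) _.
  by move=> i; apply: lt_le_trans (Hr i).
by rewrite -[X in B * X]/(l1 (t *: (y - x))) l1Z [`|t| * _]mulrC mulrA.
Qed.

End C2Functions.

(** * Estimates by the C^2 norm *)

Section C2Norm.
Context {R : realType} {d : nat} (k0 : 'I_d).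
Implicit Types (x y a v : 'rV[R]_d) (f : 'rV[R]_d -> R).
Local Notation P := (@simplex R d).
Local Notation V := 'rV[R]_d.

Let eb k := evec R k k0.

Definition derivatives f (D : V -> V -> R) (DD : V -> V -> V -> R) :=
  [/\ {within P, continuous f},
      forall a, tangent a -> {within P, continuous (D a)},
      forall a xi, tangent a -> simplex_interior xi -> is_dderiv f a xi (D a xi),
      forall a b, tangent a -> tangent b -> {within P, continuous (DD a b)} &
      forall a b xi, tangent a -> tangent b -> simplex_interior xi ->
        is_dderiv (D a) b xi (DD a b xi)].

Lemma C2_derivatives f : C2_simplex f -> exists D DD, derivatives f D DD.
Proof.
move=> [cf H].
have /choice[D HD] : forall a, exists fa : V -> R, tangent a ->
   [/\ {within P, continuous fa},
        forall xi, simplex_interior xi -> is_dderiv f a xi (fa xi) &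
        forall b, tangent b -> exists fab : V -> R, {within P, continuous fab} /\
          forall xi, simplex_interior xi -> is_dderiv fa b xi (fab xi)].
  move=> a; have [ta|nta] := pselect (tangent a); last by exists (fun=> 0).
  by have [fa Hfa] := H a ta; exists fa.
have /choice[DD HDD] : forall ab : V * V, exists fab : V -> R, tangent ab.1 -> tangent ab.2 ->
   {within P, continuous fab} /\
   forall xi, simplex_interior xi -> is_dderiv (D ab.1) ab.2 xi (fab xi).
  move=> [a b]; have [ta|nta] := pselect (tangent a); last by exists (fun=> 0).
  have [tb|ntb] := pselect (tangent b); last by exists (fun=> 0).
  by have [_ _ /(_ b tb)[fab Hfab]] := HD a ta; exists fab.
exists D, (fun a b => DD (a, b)); split => //.
- by move=> a /HD[].
- by move=> a xi /HD[_ h _]; exact: h.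
- by move=> a b ta tb; case: (HDD (a, b) ta tb).
- by move=> a b xi ta tb; case: (HDD (a, b) ta tb) => _ h; exact: h.
Qed.

Lemma unit_tangent_coord a i : unit_tangent a -> `|a 0 i| <= 1.
Proof.
move=> [s1 _].
have S1 : \sum_k a 0 k ^+ 2 = 1.
  have S0 : 0 <= \sum_k a 0 k ^+ 2 by apply: sumr_ge0 => k _; exact: sqr_ge0.
  by rewrite -(sqr_sqrtr S0) s1 expr1n.
rewrite -(@expr_le1 _ 2) // real_normK ?num_real // -S1 (bigD1 i) //= lerDl.
by apply: sumr_ge0 => k _; exact: sqr_ge0.
Qed.

Section Taylor.
Context (f : V -> R) (D : V -> V -> R) (DD : V -> V -> V -> R).
Hypothesis hf : derivatives f D DD.

(** The gradient as a form linear in [a] by construction: the family [D] is given direction by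
    direction, with no linear relation between its members. *)
Let g a x := \sum_k a 0 k * D (eb k) x.

Lemma gradZ (c : R) a x : g (c *: a) x = c * g a x.
Proof. by rewrite /g mulr_sumr; apply: eq_bigr => k _; rewrite mxE mulrA. Qed.

(** Compactness bounds the finitely many [D (eb k)] and their Lipschitz constants; linearity extends
    this to all [a]. The expansion is proved in the interior and extended to the closed simplex
    along [toward]. *)
Lemma grad_facts : exists C : R, [/\ 0 <= C,
  forall a x, simplex x -> `|g a x| <= C * l1 a,
  forall a x y, simplex x -> simplex y -> `|g a x - g a y| <= C * l1 a * l1 (x - y) &
  forall a x, simplex x -> simplex (x + a) -> `|f (x + a) - f x - g a x| <= C * l1 a ^+ 2].
Proof.
have [cf cD dD cDD dDD] := hf.
have te k : tangent (eb k) by exact: tangent_evec.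
have /choice[Bk HBk] : forall k, exists B : R, 0 <= B /\ forall x, simplex x -> `|D (eb k) x| <= B.
  by move=> k; have [B B0 HB] := cont_bounded (cD _ (te k)); exists B.
have /choice[Lk HLk] : forall k, exists L : R, 0 <= L /\
    forall x y, simplex x -> simplex y -> `|D (eb k) y - D (eb k) x| <= L * l1 (y - x).
  move=> k; have [L L0 HL] := C1_lipschitz k0 (cD _ (te k)) (fun b => cDD _ b (te k))
    (fun b xi tb => dDD _ b xi (te k) tb).
  by exists L.
have B0 : 0 <= \sum_k Bk k by apply: sumr_ge0 => k _; case: (HBk k).
have L0 : 0 <= \sum_k Lk k by apply: sumr_ge0 => k _; case: (HLk k).
set B := \sum_k Bk k in B0; set L := \sum_k Lk k in L0.
have HB k x : simplex x -> `|D (eb k) x| <= B.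
  move=> sx; apply: le_trans ((HBk k).2 _ sx) _; rewrite /B (bigD1 k) //= lerDl.
  by apply: sumr_ge0 => j _; case: (HBk j).
have HL k x y : simplex x -> simplex y -> `|D (eb k) x - D (eb k) y| <= L * l1 (x - y).
  move=> sx sy; apply: le_trans ((HLk k).2 _ _ sy sx) _; rewrite ler_wpM2r ?l1_ge0 //.
  rewrite /L (bigD1 k) //= lerDl; apply: sumr_ge0 => j _; by case: (HLk j).
have G2 a x y : simplex x -> simplex y -> `|g a x - g a y| <= L * l1 a * l1 (x - y).
  move=> sx sy; rewrite /g -sumrB; apply: le_trans (ler_norm_sum _ _ _) _.
  rewrite [L * _]mulrC -mulrA {1}/l1 mulr_suml; apply: ler_sum => k _.
  by rewrite -mulrBr normrM ler_wpM2l // HL.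
(* The expansion along basis paths identifies the derivative in every direction with the linear
   form. *)
have DE a xi : tangent a -> simplex_interior xi -> D a xi = g a xi.
  move=> ta ixi; apply: (@dderiv_unique _ _ f a xi _ _ (2 * L * l1 a ^+ 2) (proj1 ixi)).
    exact: dD.
  have [rho rho0 Hr] := interior_gap ixi.
  have [r r0 Ha] := l1_scale_lt a rho0.
  exists r => // t /Ha tl _.
  have hgk k xi' : simplex_interior xi' -> is_dderiv f (eb k) xi' (D (eb k) xi').
    by move=> h; exact: dD.
  have hLi k xi' eta : simplex_interior xi' -> simplex_interior eta ->
     `|D (eb k) xi' - D (eb k) eta| <= L * l1 (xi' - eta).
    by move=> [h1 _] [h2 _]; exact: HL.
  have := path_taylor (r := index_enum 'I_d) (a := fun k => (t *: a) 0 k) hgk ixi L0 hLi _.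
  rewrite -(tangent_decomp k0 (tangentZ t ta)) -[\sum_k _ * D _ _]/(g (t *: a) xi) gradZ mulrC.
  rewrite -/(l1 (t *: a)) => H.
  apply: le_trans (H _) _; first by move=> i; apply: lt_le_trans (Hr i).
  by rewrite l1Z exprMn real_normK ?num_real //; le_ring.
have G3i a x : tangent a -> simplex_interior x -> simplex_interior (x + a) ->
    `|f (x + a) - f x - g a x| <= L * l1 a ^+ 2.
  move=> ta ix iy.
  have iy' : simplex_interior (x + 1 *: a) by rewrite scale1r.
  have [c c01] := interior_MVT ta (fun xi => @dD _ xi ta) ix iy'.
  rewrite scale1r !mul1r => ->.
  have ic : simplex_interior (x + c *: a) by exact: interior_segment.
  rewrite DE //; apply: le_trans (G2 _ _ _ (proj1 ic) (proj1 ix)) _.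
  rewrite addrAC subrr add0r l1Z; have /andP[h0 h1] := c01; rewrite (ger0_norm h0).
  rewrite expr2 -mulrA; apply: ler_wpM2l => //; apply: ler_wpM2l; first exact: l1_ge0.
  by rewrite ler_piMl ?l1_ge0.
exists (B + L); split; first exact: addr_ge0.
- move=> a x sx; apply: le_trans (_ : B * l1 a <= _); last first.
    by rewrite ler_wpM2r ?l1_ge0 // lerDl.
  rewrite /g; apply: le_trans (ler_norm_sum _ _ _) _; rewrite {1}/l1 mulr_sumr.
  by apply: ler_sum => k _; rewrite normrM mulrC ler_wpM2r // HB.
- move=> a x y sx sy; apply: le_trans (G2 a x y sx sy) _.
  by rewrite !ler_wpM2r ?l1_ge0 // lerDr.
- move=> a x sx sy; have ta := tangent_of_simplex sx sy.
  apply: le_trans (_ : L * l1 a ^+ 2 <= _); last first.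
    by rewrite ler_wpM2r ?sqr_ge0 // lerDr.
  have cT y := toward_cont k0 cf (x := y).
  have cG : {within `[0, 1], continuous (fun th : R => (1 - th) * g a (toward x th))}.
    apply: within_contM.
      apply: within_contB; first exact: within_cont_cst.
      by apply: continuous_subspaceT => t; exact: cvg_id.
    rewrite /g; apply: within_cont_sum => k.
    apply: within_contM; first exact: within_cont_cst.
    by apply: toward_cont => //; exact: cD.
  have E (th : R) : 0 < th <= 1 ->
      `|f (toward (x + a) th) - f (toward x th) - (1 - th) * g a (toward x th)| <= L * l1 a ^+ 2.
    move=> h; have tE : toward (x + a) th = toward x th + (1 - th) *: a.
      by have := towardB x (x + a) th; rewrite [x + a - x]addrAC subrr add0r => <-; rewrite subrKC.
    rewrite tE -gradZ; apply: le_trans (G3i _ _ _ _ _) _.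
    - exact: tangentZ.
    - exact: toward_interior.
    - by rewrite -tE; exact: toward_interior.
    have /andP[h0 h1] := h.
    rewrite l1Z ger0_norm ?subr_ge0 // exprMn ler_wpM2l // ler_piMl ?sqr_ge0 //.
    by rewrite expr_le1 //; lra.
  have X0 : f (x + a) - f x - g a x =
     f (toward (x + a) 0) - f (toward x 0) - (1 - 0) * g a (toward x 0).
    by rewrite !toward0 subr0 mul1r.
  have cF : {within `[0, 1], continuous (fun th : R =>
     f (toward (x + a) th) - f (toward x th) - (1 - th) * g a (toward x th))}.
    by apply: within_contB => //; apply: within_contB; exact: cT.
  by rewrite X0; exact: (within_itv_norm_start ltr01 cF E).
Qed.

Lemma l1_unit a : unit_tangent a -> l1 a <= d%:R.
Proof.
by move=> ua; rewrite -[leRHS]mulr1; apply: l1_le => i; exact: unit_tangent_coord.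
Qed.

(** The [sup] of an unbounded set is 0 by convention, so [C2_norm] bounds nothing until its sets are
    known to be bounded. They include derivatives at boundary points, which is why the expansion up
    to the boundary is used. *)
Lemma dderivs_bounded : exists C : R,
  (forall x a l, simplex x -> unit_tangent a -> is_dderiv f a x l -> `|l| <= C) /\
  (forall x a l, simplex x -> unit_tangent a -> is_dderiv2 f a x l -> `|l| <= C).
Proof.
have [C [C0 G1 G2 G3]] := grad_facts.
have lg x a l : simplex x -> is_dderiv f a x l -> l = g a x.
  move=> sx dl; apply: (@dderiv_unique _ _ f a x _ _ (C * l1 a ^+ 2) sx dl).
  exists 1 => // t _ st; have := G3 _ _ sx st.
  rewrite gradZ l1Z exprMn real_normK ?num_real // [g a x * t]mulrC.
  by move=> /le_trans; apply; le_ring.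
have d0 : 0 <= d%:R :> R by exact: ler0n.
exists (C * d%:R + C * d%:R ^+ 2); split=> x a l sx ua.
  move=> /(lg _ _ _ sx) ->; apply: le_trans (G1 _ _ sx) _.
  apply: le_trans (_ : C * d%:R <= _); first by rewrite ler_wpM2l // l1_unit.
  by rewrite lerDl mulr_ge0 // sqr_ge0.
move=> [f1 [Hf1 dl]]; apply: (dderiv_bound sx dl).
have /nbhs_ballP[rho /= rho0 Hr] := Hf1.
have f1E s : `|s| < rho -> simplex (x + s *: a) -> f1 (x + s *: a) = g a (x + s *: a).
  move=> hs ss; apply: lg => //; apply: Hr => //.
  by rewrite -ball_normE /= sub0r normrN.
exists rho => // t ht st.
have -> : f1 x = g a x.
  by have := f1E 0; rewrite normr0 scale0r addr0; apply.
rewrite f1E //; apply: le_trans (G2 _ _ _ st sx) _.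
rewrite addrAC subrr add0r l1Z mulrCA [leRHS]mulrC; apply: ler_wpM2l => //.
have L := l1_unit ua; have l0 := l1_ge0 a.
apply: le_trans (_ : C * (l1 a * l1 a) <= _); first by rewrite mulrA.
apply: le_trans (_ : C * d%:R ^+ 2 <= _); last by rewrite lerDr mulr_ge0.
by rewrite ler_wpM2l // expr2 ler_pM.
Qed.

End Taylor.

Lemma sup_ge0 (A : set R) : (forall z, A z -> 0 <= z) -> 0 <= sup A.
Proof.
move=> h; have [[[z Az] hb]|ns] := pselect (has_sup A); last by rewrite sup_out.
by apply: le_trans (h _ Az) _; exact: ub_le_sup.
Qed.

Lemma C2_norm_bounds f (M0 : R) : C2_simplex f -> C2_norm f = M0 ->
  [/\ 0 <= M0, forall x, simplex x -> `|f x| <= M0,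
      forall x y, simplex x -> simplex y -> `|f y - f x| <= M0 * l1 (y - x) &
      forall x a, simplex x -> simplex (x + a) -> simplex (x - a) ->
        `|f (x + a) + f (x - a) - 2 * f x| <= 2 * M0 * l1 a ^+ 2].
Proof.
move=> c2 <-; have [D [DD hf]] := C2_derivatives c2.
have [C [HC1 HC2]] := dderivs_bounded hf.
have [cf cD dD cDD dDD] := hf.
rewrite /C2_norm; set A0 := [set y | exists2 xi, _ & _].
set A1 := [set y | exists xi a l, [/\ _, _, is_dderiv f a xi l & _]].
set A2 := [set y | exists xi a l, _].
have s0 : 0 <= sup A0 by apply: sup_ge0 => y [x _ ->].
have s1 : 0 <= sup A1 by apply: sup_ge0 => y [x [a [l [_ _ _ ->]]]].
have s2 : 0 <= sup A2 by apply: sup_ge0 => y [x [a [l [_ _ _ ->]]]].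
have [B B0 HB] := cont_bounded cf.
have h0 x : simplex x -> `|f x| <= sup A0.
  move=> sx; apply: ub_le_sup; last by exists x.
  by exists B => y [z sz ->]; exact: HB.
have h1 x a : simplex_interior x -> unit_tangent a -> `|D a x| <= sup A1.
  move=> ix ua; apply: ub_le_sup.
    by exists C => y [z [b [l [sz ub dl ->]]]]; exact: HC1 dl.
  by exists x, a, (D a x); split => //; [case: ix|apply: dD => //; case: ua].
have h2 x a : simplex_interior x -> unit_tangent a -> `|DD a a x| <= sup A2.
  move=> ix ua; have ta := proj2 ua; apply: ub_le_sup.
    by exists C => y [z [b [l [sz ub dl ->]]]]; exact: HC2 dl.
  exists x, a, (DD a a x); split => //; first by case: ix.
  exists (D a); split; last exact: dDD.
  have [rho rho0 Hr] := interior_small ix.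
  have [r r0 Ha] := l1_scale_lt a rho0.
  apply/nbhs_ballP; exists r => // s; rewrite -ball_normE /= sub0r normrN => /Ha hs _.
  by apply: dD => //; apply: Hr => //; exact: tangentZ.
set M := sup A0 + sup A1 + sup A2.
have M1 : sup A1 <= M by rewrite /M; lra.
have M2 : sup A2 <= M by rewrite /M; lra.
have Mge0 : 0 <= M by rewrite /M; lra.
(* [C2_norm] refers to directions of Euclidean norm 1, whereas the estimates are in the [l1] norm,
   which is larger. *)
have normalize a : tangent a -> exists n b, [/\ 0 <= n, n <= l1 a, a = n *: b & (n = 0 \/ unit_tangent b)].
  move=> ta; pose q := \sum_k a 0 k ^+ 2.
  have q0 : 0 <= q by apply: sumr_ge0 => k _; exact: sqr_ge0.
  have nl : Num.sqrt q <= l1 a.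
    rewrite -[l1 a]ger0_norm ?l1_ge0 // -sqrtr_sqr ler_wsqrtr //.
    rewrite expr2 {1}/l1 mulr_suml; apply: ler_sum => k _.
    rewrite -[a 0 k ^+ 2]real_normK ?num_real // expr2 ler_wpM2l //.
    exact: coord_le_l1.
  have [n0|nn] := eqVneq (Num.sqrt q) 0.
    exists 0, 0; split => //; [exact: l1_ge0| |by left].
    rewrite scale0r; apply/rowP => k; rewrite mxE; apply/eqP.
    rewrite -sqrf_eq0 eq_le sqr_ge0 andbT.
    apply: le_trans (_ : q <= 0); first by rewrite /q (bigD1 k) //= lerDl sumr_ge0 // => j _; exact: sqr_ge0.
    by rewrite -sqrtr_eq0; apply/eqP.
  exists (Num.sqrt q), ((Num.sqrt q)^-1 *: a); split => //.
  - by rewrite scalerA mulfV // scale1r.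
  - right; split; last exact: tangentZ.
    under eq_bigr do rewrite mxE exprMn; rewrite -mulr_sumr -/q sqrtrM ?sqr_ge0 //.
    by rewrite sqrtr_sqr ger0_norm ?invr_ge0 ?sqrtr_ge0 // mulVf.
split => //.
- by move=> x sx; apply: le_trans (h0 x sx) _; rewrite /M; lra.
- apply: (lipschitz_closure k0) => // x y ix iy.
  have ta : tangent (y - x) by apply: tangentB; [case: ix|case: iy].
  have [n [b [n0 nl ab ub]]] := normalize _ ta.
  have yE : y = x + n *: b by rewrite -ab subrKC.
  case: ub => [nz|ub].
    by rewrite {1}yE nz scale0r addr0 subrr normr0 mulr_ge0 // l1_ge0.
  have iy' : simplex_interior (x + n *: b) by rewrite -yE.
  have [c c01] := interior_MVT (proj2 ub) (fun xi => @dD _ xi (proj2 ub)) ix iy'.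
  rewrite -yE => ->; rewrite normrM (ger0_norm n0) mulrC.
  apply: ler_pM => //; apply: le_trans (h1 _ _ _ ub) M1.
  by rewrite mulrC -scalerA; exact: interior_segment.
- have Hi x a : simplex_interior x -> simplex_interior (x + a) -> simplex_interior (x - a) ->
      `|f (x + a) + f (x - a) - 2 * f x| <= 2 * M * l1 a ^+ 2.
    move=> ix ip im; have ta := tangent_of_simplex (proj1 ix) (proj1 ip).
    have [n [b [n0 nl ab ub]]] := normalize _ ta.
    case: ub => [nz|ub].
      rewrite ab nz scale0r addr0 subr0 -[f x + f x]mulr2n mulr_natl subrr normr0; ge0.
    have tb := proj2 ub.
    pose psi (s : R) := f (x + s *: b) + f (x + (- s) *: b).
    have seg (s : R) : 0 <= s <= n -> simplex_interior (x + s *: b) /\ simplex_interior (x + (- s) *: b).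
      move=> /andP[s0' sn].
      have [nz|nn] := eqVneq n 0.
        have -> : s = 0 by lra.
        by rewrite oppr0 scale0r addr0.
      have np : 0 < n by rewrite lt_def nn.
      have -> : s = (s / n) * n by rewrite divfK.
      have h01 : 0 <= s / n <= 1 by apply/andP; split; [exact: divr_ge0|rewrite ler_pdivrMr // mul1r].
      move: (s / n) h01 => th h01.
      rewrite -mulrN -!scalerA scaleNr -ab; split; exact: interior_segment.
    have dpsi (s : R) : 0 <= s <= n -> is_derive s 1 psi (D b (x + s *: b) - D b (x + (- s) *: b)).
      move=> hs; have [i1 i2] := seg s hs.
      have d1 := interior_is_derive tb i1 (dD _ _ tb i1).
      have d2 := interior_is_derive tb i2 (dD _ _ tb i2).
      have d3 := is_derive1_comp (f := fun u => f (x + u *: b)) (g := -%R) d2 (is_deriveNid s 1).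
      have := is_deriveD d1 d3; move=> H; apply: is_derive_eq H _.
      by rewrite /GRing.scale /= mulrN1.
    have [c hc] := MVT_closed n0 dpsi; have [i1 i2] := seg c hc; have /andP[c0 cn] := hc.
    rewrite /psi oppr0 scale0r !addr0 scaleNr -ab -[f x + f x]mulr2n -[f x *+ 2]mulr_natl => ->.
    have e1 : x + c *: b = x + (- c) *: b + (2 * c) *: b.
      by rewrite -addrA -scalerDl; congr (_ + _ *: _); ring.
    have i1' := i1; rewrite e1 in i1'.
    (* The second mean value theorem runs over a segment of length 2 c <= 2 n, whence the factor
       2. *)
    have [c' c01] := interior_MVT tb (fun xi => @dDD b b xi tb tb) i2 i1'.
    rewrite -e1 => ->.
    have h : `|DD b b (x + (- c) *: b + (2 * c * c') *: b)| <= M.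
      apply: le_trans (h2 _ _ _ ub) M2.
      by rewrite mulrC -scalerA; exact: interior_segment.
    rewrite !normrM (ger0_norm n0) (ger0_norm c0) (ger0_norm (ler0n _ 2)).
    have -> : 2 * M * l1 a ^+ 2 = 2 * l1 a * M * l1 a by ring.
    apply: ler_pM => //; first by rewrite !mulr_ge0.
    apply: ler_pM => //; first by rewrite !mulr_ge0.
    by rewrite ler_wpM2l //; lra.
  move=> x a sx sp sm.
  have cT y := toward_cont k0 cf (x := y).
  have E (th : R) : 0 < th <= 1 ->
      `|f (toward (x + a) th) + f (toward (x - a) th) - 2 * f (toward x th)| <= 2 * M * l1 a ^+ 2.
    move=> h.
    have tE : toward (x + a) th = toward x th + (1 - th) *: a.
      by have := towardB x (x + a) th; rewrite [x + a - x]addrAC subrr add0r => <-; rewrite subrKC.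
    have tE' : toward (x - a) th = toward x th - (1 - th) *: a.
      have := towardB x (x - a) th; rewrite [x - a - x]addrAC subrr add0r scalerN => <-.
      by rewrite subrKC.
    rewrite tE tE'; apply: le_trans (Hi _ _ _ _ _) _.
    - exact: toward_interior.
    - by rewrite -tE; exact: toward_interior.
    - by rewrite -tE'; exact: toward_interior.
    have /andP[h0' h1'] := h.
    rewrite l1Z ger0_norm ?subr_ge0 // exprMn ler_wpM2l // ?mulr_ge0 // ler_piMl ?sqr_ge0 //.
    by rewrite expr_le1 //; lra.
  have X0 : f (x + a) + f (x - a) - 2 * f x =
     f (toward (x + a) 0) + f (toward (x - a) 0) - 2 * f (toward x 0) by rewrite !toward0.
  have cF : {within `[0, 1], continuous (fun th : R =>
     f (toward (x + a) th) + f (toward (x - a) th) - 2 * f (toward x th))}.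
    apply: within_contB; first by apply: within_contD; exact: cT.
    by apply: within_contM; [exact: within_cont_cst|exact: cT].
  by rewrite X0; exact: (within_itv_norm_start ltr01 cF E).
Qed.

End C2Norm.

(** * Lattices in the simplex *)

Section Lattice.
Context {R : realType} {d : nat}.
Implicit Types (x y : 'rV[R]_d) (h : R).
Local Notation E := ('I_d * 'I_d)%type.
Implicit Types (e : E).

Definition ev e : 'rV[R]_d := evec R e.1 e.2.
Definition rev_pair e : E := (e.2, e.1).

Lemma rev_pairK : involutive rev_pair. Proof. by case. Qed.

Lemma ev_rev e : ev (rev_pair e) = - ev e.
Proof. by rewrite /ev /evec opprB. Qed.

Lemma ev_coord e k : `|ev e 0 k| <= 1.
Proof. exact: evec_coord. Qed.

Lemma tangent_ev e : tangent (ev e). Proof. exact: tangent_evec. Qed.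

Lemma tangent_hev h e : tangent (h *: ev e).
Proof. exact: tangentZ (tangent_ev e). Qed.

Lemma hev_coord h e k : 0 < h -> `|(h *: ev e) 0 k| <= h.
Proof.
move=> h0; rewrite mxE normrM (gtr0_norm h0) ler_piMr ?(ltW h0) //.
exact: ev_coord.
Qed.

Lemma l1_hev h e : 0 < h -> l1 (h *: ev e) <= 2 * h.
Proof. by move=> h0; rewrite l1Z (gtr0_norm h0) mulrC ler_wpM2r ?(ltW h0) // l1_evec. Qed.

(** Constant extrapolation makes a point its own neighbour, so that extrapolated differences vanish
    without a case distinction in the Hamiltonian. *)
Definition nb h e x :=
  if x + h *: ev e \in @simplex R d then x + h *: ev e else x.

Lemma nb_simplex h e x : simplex x -> simplex (nb h e x).
Proof. by move=> sx; rewrite /nb; case: ifPn => // /set_mem. Qed.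

Lemma nb_in h e x : simplex (x + h *: ev e) -> nb h e x = x + h *: ev e.
Proof. by move=> sx; rewrite /nb mem_set. Qed.

Lemma nb_cases h e x : simplex x -> nb h e x = x \/
  (nb h e x = x + h *: ev e /\ nb h (rev_pair e) (nb h e x) = x).
Proof.
move=> sx; rewrite {1 2}/nb; case: ifPn => h1; [right|by left].
rewrite /nb h1; split => //; rewrite ev_rev scalerN addrK.
by rewrite mem_set.
Qed.

(** Four steps leave room for two successive mesh steps and for the factor 2 in [coef_regular]. *)
Definition deep h : pred 'rV[R]_d := fun x => [forall k, 4 * h <= x 0 k].

Lemma deepP h x : reflect (forall k, 4 * h <= x 0 k) (deep h x).
Proof. exact: forallP. Qed.

Lemma shift_simplex x (a : 'rV[R]_d) : simplex x -> tangent a ->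
  (forall k, `|a 0 k| <= x 0 k) -> simplex (x + a).
Proof.
move=> sx ta ha; have [_ s1] := (simplexP x).1 sx.
apply/simplexP; split; last by rewrite sum_addt.
by move=> k; rewrite mxE; have := ha k; have := ler_norm (- a 0 k); rewrite normrN; lra.
Qed.

Lemma deep_nb h e x : 0 < h -> simplex x -> deep h x -> nb h e x = x + h *: ev e.
Proof.
move=> h0 sx /deepP dx; apply: nb_in; apply: shift_simplex => //; first exact: tangent_hev.
by move=> k; have := hev_coord e k h0; have := dx k; lra.
Qed.

Lemma deep_nb2 h e e' x : 0 < h -> simplex x -> deep h x ->
  nb h e (nb h e' x) = x + h *: ev e' + h *: ev e.
Proof.
move=> h0 sx dx; rewrite (deep_nb e' h0 sx dx); apply: nb_in.
have dx' := deepP _ _ dx.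
have sx' : simplex (x + h *: ev e') by rewrite -(deep_nb e' h0 sx dx); exact: nb_simplex.
apply: shift_simplex => //; first exact: tangent_hev.
move=> k; rewrite [X in _ <= X]mxE.
have := hev_coord e k h0; have := hev_coord e' k h0; have := dx' k.
by have := ler_norm (- (h *: ev e') 0 k); rewrite normrN; lra.
Qed.

Lemma deep_nbC h e e' x : 0 < h -> simplex x -> deep h x ->
  nb h e (nb h e' x) = nb h e' (nb h e x).
Proof. by move=> h0 sx dx; rewrite !deep_nb2 // addrAC. Qed.

Lemma deep_nbK h e x : 0 < h -> simplex x -> deep h x ->
  nb h (rev_pair e) (nb h e x) = x.
Proof. by move=> h0 sx dx; rewrite deep_nb2 // ev_rev scalerN addrK. Qed.

(** The two alternatives describe a mesh step and a translation by [dx] with 2 |dx_k| <= x_k. A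
    coordinate below 4 h becomes at most 5 h or 6 h, and 36 = 6^2. *)
Lemma shallow_inv_I2 h x y : 0 < h -> simplex x -> simplex y -> ~~ deep h x ->
  (forall k, y 0 k <= x 0 k + h \/ y 0 k <= 3 / 2 * x 0 k) -> inv_I2 y <= 36 * h ^+ 2.
Proof.
move=> h0 sx sy; rewrite /deep negb_forall => /existsP[k]; rewrite -ltNge => xk H.
have -> : 36 * h ^+ 2 = (6 * h) ^+ 2 by ring.
apply: (@inv_I2_le _ _ _ k) => //.
by case: (H k); lra.
Qed.

(** All points of x0 + h Z^d in the simplex, whether or not mesh steps reach them: this set is
    stable under [nb] and easy to enumerate. *)
Definition in_lattice h (x0 x : 'rV[R]_d) :=
  simplex x /\ exists z : 'I_d -> int, forall k, x 0 k = x0 0 k + h * (z k)%:~R.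

Lemma lattice_base h x0 : simplex x0 -> in_lattice h x0 x0.
Proof. by move=> sx; split => //; exists (fun=> 0) => k; rewrite mulr0 addr0. Qed.

Lemma lattice_nb h x0 e x : in_lattice h x0 x -> in_lattice h x0 (nb h e x).
Proof.
move=> [sx [z hz]]; split; first exact: nb_simplex.
rewrite /nb; case: ifP => _; last by exists z.
exists (fun k => z k + ((k == e.1)%:Z - (k == e.2)%:Z)) => k.
by rewrite !mxE !eqxx /= hz rmorphD rmorphB /= -!pmulrn; ring.
Qed.

Lemma lattice_finite h x0 : 0 < h -> simplex x0 ->
  exists s : seq 'rV[R]_d, forall x, (x \in s) <-> in_lattice h x0 x.
Proof.
move=> h0 sx0.
(* Both points have coordinates in [0, 1], so the integer offsets are at most 1 / h in absolute
   value. *)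
pose n := Num.bound h^-1.
have nh : h^-1 < n%:R by apply: archi_boundP; rewrite invr_ge0 ltW.
pose pt (z : {ffun 'I_d -> 'I_(n + n).+1}) : 'rV[R]_d :=
  \row_k (x0 0 k + h * ((z k : nat)%:Z - n%:Z)%:~R).
exists [seq x <- [seq pt z | z <- enum {: {ffun 'I_d -> 'I_(n + n).+1}}] | x \in @simplex R d].
move=> x; rewrite mem_filter; split.
  move=> /andP[/set_mem sx /mapP[z _ xz]]; split => //.
  by exists (fun k => (z k : nat)%:Z - n%:Z) => k; rewrite xz mxE.
move=> [sx [z hz]]; apply/andP; split; first by rewrite mem_set.
have bz k : `|z k| <= n%:Z.
  have [[h1 _] [h2 _]] := (sx0, sx).
  have zh : `|h * (z k)%:~R : R| <= 1.
    have -> : h * (z k)%:~R = x 0 k - x0 0 k by rewrite hz addrAC subrr add0r.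
    rewrite ler_norml; have /andP[a1 a2] := h1 k; have /andP[b1 b2] := h2 k.
    by apply/andP; split; lra.
  rewrite -(ler_int R) intr_norm; apply: ltW; apply: le_lt_trans nh.
  by move: zh; rewrite normrM (gtr0_norm h0) -ler_pdivlMl // mulr1.
have zk k : exists m : 'I_(n + n).+1, z k = (m : nat)%:Z - n%:Z.
  have h1 : 0 <= z k + n%:Z by have := bz k; rewrite ler_norml => /andP[a _]; rewrite -lerBlDr sub0r.
  have h2 : z k + n%:Z <= (n + n)%N%:Z.
    by have := bz k; rewrite ler_norml => /andP[_ b]; rewrite PoszD lerD2r.
  have hm : (absz (z k + n%:Z)%R < (n + n).+1)%N.
    by rewrite ltnS -lez_nat gez0_abs.
  by exists (Ordinal hm); rewrite /= gez0_abs // addrK.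
have /choice[m hm] := zk.
apply/mapP; exists [ffun k => m k]; first by rewrite mem_enum.
by apply/rowP => k; rewrite mxE ffunE -hm hz.
Qed.

(* [eta] and [eta + dx] lie in the interior of the same mesh cell, and [dx] is
   small enough for the lattices through them to have comparable coordinates. *)
Definition cell h (eta dx : 'rV[R]_d) := tangent dx /\ forall k (m : int),
  (0 <= eta 0 k + h * m%:~R -> 2 * `|dx 0 k| <= eta 0 k + h * m%:~R) /\
  (eta 0 k + h * m%:~R < 0 -> eta 0 k + h * m%:~R + `|dx 0 k| < 0).

Lemma cell0 h eta : cell h eta 0.
Proof.
split; first by rewrite /tangent big1 // => k _; rewrite mxE.
by move=> k m; rewrite mxE normr0 mulr0 addr0.
Qed.

Lemma cellN h eta dx : cell h eta dx -> cell h eta (- dx).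
Proof. by move=> [t H]; split; [exact: tangentN|move=> k m; rewrite mxE normrN]. Qed.

Lemma cell_coord h eta dx x k : cell h eta dx -> in_lattice h eta x ->
  2 * `|dx 0 k| <= x 0 k.
Proof.
move=> [_ H] [sx [z hz]]; rewrite hz; have [h1 _] := H k (z k); apply: h1.
by rewrite -hz; have [] := (simplexP x).1 sx.
Qed.

Lemma cell_simplex h eta dx x : cell h eta dx -> in_lattice h eta x -> simplex (x + dx).
Proof.
move=> c l; apply: (@shift_simplex) => //; [by case: l|by case: c|].
by move=> k; have := cell_coord k c l; have := normr_ge0 (dx 0 k); lra.
Qed.

(** Within a cell, translation by [dx] preserves the sign of every lattice coordinate, also outside
    the simplex; both points therefore extrapolate along the same edges. *)
Lemma cell_nb h eta dx x e : cell h eta dx -> in_lattice h eta x ->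
  nb h e (x + dx) = nb h e x + dx.
Proof.
move=> c l; have [sx [z hz]] := l; have [tdx H] := c.
have E : x + dx + h *: ev e = x + h *: ev e + dx by rewrite addrAC.
rewrite /nb E; case: ifPn => h1; last first.
  case: ifPn => // /set_mem h2; case/negP: h1; apply: mem_set.
  apply: cell_simplex c _; split => //.
  by have := lattice_nb e l; rewrite nb_in // => -[].
case: ifPn => // h2; case/negP: h2; apply: mem_set.
have := set_mem h1 => /simplexP[p0 p1].
apply/simplexP; split; last by move: p1; rewrite sum_addt.
move=> k; rewrite leNgt; apply/negP => neg.
have := p0 k; rewrite mxE.
have zz : (x + h *: ev e) 0 k = eta 0 k + h * (z k + ((k == e.1)%:Z - (k == e.2)%:Z))%:~R.
  by rewrite !mxE !eqxx /= hz rmorphD rmorphB /= -!pmulrn; ring.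
have [_ h3] := H k (z k + ((k == e.1)%:Z - (k == e.2)%:Z)).
rewrite zz in neg *; have := h3 neg; have := ler_norm (dx 0 k); lra.
Qed.

End Lattice.

(** * A common form of the two Hamiltonians *)

Section UnifiedHamiltonian.
Context {R : realType} {d : nat} (G : wgraph R d) (h : R).
Local Notation E := ('I_d * 'I_d)%type.
Implicit Types (e : E) (x : 'rV[R]_d) (v : 'rV[R]_d -> R).

Definition wt e : R := Num.sqrt (weight G e.1 e.2).

Lemma wt_ge0 e : 0 <= wt e. Proof. exact: sqrtr_ge0. Qed.

Lemma wt_rev e : wt (rev_pair e) = wt e.
Proof. by rewrite /wt /= -{1}(weight_sym G) mxE. Qed.

Lemma wt_nonedge i j : ~~ edge G i j -> wt (i, j) = 0.
Proof. by move=> h0; rewrite /wt weight_nonedge // sqrtr0. Qed.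

Lemma sum_pairs (F : E -> R) : (forall i, F (i, i) = 0) ->
  \sum_e F e = \sum_(i : 'I_d) \sum_(j : 'I_d | (i < j)%N) (F (i, j) + F (j, i)).
Proof.
move=> F0; rewrite (eq_bigr (fun p => F (p.1, p.2))) => [|[] //].
rewrite -(pair_bigA _ (fun i j => F (i, j))) /=.
have -> : \sum_i \sum_j F (i, j) =
    \sum_(i : 'I_d) (\sum_(j : 'I_d | (i < j)%N) F (i, j) + \sum_(j : 'I_d | (j < i)%N) F (i, j)).
  apply: eq_bigr => i _; rewrite (bigID (fun j : 'I_d => (i < j)%N)) /=; congr (_ + _).
  rewrite (bigD1 i) /=; last by rewrite ltnn.
  rewrite F0 add0r; apply: eq_bigl => j.
  by rewrite -leqNgt ltn_neqAle andbC.
under [RHS]eq_bigr do rewrite big_split /=.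
rewrite !big_split /=; congr (_ + _).
rewrite (exchange_big_dep xpredT) //=.
Qed.

(** Both Hamiltonians carry 1/2; Lax-Friedrichs has another 1/2 on p^2 + q^2. Then 1/2 gamma (d_e +
    d_rev) is 1/4 times the linear part 2 g d of [theta] with g = gamma. *)
Definition scheme_scale (s : scheme_kind) : R :=
  match s with LaxFriedrichs => 4^-1 | OsherSethian => 2^-1 end.

Definition viscosity (s : scheme_kind) (r : R) : R :=
  match s with LaxFriedrichs => r | OsherSethian => 0 end.

Lemma theta0 (g : R) : 0 <= g -> theta g 0 = 0.
Proof. by move=> g0; rewrite /theta addr0 pos_id // subrr. Qed.

(** For i < j the entries are p = - d_(i, j) and q = d_(j, i), so an undirected edge splits into two
    oriented ones. In the Lax-Friedrichs case |d| <= r keeps g + d nonnegative, where [theta] is the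
    polynomial d^2 + 2 r d. *)
Lemma ham_eq s k r v x : 0 <= r ->
  (s = LaxFriedrichs -> forall e, `|ndiff (nb h) wt h v x e| <= r) ->
  num_hamiltonian G s k (const_mx r) x (skew_diff G h (Dplus h v x))
    (skew_diff G h (Dminus h v x)) =
  ham (nb h) wt h (viscosity s r) (coef (scheme_scale s) k) v x.
Proof.
move=> r0 small; set nd := ndiff (nb h) wt h v x.
have v0 : 0 <= viscosity s r by case: s {small}.
have nd0 i j : ~~ edge G i j -> nd (i, j) = 0.
  by move=> ne; rewrite /nd /ndiff wt_nonedge // mul0r.
have PE (i j : 'I_d) : (i < j)%N -> skew_diff G h (Dplus h v x) i j = - nd (i, j).
  move=> ij; rewrite mxE ij /nd /ndiff /Dplus /extrapolate /nb /ev /wt /=.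
  by case: ifP => _; ring.
have QE (i j : 'I_d) : (i < j)%N -> skew_diff G h (Dminus h v x) i j = nd (j, i).
  move=> ij; rewrite mxE ij /nd /ndiff /Dminus /extrapolate /nb /=.
  rewrite -[wt (j, i)]wt_rev /= /wt /=.
  have -> : x + h *: ev (j, i) = x - h *: evec R i j.
    by rewrite -scalerN; congr (_ + h *: _); rewrite /ev /evec opprB.
  by case: ifP => _; ring.
rewrite /ham sum_pairs => [|i]; last first.
  by rewrite -/nd nd0 ?edge_irr // theta0 // mulr0.
have edgeE (H K : 'I_d -> 'I_d -> R) c :
  (forall i j : 'I_d, (i < j)%N -> edge G i j -> c * H i j = K i j) ->
  (forall i j, ~~ edge G i j -> K i j = 0) ->
  c * (\sum_i \sum_(j | edge G i j && (i < j)%N) H i j) =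
  \sum_(i : 'I_d) \sum_(j : 'I_d | (i < j)%N) K i j.
  move=> h1 h2; rewrite mulr_sumr; apply: eq_bigr => i _.
  rewrite mulr_sumr [RHS](bigID (edge G i)) /= [X in _ = _ + X]big1 ?addr0; last first.
    by move=> j /andP[_]; exact: h2.
  rewrite (eq_bigl (fun j : 'I_d => (i < j)%N && edge G i j)); last by move=> j; rewrite andbC.
  by apply: eq_bigr => j /andP[]; exact: h1.
have cs c i j : coef c k x (j, i) = coef c k x (i, j) by exact: coef_sym (i, j).
have nonedgeK i j : ~~ edge G i j ->
    coef (scheme_scale s) k x (i, j) * theta (viscosity s r) (nd (i, j)) +
    coef (scheme_scale s) k x (j, i) * theta (viscosity s r) (nd (j, i)) = 0.
  move=> ne; have ne' : ~~ edge G j i by rewrite edge_sym.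
  by rewrite !nd0 // theta0 // !mulr0 addr0.
case: s small v0 nonedgeK => small v0 nonedgeK; rewrite /num_hamiltonian; apply: edgeE => //.
  move=> i j ij _; rewrite PE // QE // mxE.
  have th e : theta r (nd e) = 2 * r * nd e + nd e ^+ 2.
    have := small erefl e; rewrite -/nd ler_norml => /andP[h1 h2].
    by rewrite /theta pos_id; [ring|lra].
  rewrite /viscosity (cs _ i j) !th /coef /scheme_scale /=.
  by field.
move=> i j ij _; rewrite PE // QE //.
have -> : Num.min (- nd (i, j)) 0 = - pos (nd (i, j)).
  by rewrite /pos oppr_max oppr0.
rewrite /viscosity (cs _ i j) /coef /scheme_scale /theta /= !add0r.
by rewrite -/(pos (nd (j, i))); ring.
Qed.

End UnifiedHamiltonian.

(** * Estimates for the solution *)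

Section Estimates.
Context {R : realType} {d : nat} (G : wgraph R d) (T L MU MF : R).
Local Notation E := ('I_d * 'I_d)%type.
Local Notation V := 'rV[R]_d.
Let N : R := #|{: E}|%:R.

(** A bound for [wt], the square roots of the weights; the summand 1 yields
    [slope_bound <= grad_bound]. *)
Definition max_weight : R := 1 + \sum_e wt G e.
Let Om := max_weight.

(** Initially |d| <= 2 Om MU: its square bounds the excess of [theta]. The middle term bounds the
    viscous part, with 144 = 36 * 4 coming from the boundary layer. *)
Definition rate_bound : R := 4 * N * Om ^+ 2 * MU ^+ 2 + 144 * N * Om * MU + MF.
(** Bounds for H + F, for F and for minus the viscous part of H; the last is N Om because g K h <=
    1. *)
Definition energy_bound : R := rate_bound + MF + N * Om.
Definition gradsq_bound : R :=
  ((N + 1) * (2 * d%:R * MU) ^+ 2 + @bern_source R E L (2 * d%:R * MF) 36 * T)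
  * expR (@bern_rate R E L energy_bound Om 36 * T).
(** A number B >= 2 satisfies B^2 >= B, so B^2 exceeds gradsq_bound + 1 and no square root
    occurs. *)
Definition slope_bound : R := gradsq_bound + 2.
Definition grad_bound : R := Om * slope_bound.
Let R0 := grad_bound.
Let B := slope_bound.
(** In a second difference with step h, [l1] is at most 2 h, whence 8 = 2 * 2^2; 720 = 4 * 180
    collects three Hamiltonians in the layer with weights 1, 1, 2; and 18 rounds up the 13 of
    [slope_flux_le]. *)
Definition semiconc_bound : R :=
  8 * MU + T * (18 * N * L * R0 ^+ 2 + 720 * N * R0 ^+ 2 + 8 * MF).
Let K := semiconc_bound.
(** Its terms are the smallness conditions on h: h below 1 / d, g + |d| <= 3 R0 against 1 / h,
    |theta| <= 5 R0^2 against 1 / h, and g K h <= 1. *)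
Definition mesh_scale : R := 2 * d%:R + 3 * R0 + 5 * R0 ^+ 2 + 2 * R0 * K + 1.
Definition hess_bound : R :=
  2 * MU * d%:R ^+ 2 + T * (18 * N * L * R0 ^+ 2 + 2 * MF * d%:R ^+ 2) + 1.

Hypothesis d1 : (1 <= d)%N.
Hypothesis T0 : 0 < T.
Hypothesis L0 : 0 <= L.
Hypothesis MU0 : 0 <= MU.
Hypothesis MF0 : 0 <= MF.

Let N0 : 0 <= N. Proof. exact: ler0n. Qed.

Lemma max_weight_ge1 : 1 <= Om.
Proof. by rewrite lerDl sumr_ge0 // => e _; exact: wt_ge0. Qed.

Let Om0 : 0 <= Om. Proof. by have := max_weight_ge1; lra. Qed.

Lemma wt_le e : wt G e <= Om.
Proof.
rewrite /Om /max_weight (bigD1 e) //=.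
have : 0 <= \sum_(i | i != e) wt G i by apply: sumr_ge0 => i _; exact: wt_ge0.
by lra.
Qed.

Let rate0 : 0 <= rate_bound. Proof. by rewrite /rate_bound; ge0. Qed.
Let E20 : 0 <= energy_bound. Proof. by rewrite /energy_bound; ge0. Qed.

Lemma gradsq_bound_ge0 : 0 <= gradsq_bound.
Proof.
rewrite /gradsq_bound; apply: mulr_ge0; last exact: expR_ge0.
have := @bern_source_ge0 R E L (2 * d%:R * MF) 36 L0 (ler0n _ _).
by move=> h; ge0.
Qed.

Let B2 : 2 <= B. Proof. by rewrite /B /slope_bound; have := gradsq_bound_ge0; lra. Qed.

Lemma slope_le_grad : B <= R0.
Proof.
rewrite /R0 /grad_bound -/B ler_peMl ?max_weight_ge1 //; have := B2; lra.
Qed.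

Let R00 : 0 <= R0. Proof. have := slope_le_grad; have := B2; lra. Qed.

Lemma semiconc_bound_ge0 : 0 <= K.
Proof. rewrite /K /semiconc_bound; ge0. Qed.

Lemma mesh_scale_ge1 : 1 <= mesh_scale.
Proof.
rewrite /mesh_scale lerDr; have := semiconc_bound_ge0 => k0; ge0.
Qed.

Lemma mesh_scale_gt : d%:R < mesh_scale.
Proof.
have k0 := semiconc_bound_ge0; have r0 := R00.
have dp := ler0n R d.
have q : 0 <= 3 * R0 + 5 * R0 ^+ 2 + 2 * R0 * K by ge0.
rewrite /mesh_scale; move: q; move: (3 * R0) (5 * R0 ^+ 2) (2 * R0 * K) => *; lra.
Qed.

Lemma hess_bound_gt0 : 0 < hess_bound.
Proof. by rewrite /hess_bound ltr_wpDl //; have r0 := R00; ge0. Qed.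

Section Solution.
Context (s : scheme_kind) (k : mean_kind) (U0 F : V -> R) (h : R) (u : R -> V -> R).
Hypothesis hU1 : forall x y, simplex x -> simplex y -> `|U0 y - U0 x| <= MU * l1 (y - x).
Hypothesis hU2 : forall x a, simplex x -> simplex (x + a) -> simplex (x - a) ->
  `|U0 (x + a) + U0 (x - a) - 2 * U0 x| <= 2 * MU * l1 a ^+ 2.
Hypothesis hF0 : forall x, simplex x -> `|F x| <= MF.
Hypothesis hF1 : forall x y, simplex x -> simplex y -> `|F y - F x| <= MF * l1 (y - x).
Hypothesis hF2 : forall x a, simplex x -> simplex (x + a) -> simplex (x - a) ->
  `|F (x + a) + F (x - a) - 2 * F x| <= 2 * MF * l1 a ^+ 2.
Hypothesis hL : @coef_regular R d L.
Hypothesis h0 : 0 < h.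
Hypothesis hsmall : h * mesh_scale <= 1.
Hypothesis su : semidiscrete_solution G s k (const_mx (2 * R0)) T h U0 F u.

Let g := viscosity s (2 * R0).
Let c := scheme_scale s : R.
Let a := fun x : V => coef c k x.
Let nbh := nb (d := d) h.
Let H := ham nbh (wt G) h g.
Let nd := ndiff nbh (wt G) h.

Let c01 : 0 < c <= 1. Proof. by rewrite /c; case: (s) => /=; lra. Qed.
Let c01' : 0 <= c <= 1. Proof. by have /andP[] := c01; lra. Qed.
Let g0 : 0 <= g. Proof. by rewrite /g; case: (s) => //=; rewrite mulr_ge0. Qed.
Let g2 : g <= 2 * R0. Proof. by rewrite /g; case: (s) => //=; rewrite mulr_ge0. Qed.
Let R0p := R00.
Let hp := h0.

Ltac slra := move: hp R0p g0 g2 => ? ? ? ?; lra.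

Let parts : [/\ h <= 1, h * (3 * R0) <= 1, h * (5 * R0 ^+ 2) <= 1 & h * (2 * R0 * K) <= 1].
Proof.
have k0 := semiconc_bound_ge0.
have q1 : 0 <= h * (2 * d%:R) by ge0.
have q2 : 0 <= h * (3 * R0) by ge0.
have q3 : 0 <= h * (5 * R0 ^+ 2) by ge0.
have q4 : 0 <= h * (2 * R0 * K) by ge0.
have E : h * mesh_scale = h * (2 * d%:R) + h * (3 * R0) + h * (5 * R0 ^+ 2) + h * (2 * R0 * K) + h.
  by rewrite /mesh_scale; ring.
have := hsmall; rewrite E => hs.
by split; slra.
Qed.

Lemma coef_ge0 x e : simplex x -> 0 <= a x e.
Proof. by move=> sx; have /andP[] := coef_bounds k e c01' sx (inv_I2_le1 sx). Qed.

Lemma coef_le1 x e : simplex x -> a x e <= 1.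
Proof. by move=> sx; have /andP[] := coef_bounds k e c01' sx (inv_I2_le1 sx). Qed.

Lemma coef_shallow x y e : simplex x -> simplex y -> ~~ deep h x ->
  (forall k, y 0 k <= x 0 k + h \/ y 0 k <= 3 / 2 * x 0 k) -> a y e <= 36 * h ^+ 2.
Proof.
move=> sx sy nx hy.
by have /andP[] := coef_bounds k e c01' sy (shallow_inv_I2 h0 sx sy nx hy).
Qed.

Lemma near_nb x e : simplex x -> forall k, nbh e x 0 k <= x 0 k + h \/ nbh e x 0 k <= 3 / 2 * x 0 k.
Proof.
move=> sx j; left; rewrite /nbh /nb; case: ifP => _; last by slra.
rewrite mxE; have := hev_coord e j h0; have := ler_norm ((h *: ev e : V) 0 j); slra.
Qed.

Lemma near_refl (x : V) : forall k, x 0 k <= x 0 k + h \/ x 0 k <= 3 / 2 * x 0 k.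
Proof. by move=> j; left; slra. Qed.

Definition slopes_bounded (T' : R) x0 := forall t x e, 0 <= t <= T' -> in_lattice h x0 x ->
  `|u t (nbh e x) - u t x| <= B * h.

Lemma nb_dist x e : simplex x -> l1 (nbh e x - x) <= 2 * h.
Proof.
move=> sx; rewrite /nbh /nb; case: ifP => _; last first.
  by rewrite subrr /l1 big1 => [|i _]; [slra|rewrite mxE normr0].
by rewrite addrAC subrr add0r; exact: l1_hev.
Qed.

Lemma initial_gradsq (dx : V) (sg : R) y : 0 < sg -> l1 dx <= d%:R * sg ->
  simplex y -> simplex (y + dx) ->
  gradsq nbh h sg (u 0) (fun y => u 0 (y + dx)) y <= (N + 1) * (2 * d%:R * MU) ^+ 2.
Proof.
move=> sg0 l1dx sy sydx; have [u0 _ _] := su.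
have dR : 1 <= d%:R :> R by rewrite ler1n.
rewrite /gradsq; apply: le_trans (_ : \sum_(i : option E) (2 * d%:R * MU) ^+ 2 <= _); last first.
  by rewrite sumr_const card_option -[leLHS]mulr_natl -natr1.
have C0 : 0 <= 2 * d%:R * MU by ge0.
apply: ler_sum => i _; rewrite ler_sqr ?nnegrE ?pos_ge0 //; apply: pos_le => //.
case: i => [e|]; rewrite /slope /= ler_pdivrMr //; apply: le_trans (ler_norm _) _; rewrite !u0 //.
+ apply: le_trans (hU1 sy (nb_simplex h e sy)) _.
  have := ler_wpM2l MU0 (nb_dist e sy).
  have : MU * (2 * h) <= 2 * d%:R * MU * h.
    have -> : 2 * d%:R * MU * h = d%:R * (MU * (2 * h)) by ring.
    by rewrite ler_peMl // !mulr_ge0 // ltW.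
  by rewrite /nbh; slra.
+ exact: nb_simplex.
+ apply: le_trans (hU1 sy sydx) _; rewrite addrAC subrr add0r.
  have := ler_wpM2l MU0 l1dx.
  have : 0 <= d%:R * MU * sg by rewrite !mulr_ge0 // ltW.
  slra.
Qed.

Section Horizon.
Context (T' : R).
Hypothesis T'0 : 0 < T'.
Hypothesis T'T : T' <= T.

Lemma slope_ndiff_le x0 t x e : slopes_bounded T' x0 -> 0 <= t <= T' -> in_lattice h x0 x -> `|nd (u t) x e| <= R0.
Proof.
move=> hB ht lx; rewrite /nd /ndiff normrM (ger0_norm (wt_ge0 _ _)).
rewrite normrM normfV (gtr0_norm h0); apply: ler_pM => //.
- exact: wt_ge0.
- by rewrite mulr_ge0 // invr_ge0 ltW.
- exact: wt_le.
by rewrite ler_pdivrMr // distrC; exact: hB.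
Qed.

Lemma slope_flux_le x0 t x e : slopes_bounded T' x0 -> 0 <= t <= T' -> in_lattice h x0 x ->
  pos (g + nd (u t) x e) ^+ 2 + g ^+ 2 <= 13 * R0 ^+ 2.
Proof.
move=> hB ht lx; have n1 := slope_ndiff_le e hB ht lx.
have p1 : pos (g + nd (u t) x e) <= 3 * R0.
  by apply: pos_le; last slra; have := ler_norm (nd (u t) x e); slra.
have P2 : pos (g + nd (u t) x e) ^+ 2 <= (3 * R0) ^+ 2.
  by rewrite ler_sqr ?nnegrE ?pos_ge0 //; slra.
have G2 : g ^+ 2 <= (2 * R0) ^+ 2 by rewrite ler_sqr ?nnegrE //; slra.
slra.
Qed.

(** The slope bound is what makes Lax-Friedrichs coincide with the monotone form [ham]. *)
Lemma slope_scheme_derive x0 t x : slopes_bounded T' x0 -> 0 < t < T' -> in_lattice h x0 x ->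
  is_derive t 1 (u^~ x) (- (H a (u t) x + F x)).
Proof.
move=> hB /andP[t0 tT] lx; have [sx _] := lx.
have tT' : 0 < t < T by rewrite t0 (lt_le_trans tT).
have [_ _ /(_ t x tT' sx)[dv eq]] := su.
split; first exact: dv.
have r2 : 0 <= 2 * R0 by slra.
move: eq; rewrite derive1E (ham_eq _ r2).
  by rewrite -/g -/c => /eqP; rewrite -addrA addr_eq0 => /eqP ->.
move=> _ e; apply: le_trans (slope_ndiff_le e hB _ lx) _; [by rewrite !ltW|slra].
Qed.

Context (x0 : V).
Hypothesis hB : slopes_bounded T' x0.

Let ndiff_le t x e : 0 <= t <= T' -> in_lattice h x0 x -> `|nd (u t) x e| <= R0.
Proof. exact: slope_ndiff_le. Qed.

Let scheme_derive t x : 0 < t < T' -> in_lattice h x0 x ->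
  is_derive t 1 (u^~ x) (- (H a (u t) x + F x)).
Proof. exact: slope_scheme_derive. Qed.

Lemma solution_cont x : simplex x -> {within `[0, T'], continuous (u^~ x)}.
Proof.
move=> sx; have [_ /(_ x sx) cu _] := su.
exact: within_itv_sub cu.
Qed.

Lemma theta_small t x e : 0 <= t <= T' -> in_lattice h x0 x ->
  `|theta g (nd (u t) x e)| <= 5 * R0 ^+ 2.
Proof.
move=> ht lx; have hn := ndiff_le e ht lx.
apply: le_trans (theta_abs_le _ g0) _.
rewrite -[nd _ _ _ ^+ 2]real_normK ?num_real //.
have h1 : `|nd (u t) x e| ^+ 2 <= R0 ^+ 2 by rewrite ler_sqr ?nnegrE.
have h2 : 2 * g * `|nd (u t) x e| <= 4 * R0 * R0.
  by apply: ler_pM => //; [rewrite mulr_ge0|have := g2; slra].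
slra.
Qed.

Lemma ham_shallow t x y : 0 <= t <= T' -> in_lattice h x0 x -> in_lattice h x0 y ->
  ~~ deep h x -> (forall k, y 0 k <= x 0 k + h \/ y 0 k <= 3 / 2 * x 0 k) ->
  `|H a (u t) y| <= 180 * N * R0 ^+ 2 * h ^+ 2.
Proof.
move=> ht [sx _] ly nx hy; have [sy _] := ly.
apply: le_trans (ler_norm_sum _ _ _) _.
apply: le_trans (_ : \sum_(e : E) 36 * h ^+ 2 * (5 * R0 ^+ 2) <= _).
  apply: ler_sum => e _; rewrite normrM (ger0_norm (coef_ge0 e sy)).
  exact: (ler_pM (coef_ge0 e sy) (normr_ge0 _) (coef_shallow e sx sy nx hy) (theta_small e ht ly)).
rewrite sumr_const -[leLHS]mulr_natr -/N; le_ring.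
Qed.

Context (sl : seq V).
Hypothesis hsl : forall x, (x \in sl) <-> in_lattice h x0 x.

Let sl_s x : x \in sl -> simplex x. Proof. by move=> /hsl[]. Qed.
Let nb_sl e x : x \in sl -> nbh e x \in sl.
Proof. by move=> /hsl l; apply/hsl; exact: lattice_nb. Qed.

Lemma solves_lattice : solves nbh (wt G) h g sl T' a F u.
Proof.
split; first by move=> x /sl_s; exact: solution_cont.
by move=> t x ht /hsl; exact: scheme_derive.
Qed.

(** The bound must not involve [g]. Pairing edges turns the viscous part into second differences: at
    deep points they are O(h) because U0 is C^2, in the layer the coefficient is O(h^2), and g h <=
    1 absorbs [g]. *)
Lemma initial_rate x : x \in sl -> `|H a (u 0) x + F x| <= rate_bound.
Proof.
move=> xs; have lx := (hsl x).1 xs; have [sx _] := lx.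
have [u0 _ _] := su.
have [q1 q2 q3 q4] := parts.
have slope e : `|u 0 (nbh e x) - u 0 x| <= 2 * MU * h.
  rewrite !u0 //; last exact: nb_simplex.
  apply: le_trans (hU1 _ _) _ => //; first exact: nb_simplex.
  have := ler_wpM2l MU0 (nb_dist e sx); slra.
have ndU e : `|nd (u 0) x e| <= 2 * Om * MU.
  rewrite /nd /ndiff normrM (ger0_norm (wt_ge0 _ _)) normrM normfV (gtr0_norm h0).
  have -> : 2 * Om * MU = Om * (2 * MU) by ring.
  apply: ler_pM; [exact: wt_ge0|by rewrite mulr_ge0 // invr_ge0 ltW|exact: wt_le|].
  by rewrite ler_pdivrMr // distrC; exact: slope.
have gh : g * h <= 1 by have := ler_wpM2r (ltW h0) g2; slra.
have exc : `|\sum_e a x e * (theta g (nd (u 0) x e) - 2 * g * nd (u 0) x e)| <= 4 * N * Om ^+ 2 * MU ^+ 2.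
  apply: le_trans (ler_norm_sum _ _ _) _.
  apply: le_trans (_ : \sum_(e : E) (2 * Om * MU) ^+ 2 <= _); last first.
    by rewrite sumr_const -[leLHS]mulr_natr -/N; le_ring.
  apply: ler_sum => e _; rewrite normrM (ger0_norm (coef_ge0 e sx)).
  have p0 := theta_excess_ge0 (nd (u 0) x e) g0.
  rewrite (ger0_norm p0); apply: le_trans (_ : 1 * (theta g (nd (u 0) x e) - 2 * g * nd (u 0) x e) <= _).
    by rewrite ler_wpM2r // coef_le1.
  rewrite mul1r; apply: le_trans (theta_excess_le _ _) _.
  by rewrite -real_normK ?num_real // ler_sqr ?nnegrE // !mulr_ge0.
have lin : `|2 * g * \sum_e a x e * nd (u 0) x e| <= 144 * N * Om * MU.
  rewrite (sum_sym _ rev_pairK) => [|e]; last by rewrite /a coef_sym.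
  rewrite mulrA normrM.
  have -> : `|2 * g * 2^-1| = g by rewrite mulrAC divff ?mul1r ?ger0_norm.
  apply: le_trans (ler_wpM2l g0 (ler_norm_sum _ _ _)) _.
  rewrite mulr_sumr; apply: le_trans (_ : \sum_(e : E) 144 * Om * MU <= _); last first.
    by rewrite sumr_const -[leLHS]mulr_natr -/N; le_ring.
  apply: ler_sum => e _; rewrite normrM (ger0_norm (coef_ge0 e sx)).
  have OM : 0 <= Om * MU by rewrite mulr_ge0.
  have a0 := coef_ge0 e sx.
  have [dx|nx] := boolP (deep h x).
    have sm : `|nd (u 0) x e + nd (u 0) x (rev_pair e)| <= 8 * Om * MU * h.
      have -> : nd (u 0) x e + nd (u 0) x (rev_pair e) =
        - (wt G e * ((u 0 (nbh e x) + u 0 (nbh (rev_pair e) x) - 2 * u 0 x) / h)).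
        by rewrite /nd /ndiff wt_rev; ring.
      rewrite normrN normrM (ger0_norm (wt_ge0 _ _)) normrM normfV (gtr0_norm h0).
      have -> : 8 * Om * MU * h = Om * (8 * MU * h) by ring.
      apply: ler_pM; [exact: wt_ge0|by rewrite mulr_ge0 // invr_ge0 ltW|exact: wt_le|].
      have sn e' : simplex (nbh e' x) by exact: nb_simplex.
      rewrite ler_pdivrMr // !u0 //.
      have := sn e; have := sn (rev_pair e); rewrite /nbh !deep_nb // ev_rev scalerN => s1 s2.
      apply: le_trans (hU2 sx s2 s1) _.
      have l := l1_hev e h0.
      have : l1 (h *: ev e : V) ^+ 2 <= (2 * h) ^+ 2.
        by rewrite ler_sqr ?nnegrE ?l1_ge0 // mulr_ge0 // ltW.
      move=> /(ler_wpM2l (mulr_ge0 (ler0n _ 2) MU0)); slra.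
    have s1 : a x e * `|nd (u 0) x e + nd (u 0) x (rev_pair e)| <= 8 * Om * MU * h.
      apply: le_trans sm; rewrite ler_piMl // coef_le1 //.
    have := ler_wpM2l g0 s1; have := ler_wpM2r OM gh; slra.
  have sm : `|nd (u 0) x e + nd (u 0) x (rev_pair e)| <= 4 * Om * MU.
    by apply: le_trans (ler_normD _ _) _; have := ndU e; have := ndU (rev_pair e); slra.
  have ah : a x e <= 36 * h ^+ 2 := coef_shallow e sx sx nx (near_refl x).
  have s1 := ler_pM a0 (normr_ge0 _) ah sm.
  have s2 := ler_wpM2l g0 s1.
  have gh1 : 0 <= g * h by rewrite mulr_ge0 // ltW.
  have gh2 : g * h * h <= 1 by rewrite -[1]mulr1 ler_pM // ltW.
  have := ler_wpM2r OM gh2; slra.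
have -> : H a (u 0) x + F x =
   \sum_e a x e * (theta g (nd (u 0) x e) - 2 * g * nd (u 0) x e)
   + 2 * g * (\sum_e a x e * nd (u 0) x e) + F x.
  congr (_ + _); rewrite mulr_sumr -big_split /=; apply: eq_bigr => e _.
  by rewrite -/nd; ring.
apply: le_trans (ler_normD _ _) _; rewrite /rate_bound lerD ?hF0 //.
by apply: le_trans (ler_normD _ _) _; rewrite lerD.
Qed.

Lemma rate_le t x : 0 < t < T' -> x \in sl -> `|H a (u t) x + F x| <= rate_bound.
Proof.
move=> ht xs.
apply: (@time_derivative_bound R V E nbh (wt G) h g h0 (wt_ge0 G) sl nb_sl T' a F u) => //.
- by move=> y e /sl_s; exact: coef_ge0.
- exact: solves_lattice.
- exact: initial_rate.
Qed.

Let itvW t : 0 < t < T' -> 0 <= t <= T'. Proof. by move=> /andP[? ?]; rewrite !ltW. Qed.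

Lemma lattice_semiconcave t x e : 0 <= t <= T' -> x \in sl -> deep h x ->
  u t (nbh e x) + u t (nbh (rev_pair e) x) - 2 * u t x <= K * h ^+ 2.
Proof.
move=> ht xs dx.
have [u0 _ _] := su.
have [q1 q2 q3 q4] := parts.
(* Where a step is extrapolated, [f] reduces to a first difference, of order h only. Such points are
   left out; the neighbours of deep points remain. *)
pose ok : pred V := fun y => (y + h *: ev e \in @simplex R d) && (y - h *: ev e \in @simplex R d).
pose s' := [seq y <- sl | ok y].
have okE y : y \in s' -> [/\ y \in sl, simplex (y + h *: ev e), simplex (y - h *: ev e),
    nbh e y = y + h *: ev e & nbh (rev_pair e) y = y - h *: ev e].
  rewrite mem_filter => /andP[/andP[/set_mem a1 /set_mem a2] ys]; split => //.
    by rewrite /nbh nb_in.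
  by rewrite /nbh nb_in ev_rev scalerN.
have okd y : y \in sl -> (forall k, 2 * h <= y 0 k) -> y \in s'.
  move=> ys hy; rewrite mem_filter ys andbT; have sy := sl_s ys.
  apply/andP; split; apply: mem_set; apply: shift_simplex => //.
  - exact: tangent_hev.
  - by move=> j; have := hev_coord e j h0; have := hy j; slra.
  - by apply: tangentN; exact: tangent_hev.
  - by move=> j; rewrite mxE normrN; have := hev_coord e j h0; have := hy j; slra.
pose D := (18 * N * L * R0 ^+ 2 + 720 * N * R0 ^+ 2 + 8 * MF) * h ^+ 2.
have D0 : 0 <= D by rewrite /D; ge0.
have M0 : 0 <= 8 * MU * h ^+ 2 by ge0.
have hev2 : l1 (h *: ev e : V) ^+ 2 <= 4 * h ^+ 2.
  have -> : 4 * h ^+ 2 = (2 * h) ^+ 2 by ring.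
  by rewrite ler_sqr ?nnegrE ?l1_ge0 ?l1_hev // mulr_ge0 // ltW.
pose f t y := u t (nbh e y) + u t (nbh (rev_pair e) y) - 2 * u t y.
pose f' t y := - (H a (u t) (nbh e y) + F (nbh e y)) - (H a (u t) (nbh (rev_pair e) y) + F (nbh (rev_pair e) y))
   + 2 * (H a (u t) y + F y).
have mp : f t x <= (8 * MU * h ^+ 2 + D * t) * expR (0 * t).
  apply: (@max_principle R V s' T' 0 D (8 * MU * h ^+ 2) f f') => //.
  - move=> y /okE[ys _ _ _ _]; have sy := sl_s ys.
    rewrite /f; apply: within_contB.
      by apply: within_contD; apply: solution_cont; exact: nb_simplex.
    by apply: within_contM; [exact: within_cont_cst|exact: solution_cont].
  - move=> t' y ht' /okE[ys _ _ _ _]; have ly := (hsl y).1 ys.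
    have d1' := scheme_derive ht' (lattice_nb e ly).
    have d2' := scheme_derive ht' (lattice_nb (rev_pair e) ly).
    have d3' := is_deriveZ 2 (scheme_derive ht' ly).
    have := is_deriveB (is_deriveD d1' d2') d3'.
    by move=> Hd; apply: is_derive_eq Hd _; rewrite /f' /GRing.scale /=; ring.
  - move=> y /okE[ys sp sm ep em]; have sy := sl_s ys.
    rewrite /f ep em !u0 //; apply: le_trans (ler_norm _) _; apply: le_trans (hU2 sy sp sm) _.
    by have := ler_wpM2l (mulr_ge0 (ler0n _ 2) MU0) hev2; slra.
  - move=> t' y ht' /okE[ys sp sm ep em] ymax _; rewrite mul0r add0r.
    have sy := sl_s ys; have ly := (hsl y).1 ys.
    have Fd : - (F (nbh e y) + F (nbh (rev_pair e) y) - 2 * F y) <= 8 * MF * h ^+ 2.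
      rewrite ep em; apply: le_trans (ler_norm _) _; rewrite normrN.
      apply: le_trans (hF2 sy sp sm) _.
      by have := ler_wpM2l (mulr_ge0 (ler0n _ 2) MF0) hev2; slra.
    have NR : 0 <= N * R0 ^+ 2 * h ^+ 2 by ge0.
    have NLR : 0 <= N * L * R0 ^+ 2 * h ^+ 2 by ge0.
    (* In the layer each Hamiltonian is O(h^2) by itself; at deep points the shifted Hamiltonians
       can be read at [y]. *)
    have [dy|ny] := boolP (deep h y); last first.
      have b0 := ham_shallow (itvW ht') ly ly ny (near_refl y).
      have b1 := ham_shallow (itvW ht') ly (lattice_nb e ly) ny (near_nb e sy).
      have b2 := ham_shallow (itvW ht') ly (lattice_nb (rev_pair e) ly) ny (near_nb (rev_pair e) sy).
      move: b0 b1 b2; rewrite !ler_norml -/nbh /f' /D => /andP[? ?] /andP[? ?] /andP[? ?]; slra.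
    have hE e' z : deep h z -> simplex z ->
       H a (u t') (nbh e' z) = H (fun y => a (nbh e' y)) (fun y => u t' (nbh e' y)) z.
      move=> dz sz; apply: eq_bigr => e1 _; congr (_ * theta g _).
      by rewrite /ndiff /nbh (deep_nbC e1 e').
    have := @ham_second_diff R V E nbh (wt G) h g h0 (wt_ge0 G) a (fun y => a (nbh e y))
      (fun y => a (nbh (rev_pair e) y)) (u t') (fun y => u t' (nbh e y))
      (fun y => u t' (nbh (rev_pair e) y)) y (L * h ^+ 2) (13 * R0 ^+ 2).
    rewrite -/N => hs.
    have hs' : - (N * (L * h ^+ 2) * (13 * R0 ^+ 2)) <=
       H a (u t') (nbh e y) + H a (u t') (nbh (rev_pair e) y) - 2 * H a (u t') y.
      rewrite !hE //; apply: hs.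
      - ge0.
      - move=> e1; rewrite ep em /a.
        have w1 j : 2 * `|(h *: ev e : V) 0 j| <= y 0 j.
          by have := hev_coord e j h0; have := deepP _ _ dy j; slra.
        have w2 j : `|(h *: ev e : V) 0 j| <= h by exact: hev_coord.
        by have [_] := @hL c k y (h *: ev e) e1 h c01 sy (tangent_hev h e) w1 w2.
      - move=> e1; apply: ymax; apply: okd; first exact: nb_sl.
        move=> j; rewrite /nbh deep_nb // mxE.
        have := hev_coord e1 j h0; have := deepP _ _ dy j.
        by have := ler_norm (- (h *: ev e1 : V) 0 j); rewrite normrN; slra.
      - by move=> e1; exact: slope_flux_le hB (itvW ht') ly.
    rewrite /f' /D; slra.
  - apply: okd => // j; have := deepP _ _ dx j; slra.
move: mp; rewrite mul0r expR0 mulr1 => /le_trans; apply.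
have /andP[t0 tT'] := ht.
have : D * t <= D * T by rewrite ler_wpM2l // (le_trans tT').
rewrite /K /semiconc_bound /D; slra.
Qed.

(** All excess terms are nonnegative, so each is at most their sum, which is (H + F) - F minus the
    viscous part. The last needs a lower bound only, so one-sided semiconcavity suffices. *)
Lemma lattice_energy t x e : 0 < t < T' -> x \in sl -> deep h x ->
  a x e * (theta g (nd (u t) x e) - 2 * g * nd (u t) x e) <= energy_bound.
Proof.
move=> ht xs dx; have sx := sl_s xs.
have [q1 q2 q3 q4] := parts.
have Hb := rate_le ht xs.
have gK : g * (K * h) <= 1.
  by have := ler_wpM2r (mulr_ge0 semiconc_bound_ge0 (ltW h0)) g2; rewrite -/K; slra.
have lin : - (2 * g * \sum_e a x e * nd (u t) x e) <= N * Om.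
  rewrite (sum_sym _ rev_pairK) => [|e']; last by rewrite /a coef_sym.
  have -> : - (2 * g * (2^-1 * \sum_e a x e * (nd (u t) x e + nd (u t) x (rev_pair e)))) =
    \sum_e a x e * (g * - (nd (u t) x e + nd (u t) x (rev_pair e))).
    have half (z : R) : - (2 * g * (2^-1 * z)) = - (g * z) by field.
    rewrite half mulr_sumr -sumrN.
    by apply: eq_bigr => e' _; ring.
  apply: le_trans (_ : \sum_(e : E) Om <= _); last first.
    by rewrite sumr_const -[leLHS]mulr_natr -/N mulrC.
  apply: ler_sum => e' _; have a0 := coef_ge0 e' sx; have a1 := coef_le1 e' sx.
  have sc := lattice_semiconcave e' (itvW ht) xs dx.
  have z : - (nd (u t) x e' + nd (u t) x (rev_pair e')) <= Om * (K * h).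
    have -> : - (nd (u t) x e' + nd (u t) x (rev_pair e')) =
      wt G e' * ((u t (nbh e' x) + u t (nbh (rev_pair e') x) - 2 * u t x) / h).
      by rewrite /nd /ndiff wt_rev; ring.
    apply: le_trans (_ : wt G e' * (K * h) <= _).
      by rewrite ler_wpM2l ?wt_ge0 // ler_pdivrMr // -mulrA -expr2.
    by rewrite ler_wpM2r ?wt_le // mulr_ge0 ?semiconc_bound_ge0 // ltW.
  have z1 := ler_wpM2l g0 z.
  have z2 : g * (Om * (K * h)) <= Om by rewrite mulrCA ler_piMr.
  apply: le_trans (ler_wpM2l a0 (le_trans z1 z2)) _.
  by rewrite ler_piMl.
have tot : \sum_e a x e * (theta g (nd (u t) x e) - 2 * g * nd (u t) x e) <= energy_bound.
  have -> : \sum_e a x e * (theta g (nd (u t) x e) - 2 * g * nd (u t) x e) =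
     (H a (u t) x + F x) - F x + - (2 * g * \sum_e a x e * nd (u t) x e).
    rewrite addrK mulr_sumr -sumrB; apply: eq_bigr => e' _; rewrite -/nd; ring.
  rewrite /energy_bound lerD //.
  move: Hb (hF0 sx); rewrite !ler_norml => /andP[_ b1] /andP[b2 _]; slra.
apply: le_trans tot; rewrite (bigD1 e) //= lerDl sumr_ge0 // => e' _.
by rewrite mulr_ge0 ?coef_ge0 // theta_excess_ge0.
Qed.

(** The slope bounds up to T' are hypotheses: the lemma is the improvement step of the continuity
    argument, and is used again on [0, T] for the translates. *)
Lemma gradsq_le (dx : V) (sg : R) : cell h x0 dx -> slopes_bounded T' (x0 + dx) ->
  0 < sg <= h -> (forall i, `|dx 0 i| <= sg) ->
  forall t x, 0 <= t <= T' -> x \in sl ->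
  gradsq nbh h sg (u t) (fun y => u t (y + dx)) x <= gradsq_bound.
Proof.
move=> cdx hB' /andP[sg0 sgh] hdx t x ht xs.
have [u0 _ _] := su.
have [q1 q2 q3 q4] := parts.
have sdx y : y \in sl -> simplex (y + dx) by move=> /hsl; exact: cell_simplex.
have ldx y : y \in sl -> in_lattice h (x0 + dx) (y + dx).
  move=> ys; split; first exact: sdx.
  have [_ [z hz]] := (hsl y).1 ys; exists z => j.
  by rewrite !mxE hz; ring.
have cnb e y : y \in sl -> nbh e (y + dx) = nbh e y + dx.
  by move=> /hsl; exact: cell_nb.
have l1dx : l1 dx <= d%:R * sg by exact: l1_le.
have dR : 1 <= d%:R :> R by rewrite ler1n.
(* By [cell_nb] the lattice through x0 + dx is the translated lattice, so the translate solves a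
   scheme on [sl]. *)
have sv : solves nbh (wt G) h g sl T' (fun y => a (y + dx)) (fun y => F (y + dx))
    (fun t y => u t (y + dx)).
  split; first by move=> y /sdx; exact: solution_cont.
  move=> t' y ht' ys.
  have := slope_scheme_derive hB' ht' (ldx y ys).
  congr (is_derive _ _ _ (- (_ + _))).
  by apply: eq_bigr => e _; rewrite /ndiff cnb.
have Fl y1 y2 (r : R) : simplex y1 -> simplex y2 -> l1 (y2 - y1) <= 2 * d%:R * r ->
    `|F y2 - F y1| <= 2 * d%:R * MF * r.
  move=> s1 s2 hr; apply: le_trans (hF1 s1 s2) _.
  by have := ler_wpM2l MF0 hr; slra.
have coefv y e : y \in sl -> (a (y + dx) e - a y e) ^+ 2 <= L * a y e * sg ^+ 2.
  move=> ys; have [] // := @hL c k y dx e sg c01 (sl_s ys) (proj1 cdx) _ hdx.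
  by move=> i; apply: cell_coord cdx _; exact/hsl.
pose M := (N + 1) * (2 * d%:R * MU) ^+ 2.
have M0 : 0 <= M by rewrite /M; ge0.
have small1 t' y e : 0 < t' < T' -> y \in sl -> h * (g + `|nd (u t') y e|) <= 1.
  move=> ht' /hsl ly; have n1 := ndiff_le e (itvW ht') ly.
  have : g + `|nd (u t') y e| <= 3 * R0 by slra.
  by move=> /(ler_wpM2l (ltW h0)); slra.
have res := @gradient_bound R V E rev_pair nbh (wt G) h g sg sl (deep h) a (fun y => a (y + dx))
   F (fun y => F (y + dx)) T' L (2 * d%:R * MF) energy_bound Om (5 * R0 ^+ 2) 36 M u
   (fun t y => u t (y + dx)) T'0 h0 g0 sg0 sgh L0 Om0 (ler0n _ _) E20 M0.
have {res} : gradsq nbh h sg (u t) (fun y => u t (y + dx)) x <=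
   (M + @bern_source R E L (2 * d%:R * MF) 36 * t) * expR (@bern_rate R E L energy_bound Om 36 * t).
  apply: res => //.
  - ge0.
  - exact: wt_ge0.
  - exact: wt_le.
  - exact: wt_rev.
  - exact: rev_pairK.
  - by move=> y e ys; apply: coef_ge0; exact: sl_s.
  - by move=> y e ys; apply: coef_ge0; exact: sdx.
  - by move=> y e; exact: coef_sym.
  - by move=> y e; exact: coef_sym.
  - move=> e y ys; have sy := sl_s ys; apply: Fl => //; first exact: nb_simplex.
    apply: le_trans (nb_dist e sy) _; rewrite -mulrA ler_wpM2l //.
    by rewrite ler_peMl // ltW.
  - move=> y ys; apply: Fl; [exact: sl_s|exact: sdx|].
    rewrite addrAC subrr add0r; apply: le_trans l1dx _.
    by have := mulr_ge0 (ler0n R d) (ltW sg0); slra.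
  - by move=> e e' y ys dy; apply: deep_nbC => //; exact: sl_s.
  - by move=> e y ys dy; apply: deep_nbK => //; exact: sl_s.
  - move=> e' e y ys dy; rewrite /nbh deep_nb //; last exact: sl_s.
    have [] // := @hL c k y (h *: ev e') e h c01 (sl_s ys) (tangent_hev h e').
      by move=> j; have := hev_coord e' j h0; have := deepP _ _ dy j; slra.
    by move=> j; exact: hev_coord.
  - by move=> e y ys; exact: coefv.
  - move=> e y ys ny; have sy := sl_s ys.
    by apply: (coef_shallow (x := y)) => //; exact: near_refl.
  - move=> e' e y ys ny; have sy := sl_s ys.
    by apply: (coef_shallow (x := y)) => //; [exact: nb_simplex|exact: near_nb].
  - move=> e y ys ny; have sy := sl_s ys.
    apply: (coef_shallow (x := y)) => //; first exact: sdx.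
    move=> j; right; rewrite mxE.
    have := cell_coord j cdx ((hsl y).1 ys); have := ler_norm (dx 0 j); slra.
  - exact: solves_lattice.
  - move=> t' y e ht' /hsl ly; have n1 := ndiff_le e (itvW ht') ly.
    have p1 := pos_ge (g + ndiff nbh (wt G) h (u t') y e).
    rewrite /dtheta.
    have n2 := ler_norm (- nd (u t') y e); rewrite normrN in n2.
    (* With g = 2 R0 and |d| <= R0 one has 2 (g + d) >= g; this is the room that the factor 2 in the
       viscosity provides. *)
    have [g00|gE] : g = 0 \/ g = 2 * R0 by rewrite /g; case: (s); [right|left].
      by rewrite g00 mulr_ge0 // pos_ge0.
    by move: n1 n2 p1; rewrite /nd gE; slra.
  - by move=> t' y e ht' /hsl ly; exact: theta_small (itvW ht') ly.
  - by move=> t' y e ht' ys dy; exact: lattice_energy.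
  - by move=> y ys; apply: initial_gradsq => //; [exact: sl_s|exact: sdx].
move=> /le_trans; apply; rewrite /gradsq_bound.
have /andP[t0 tT'] := ht; have tT : t <= T := le_trans tT' T'T.
have bs0 := @bern_source_ge0 R E L (2 * d%:R * MF) 36 L0 (ler0n _ _).
have br0 := @bern_rate_ge0 R E L energy_bound Om 36 L0 Om0 (ler0n _ _) E20.
apply: ler_pM.
- by rewrite addr_ge0 // mulr_ge0.
- exact: expR_ge0.
- by rewrite lerD2l ler_wpM2l.
- by rewrite ler_expR ler_wpM2l.
Qed.

End Horizon.

Lemma initial_le_gradsq_bound : (N + 1) * (2 * d%:R * MU) ^+ 2 <= gradsq_bound.
Proof.
have bs0 := @bern_source_ge0 R E L (2 * d%:R * MF) 36 L0 (ler0n _ _).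
have br0 := @bern_rate_ge0 R E L energy_bound Om 36 L0 Om0 (ler0n _ _) E20.
have c0 : 0 <= (N + 1) * (2 * d%:R * MU) ^+ 2 by ge0.
rewrite /gradsq_bound -[leLHS]mulr1; apply: ler_pM => //.
- by rewrite lerDl mulr_ge0 // ltW.
- by rewrite -[leLHS]expR0 ler_expR mulr_ge0 // ltW.
Qed.

(** Positive parts give upper bounds only; the lower bound along [e] is the upper bound along the
    reverse edge at the neighbour. *)
Lemma slopes_of_gradsq T' x0 (sl : seq V) : (forall x, (x \in sl) <-> in_lattice h x0 x) ->
  (forall t x, 0 <= t <= T' -> x \in sl -> gradsq nbh h h (u t) (u t) x <= gradsq_bound + 1) ->
  slopes_bounded T' x0.
Proof.
move=> hsl hf t x e ht lx; have [sx _] := lx.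
have Bp : 0 <= B by have := B2; slra.
have up y e' : in_lattice h x0 y -> u t (nbh e' y) - u t y <= B * h.
  move=> ly; rewrite -ler_pdivrMr //.
  apply: le_trans (pos_ge _) _; rewrite -ler_sqr ?nnegrE ?pos_ge0 //.
  apply: le_trans (_ : gradsq_bound + 1 <= _).
    apply: le_trans (hf t y ht _); last exact/hsl.
    rewrite /gradsq (bigD1 (Some e')) //= lerDl sumr_ge0 // => i _; exact: sqr_ge0.
  apply: le_trans (_ : B <= _); first by rewrite /B /slope_bound; slra.
  by rewrite expr2 ler_peMl //; have := B2; slra.
rewrite ler_norml; apply/andP; split; last exact: up.
have [E1|[_ E2]] := nb_cases h e sx.
  by rewrite /nbh E1 subrr oppr_le0; exact: mulr_ge0 Bp (ltW h0).
have := up (nbh e x) (rev_pair e) (lattice_nb e lx); rewrite /nbh E2 -/nbh; slra.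
Qed.

(** Continuity argument with dx = 0 and sg = h, for which the extra slope vanishes. The weak bound
    gradsq_bound + 1 gives slopes at most B, under which [gradsq_le] returns gradsq_bound. *)
Lemma slopes_global x0 : simplex x0 -> slopes_bounded T x0.
Proof.
move=> sx0; have [sl hsl] := lattice_finite h0 sx0.
apply: (slopes_of_gradsq hsl) => t x.
have fE t' : (fun y => u t' (y + 0)) = u t' by apply/funext => y; rewrite addr0.
have [_ cu _] := su.
apply: (@bootstrap R V sl T gradsq_bound (gradsq_bound + 1)
  (fun t x => gradsq nbh h h (u t) (u t) x)) => //.
- by rewrite ltrDl.
- move=> y /hsl ly; have [sy _] := ly; rewrite /gradsq; apply: within_cont_sum => i.
  apply: within_cont_possq; rewrite /slope.
  apply: within_contM; last exact: within_cont_cst.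
  apply: within_contB; last exact: cu.
  by case: i => [e|] /=; apply: cu => //; exact: nb_simplex.
- move=> y /hsl [sy _]; apply: le_trans initial_le_gradsq_bound.
  rewrite -{2}(fE 0); apply: initial_gradsq => //; last by rewrite addr0.
  by rewrite /l1 big1 => [|i _]; [rewrite mulr_ge0 // ltW|rewrite mxE normr0].
move=> t1 /andP[t10 t1T] hf t' y ht' ys.
have hB := slopes_of_gradsq hsl hf.
rewrite -{2}(fE t'); apply: (@gradsq_le t1 t10 t1T x0 hB sl hsl 0 h) => //.
- exact: cell0.
- by rewrite addr0.
- by rewrite h0 lexx.
- by move=> i; rewrite mxE normr0 ltW.
Qed.

(** Only the term [None] of the sum of squares is used; its bound is independent of [sg], however
    small compared with h. *)
Lemma increment_le t (eta dx : V) (sg : R) : 0 <= t <= T -> simplex eta -> cell h eta dx ->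
  0 < sg <= h -> (forall i, `|dx 0 i| <= sg) -> u t (eta + dx) - u t eta <= R0 * sg.
Proof.
move=> ht seta cdx sgh hdx; have /andP[sg0 _] := sgh.
have [sl hsl] := lattice_finite h0 seta.
have le := lattice_base h seta.
have sdx : simplex (eta + dx) := cell_simplex cdx le.
have := @gradsq_le T T0 (lexx T) eta (slopes_global seta) sl hsl dx sg cdx
  (slopes_global sdx) sgh hdx t eta ht ((hsl eta).2 le).
rewrite /gradsq (bigD1 None) //= => hb.
have hb' : pos (slope nbh h sg (u t) (fun y => u t (y + dx)) None eta) ^+ 2 <= gradsq_bound.
  by apply: le_trans hb; rewrite lerDl sumr_ge0 // => i _; exact: sqr_ge0.
rewrite -ler_pdivrMr //; apply: le_trans (pos_ge _) _.
apply: le_trans slope_le_grad; have Bp : 0 <= B by have := B2; slra.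
rewrite -ler_sqr ?nnegrE ?pos_ge0 //; apply: le_trans hb' _.
apply: le_trans (_ : B <= _); first by rewrite /B /slope_bound; slra.
by rewrite expr2 ler_peMl //; have := B2; slra.
Qed.

(** Translations within a cell commute with all mesh steps, extrapolated ones included, so boundary
    lattice points need no separate treatment. *)
Lemma second_increment_le t (eta dx : V) (sg : R) : 0 <= t <= T -> simplex eta -> cell h eta dx ->
  0 < sg -> (forall i, `|dx 0 i| <= sg) ->
  u t (eta + dx) + u t (eta - dx) - 2 * u t eta <= hess_bound * sg ^+ 2.
Proof.
move=> ht seta cdx sg0 hdx.
have [u0 cu _] := su.
have [sl hsl] := lattice_finite h0 seta.
have le := lattice_base h seta.
have cdx' := cellN cdx.
have sp y : y \in sl -> simplex (y + dx) by move=> /hsl; exact: cell_simplex.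
have sm y : y \in sl -> simplex (y - dx) by move=> /hsl; exact: cell_simplex.
have sl_s y : y \in sl -> simplex y by move=> /hsl[].
have lsh (z : V) y : in_lattice h eta y -> simplex (y + z) -> in_lattice h (eta + z) (y + z).
  move=> [_ [w hw]] ss; split => //; exists w => j; rewrite !mxE hw; ring.
have dsh t' y (z : V) : cell h eta z -> 0 < t' < T -> y \in sl -> simplex (y + z) ->
    is_derive t' 1 (fun t => u t (y + z)) (- (ham nbh (wt G) h g (fun y => a (y + z)) (fun y => u t' (y + z)) y + F (y + z))).
  move=> cz ht' ys ss.
  have sz : simplex (eta + z) := cell_simplex cz le.
  have := slope_scheme_derive (lexx T) (slopes_global sz) ht' (lsh z y ((hsl y).1 ys) ss).
  congr (is_derive _ _ _ (- (_ + _))).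
  by apply: eq_bigr => e _; rewrite /ndiff /nbh (cell_nb e cz) //; exact/hsl.
have l1dx : l1 dx ^+ 2 <= d%:R ^+ 2 * sg ^+ 2.
  by rewrite -exprMn ler_sqr ?nnegrE ?l1_ge0 ?mulr_ge0 ?(ltW sg0) ?l1_le.
pose D := (18 * N * L * R0 ^+ 2 + 2 * MF * d%:R ^+ 2) * sg ^+ 2.
pose M := 2 * MU * d%:R ^+ 2 * sg ^+ 2.
have D0 : 0 <= D by rewrite /D; ge0.
have M0 : 0 <= M by rewrite /M; ge0.
pose f t y := u t (y + dx) + u t (y - dx) - 2 * u t y.
pose Hd (z : V) t y := ham nbh (wt G) h g (fun y => a (y + z)) (fun y => u t (y + z)) y.
pose f' t y := - (Hd dx t y + F (y + dx)) - (Hd (- dx) t y + F (y - dx)) + 2 * (H a (u t) y + F y).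
have mp : f t eta <= (M + D * t) * expR (0 * t).
  apply: (@max_principle R V sl T 0 D M f f') => //; last by apply/hsl.
  - move=> y ys; rewrite /f; apply: within_contB.
      by apply: within_contD; apply: cu; [exact: sp|exact: sm].
    by apply: within_contM; [exact: within_cont_cst|apply: cu; exact: sl_s].
  - move=> t' y ht' ys.
    have d1' := dsh t' y dx cdx ht' ys (sp y ys).
    have d2' := dsh t' y (- dx) cdx' ht' ys (sm y ys).
    have d3' := is_deriveZ 2 (slope_scheme_derive (lexx T) (slopes_global seta) ht' ((hsl y).1 ys)).
    have := is_deriveB (is_deriveD d1' d2') d3'.
    by move=> Hdd; apply: is_derive_eq Hdd _; rewrite /f' /Hd /GRing.scale /=; ring.
  - move=> y ys; have sy := sl_s y ys.
    rewrite /f !u0 //; [|exact: sm|exact: sp].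
    apply: le_trans (ler_norm _) _; apply: le_trans (hU2 sy (sp y ys) (sm y ys)) _.
    by have := ler_wpM2l (mulr_ge0 (ler0n _ 2) MU0) l1dx; rewrite /M; slra.
  - move=> t' y ht' ys ymax _; rewrite mul0r add0r.
    have sy := sl_s y ys; have ly := (hsl y).1 ys.
    have ht'' : 0 <= t' <= T by have /andP[? ?] := ht'; rewrite !ltW.
    have Fd : - (F (y + dx) + F (y - dx) - 2 * F y) <= 2 * MF * d%:R ^+ 2 * sg ^+ 2.
      apply: le_trans (ler_norm _) _; rewrite normrN.
      apply: le_trans (hF2 sy (sp y ys) (sm y ys)) _.
      by have := ler_wpM2l (mulr_ge0 (ler0n _ 2) MF0) l1dx; slra.
    have NLR : 0 <= N * L * R0 ^+ 2 * sg ^+ 2 by ge0.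
    have hs : - (N * (L * sg ^+ 2) * (13 * R0 ^+ 2)) <=
       Hd dx t' y + Hd (- dx) t' y - 2 * H a (u t') y.
      apply: ham_second_diff => //.
      - exact: wt_ge0.
      - ge0.
      - move=> e1.
        have w1 j : 2 * `|dx 0 j| <= y 0 j by exact: cell_coord cdx ly.
        by have [_] := @hL c k y dx e1 sg c01 sy (proj1 cdx) w1 hdx.
      - move=> e1; have := ymax (nbh e1 y); rewrite /f; apply.
        by apply/hsl; exact: lattice_nb.
      - by move=> e1; exact: slope_flux_le (slopes_global seta) ht'' ly.
    rewrite /f' /D; slra.
move: mp; rewrite mul0r expR0 mulr1 => /le_trans; apply.
have /andP[t0 tT] := ht.
have : D * t <= D * T by rewrite ler_wpM2l.
have : 0 <= sg ^+ 2 by exact: sqr_ge0.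
rewrite /M /D /hess_bound; slra.
Qed.
End Solution.
End Estimates.

(** * From increments to derivatives *)

Section Rays.
Context {R : realType} {d : nat}.
Local Notation V := 'rV[R]_d.
Implicit Types (x a : V) (f : V -> R).

Lemma lattice_gap (y h : R) : 0 < h ->
  exists2 gam : R, 0 < gam & forall m : int, y + h * m%:~R != 0 -> gam <= `|y + h * m%:~R|.
Proof.
move=> h0; pose n := Num.floor (y / h); pose r := y - h * n%:~R.
have r0 : 0 <= r.
  have := floor_le_tmp (y / h); rewrite -/n ler_pdivlMr // mulrC /r; lra.
have rh : r < h.
  have := floorD1_gt (y / h); rewrite -/n ltr_pdivrMr // intrD mulrDl mul1r /r mulrC; lra.
have yE m : y + h * m%:~R = r + h * (n + m)%:~R by rewrite intrD /r; ring.
have [rz|rn] := eqVneq r 0.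
  exists h => // m; rewrite yE rz add0r mulf_eq0 negb_or => /andP[_ nm].
  rewrite normrM (gtr0_norm h0) ler_peMr ?(ltW h0) //.
  rewrite -intr_norm -[1]/(1%:~R) ler_int.
  by move: nm; rewrite intr_eq0 -normr_gt0 gtz0_ge1.
have rp : 0 < r by rewrite lt_def rn.
exists (Num.min r (h - r)); first by rewrite lt_min rp subr_gt0.
move=> m _; rewrite yE; move: (n + m) => q.
have [q0|q0] := lerP 0 q.
  have : 0 <= h * q%:~R by rewrite mulr_ge0 ?(ltW h0) // ler0z.
  by move=> hq; rewrite ge_min; apply/orP; left; rewrite ger0_norm ?lerDl // addr_ge0 ?r0.
have q1 : (q%:~R : R) <= -1.
  have -> : -1 = (-1)%:~R :> R by rewrite rmorphN.
  by rewrite ler_int -(lerD2r 1) addNr lezD1.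
have := ler_wpM2l (ltW h0) q1; rewrite mulrN1 => hq.
rewrite ge_min; apply/orP; right; have := ler_norm (- (r + h * q%:~R)); rewrite normrN; lra.
Qed.

(** The centre is x + 2 r a because [x] may lie on a mesh hyperplane. There the centre has offset 2
    r a_k, just enough for the displacement r a_k; elsewhere [lattice_gap] provides room for small
    r. *)
Lemma cell_ray h x a : 0 < h -> (1 <= d)%N -> tangent a ->
  exists2 rho : R, 0 < rho & forall r, `|r| < rho -> cell h (x + (2 * r) *: a) (r *: a).
Proof.
move=> h0 d1 ta.
have /choice[gam Hg] : forall k : 'I_d, exists g : R, 0 < g /\
    forall m : int, x 0 k + h * m%:~R != 0 -> g <= `|x 0 k + h * m%:~R|.
  by move=> k; have [g g0 H] := lattice_gap (x 0 k) h0; exists g.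
pose k0 : 'I_d := Ordinal d1.
have [k _ Hk] := arg_minP gam (isT : xpredT k0).
have g0 : 0 < gam k by case: (Hg k).
have l0 : 0 < 4 * (l1 a + 1) by rewrite mulr_gt0 // ltr_wpDl ?l1_ge0.
exists (gam k / (4 * (l1 a + 1))); first by rewrite divr_gt0.
move=> r; rewrite ltr_pdivlMr // => hr; split; first exact: tangentZ.
move=> j m; rewrite !mxE.
have ra : 4 * `|r * a 0 j| < gam j.
  apply: lt_le_trans (Hk j isT).
  apply: le_lt_trans hr; rewrite normrM mulrCA ler_wpM2l // ler_wpM2l //.
  by apply: le_trans (coord_le_l1 a j) _; rewrite lerDl.
have n1 := ler_norm (r * a 0 j); have n2 := ler_norm (- (r * a 0 j)); rewrite normrN in n2.
have -> : x 0 j + 2 * r * a 0 j + h * m%:~R = (x 0 j + h * m%:~R) + 2 * (r * a 0 j) by ring.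
have [_ gap] := Hg j.
have [y0|yn] := eqVneq (x 0 j + h * m%:~R) 0.
  rewrite y0 !add0r; have [p0|p0] := lerP 0 (r * a 0 j).
    by rewrite ger0_norm //; split; lra.
  by rewrite ltr0_norm //; split; lra.
have gy := gap m yn.
have [p0|p0] := lerP 0 (x 0 j + h * m%:~R).
  by move: gy; rewrite ger0_norm // => gy; split; lra.
by move: gy; rewrite ltr0_norm // => gy; split; lra.
Qed.

Lemma ray_simplex x a (tau q : R) : simplex x -> simplex (x + tau *: a) -> 0 <= q <= 1 ->
  simplex (x + (q * tau) *: a).
Proof.
move=> sx st hq; have := simplex_convex sx st hq.
by rewrite [x + _ - x]addrAC subrr add0r scalerA.
Qed.

Lemma dderiv_ray f a x (l dl : R) : simplex x -> is_dderiv f a x l -> 0 < dl ->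
  exists r : R, [/\ r != 0, 4 * `|r| < dl & forall c, 0 <= c <= 4 -> simplex (x + (c * r) *: a)].
Proof.
move=> sx dd dl0; have [t [t0 tdl st]] := dderiv_small sx dd dl0.
exists (t / 4); split; first by rewrite mulf_neq0.
  by rewrite normrM normfV [`|4|]ger0_norm // mulrC divfK.
move=> c hc; rewrite mulrCA mulrC; apply: ray_simplex => //; lra.
Qed.

(** Upper bounds for the increments from x + 2 r a to x + 3 r a and to x + r a control l and - l. *)
Lemma dderiv_le f a x (l C : R) : simplex x -> is_dderiv f a x l ->
  (exists2 rho : R, 0 < rho & forall r : R, r != 0 -> `|r| < rho ->
     simplex (x + r *: a) -> simplex (x + (3 * r) *: a) ->
     f (x + (3 * r) *: a) - f (x + (2 * r) *: a) <= C * `|r| /\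
     f (x + r *: a) - f (x + (2 * r) *: a) <= C * `|r|) -> `|l| <= C.
Proof.
move=> sx dl [rho rho0 H]; apply/ler_addgt0Pr => e e0.
(* The expansion errors at 2 r and 3 r add up to 5 (e / 5) |r|. *)
have e50 : 0 < e / 5 by rewrite divr_gt0.
have [dlt dl0 Hd] := dderiv_lim dl e50.
have m0 : 0 < Num.min dlt rho by rewrite lt_min dl0.
have [r [r0]] := dderiv_ray sx dl m0; rewrite lt_min => /andP[rd rr] s.
have rp : 0 < `|r| by rewrite normr_gt0.
have E c : 0 < c <= 3 -> `|f (x + (c * r) *: a) - f x - l * (c * r)| <= e / 5 * (c * `|r|).
  move=> /andP[c0 c3]; have cr : `|c * r| = c * `|r| by rewrite normrM gtr0_norm.
  rewrite -cr; apply: Hd; first by rewrite mulf_neq0 // gt_eqF.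
    by rewrite cr; have := ler_wpM2r (ltW rp) c3; lra.
  by apply: s; rewrite ltW //=; lra.
have E1 := E 1; rewrite !mul1r in E1; have E2 := E 2; have E3 := E 3.
have s1 : simplex (x + r *: a) by have := s 1; rewrite mul1r; apply; lra.
have [||h1 h2] := H r r0 _ s1 (s 3 _); [lra|lra|].
have : 0 < (1 : R) <= 3 /\ 0 < (2 : R) <= 3 /\ 0 < (3 : R) <= 3 by clear; split; [|split]; lra.
move=> [/E1 + [/E2 + /E3]].
move=> /ler_normlP[a1 a2] /ler_normlP[a3 a4] /ler_normlP[a5 a6].
suff : `|l * r| <= (C + e) * `|r| by rewrite normrM ler_pM2r.
by rewrite ler_norml; apply/andP; split; lra.
Qed.

(** The second difference at r, 2 r, 3 r equals r times an increment of the first derivative between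
    c r and (c + 1) r for some c in [1, 2], which is close to l r^2. All points lie on an open
    segment from x on which the first derivative exists. *)
Lemma dderiv2_le f a x (l C : R) : simplex x -> is_dderiv2 f a x l ->
  (exists2 rho : R, 0 < rho & forall r : R, r != 0 -> `|r| < rho ->
     simplex (x + r *: a) -> simplex (x + (3 * r) *: a) ->
     f (x + (3 * r) *: a) + f (x + r *: a) - 2 * f (x + (2 * r) *: a) <= C * r ^+ 2) ->
  l <= C.
Proof.
move=> sx [f1 [Hf1 dl]] [rho rho0 H]; apply/ler_addgt0Pr => e e0.
have e50 : 0 < e / 5 by rewrite divr_gt0.
have [dlt dl0 Hd] := dderiv_lim dl e50.
have /nbhs_ballP[eta /= eta0 Hn] := Hf1.
have m0 : 0 < Num.min (Num.min dlt rho) eta by rewrite !lt_min dl0 rho0.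
have [r [r0]] := dderiv_ray sx dl m0; rewrite !lt_min => /andP[/andP[rd rr] re] s.
have rp : 0 < `|r| by rewrite normr_gt0.
have cr c : 0 < c -> `|c * r| = c * `|r| by move=> c0; rewrite normrM gtr0_norm.
have E c : 0 < c < 4 -> `|f1 (x + (c * r) *: a) - f1 x - l * (c * r)| <= e / 5 * (c * `|r|).
  move=> /andP[c0 c3]; rewrite -cr //; apply: Hd; first by rewrite mulf_neq0 // gt_eqF.
    by rewrite cr //; have := ltr_pM2r rp c 4; rewrite c3; lra.
  by apply: s; rewrite !ltW.
have D (c : R) : 0 < c < 4 -> is_derive c 1 (fun c : R => f (x + (c * r) *: a)) (r * f1 (x + (c * r) *: a)).
  move=> /andP[c0 c4].
  have dd : is_dderiv f a (x + (c * r) *: a) (f1 (x + (c * r) *: a)).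
    apply: Hn; last by apply: s; rewrite !ltW.
    by rewrite -ball_normE /= sub0r normrN cr //; have := ltr_pM2r rp c 4; rewrite c4; lra.
  have near_s : exists2 rho' : R, 0 < rho' & forall t, `|t| < rho' ->
      simplex (x + (c * r) *: a + t *: a).
    exists (Num.min c (4 - c) * `|r|); first by rewrite mulr_gt0 // lt_min c0 subr_gt0.
    move=> t ht; rewrite -addrA -scalerDl.
    have -> : c * r + t = (c + t / r) * r by rewrite mulrDl divfK.
    have : `|t / r| < Num.min c (4 - c) by rewrite normrM normfV ltr_pdivrMr.
    rewrite lt_min !ltr_norml => /andP[/andP[b1 b2] /andP[b3 b4]].
    by apply: s; apply/andP; split; lra.
  have := is_derive1_comp (f := fun u => f (x + u *: a)) (g := fun c => c * r)
    (line_is_derive near_s dd) (is_deriveM (is_derive_id c 1) (is_derive_cst r c 1)).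
  by move=> HD; apply: is_derive_eq HD _; rewrite /GRing.scale /=; ring.
pose psi (c : R) := f (x + ((c + 1) * r) *: a) - f (x + (c * r) *: a).
have dpsi (c : R) : 1 <= c <= 2 -> is_derive c 1 psi
    (r * f1 (x + ((c + 1) * r) *: a) - r * f1 (x + (c * r) *: a)).
  move=> /andP[c1 c2]; apply: is_deriveB; last by apply: D; apply/andP; split; lra.
  apply: (@is_derive_translate R (fun c => f (x + (c * r) *: a))).
  by apply: D; apply/andP; split; lra.
have le12 : (1 : R) <= 2 by lra.
have [c /andP[c1 c2]] := MVT_closed le12 dpsi.
have -> : psi 2 - psi 1 = f (x + (3 * r) *: a) + f (x + r *: a) - 2 * f (x + (2 * r) *: a).
  rewrite /psi; have -> : (2 + 1 : R) = 3 by lra.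
  have -> : (1 + 1 : R) = 2 by lra.
  by rewrite mul1r; ring.
have s1 : simplex (x + r *: a) by have := s 1; rewrite mul1r; apply; lra.
have s3 : simplex (x + (3 * r) *: a) by apply: s; lra.
have rr' : `|r| < rho by lra.
have := H r r0 rr' s1 s3 => HH E0; rewrite E0 in HH.
have F1 := E c ltac:(lra); have F2 := E (c + 1) ltac:(lra).
set w1 := f1 _ in HH F1 F2 *; set w2 := f1 (x + (c * r) *: a) in HH F1 F2 *.
have key : `|w1 - w2 - l * r| <= e * `|r|.
  have -> : w1 - w2 - l * r = (w1 - f1 x - l * ((c + 1) * r)) - (w2 - f1 x - l * (c * r)) by ring.
  apply: le_trans (ler_normB _ _) _.
  have : c * `|r| <= 2 * `|r| by rewrite ler_wpM2r // ltW.
  move=> cr2; have := ler_wpM2l (ltW e50) cr2; lra.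
have r2 : 0 < r ^+ 2 by rewrite exprn_even_gt0.
rewrite -(ler_pM2r r2).
have : `|r * (w1 - w2 - l * r)| <= e * r ^+ 2.
  rewrite normrM -[r ^+ 2]real_normK ?num_real // expr2 [e * _]mulrCA.
  by rewrite ler_pM2l.
rewrite ler_norml => /andP[a1 _]; lra.
Qed.

End Rays.

Theorem proposition5p1 (R : realType) (d : nat) (hd : (2 <= d)%N)
    (G : wgraph R d) (T : R) (hT : 0 < T) (MU MF : R) :
  exists h0 R0 K0 : R,
    [/\ 0 < h0, h0 < d%:R^-1, 0 < R0 & 0 < K0] /\
    forall (s : scheme_kind) (k : mean_kind) (U0 F : 'rV[R]_d -> R),
      C2_simplex U0 -> C2_simplex F -> C2_norm U0 = MU -> C2_norm F = MF ->
    forall (h : R) (u : R -> 'rV[R]_d -> R), 0 < h < h0 ->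
      semidiscrete_solution G s k (const_mx (2 * R0)) T h U0 F u ->
    forall t : R, 0 <= t <= T ->
      (forall (xi : 'rV[R]_d) (i j : 'I_d) (l : R), simplex xi ->
         edge G i j -> (i < j)%N ->
         is_dderiv (u t) (evec R i j) xi l -> `|l| <= R0) /\
      (forall (a xi : 'rV[R]_d) (l : R), unit_tangent a -> simplex xi ->
         is_dderiv2 (u t) a xi l -> l <= K0).
Proof.
have d1 : (1 <= d)%N by exact: ltnW.
pose k0 : 'I_d := Ordinal d1.
have [L L1 hL] := @coef_variation R d.
have L0 : 0 <= L by lra.
(* The constants are chosen before any function of norm [MU] or [MF] is given, so signs are unknown;
   absolute values keep the constants meaningful and disappear once U0 and F are introduced. *)
have mu0 : 0 <= `|MU| by []. have mf0 : 0 <= `|MF| by [].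
have R0ge := slope_le_grad G `|MU| `|MF| hT L0.
have R0p : 0 < grad_bound G T L `|MU| `|MF|.
  apply: lt_le_trans R0ge; rewrite /slope_bound.
  by have := gradsq_bound_ge0 G `|MU| `|MF| hT L0; lra.
have ms1 := mesh_scale_ge1 G hT L0 mu0 mf0.
have msp : 0 < mesh_scale G T L `|MU| `|MF| by lra.
exists (mesh_scale G T L `|MU| `|MF|)^-1, (grad_bound G T L `|MU| `|MF|), (hess_bound G T L `|MU| `|MF|).
split.
  split => //.
  - by rewrite invr_gt0.
  - rewrite ltf_pV2 ?posrE ?ltr0n //.
    exact: mesh_scale_gt.
  - exact: hess_bound_gt0.
move=> s k U0 F cU cF nU nF h u /andP[h0 hlt] su t ht.
have [MU0 _ hU1 hU2] := C2_norm_bounds k0 cU nU.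
have [MF0 hF0 hF1 hF2] := C2_norm_bounds k0 cF nF.
rewrite (ger0_norm MU0) (ger0_norm MF0) in su hlt msp *.
have hsm : h * mesh_scale G T L MU MF <= 1.
  by rewrite -ler_pdivlMr // mul1r ltW.
split.
  move=> xi i j l sxi _ _ dl; apply: (dderiv_le sxi dl).
  have tev := tangent_evec i j : tangent (evec R i j).
  have [rho rho0 Hr] := cell_ray xi h0 d1 tev.
  (* The minimum with [h] ensures sg <= h in [increment_le]. *)
  exists (Num.min rho h); first by rewrite lt_min rho0.
  move=> r r0; rewrite lt_min => /andP[rr rh] s1 s3.
  have rp : 0 < `|r| <= h by rewrite normr_gt0 r0 ltW.
  have cr : forall k, `|(r *: evec R i j) 0 k| <= `|r|.
    by move=> k'; rewrite mxE normrM ler_piMr // evec_coord.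
  have crN : forall k, `|(- (r *: evec R i j)) 0 k| <= `|r|.
    by move=> k'; rewrite mxE normrN.
  have s2 : simplex (xi + (2 * r) *: evec R i j).
    have := @ray_simplex R d xi (evec R i j) (3 * r) (2 / 3) sxi s3.
    have -> : 2 / 3 * (3 * r) = 2 * r by field.
    by apply; lra.
  have c1 := Hr r rr; have c2 := cellN c1.
  have i1 := increment_le d1 hT L0 MU0 MF0 hU1 hU2 hF0 hF1 hF2 hL h0 hsm su ht s2 c1 rp cr.
  have i2 := increment_le d1 hT L0 MU0 MF0 hU1 hU2 hF0 hF1 hF2 hL h0 hsm su ht s2 c2 rp crN.
  have e3 : xi + (2 * r) *: evec R i j + r *: evec R i j = xi + (3 * r) *: evec R i j.
    by rewrite -addrA -scalerDl; congr (_ + _ *: _); ring.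
  have e1 : xi + (2 * r) *: evec R i j - r *: evec R i j = xi + r *: evec R i j.
    by rewrite -addrA -scalerBl; congr (_ + _ *: _); ring.
  by rewrite e3 in i1; rewrite e1 in i2.
move=> a xi l ua sxi dl; apply: (dderiv2_le sxi dl).
have ta := proj2 ua.
have [rho rho0 Hr] := cell_ray xi h0 d1 ta.
exists rho => // r r0 rr s1 s3.
have rp : 0 < `|r| by rewrite normr_gt0.
have cr : forall k, `|(r *: a) 0 k| <= `|r|.
  by move=> k'; rewrite mxE normrM ler_piMr // unit_tangent_coord.
have s2 : simplex (xi + (2 * r) *: a).
  have := @ray_simplex R d xi a (3 * r) (2 / 3) sxi s3.
  have -> : 2 / 3 * (3 * r) = 2 * r by field.
  by apply; lra.
have c1 := Hr r rr.
have := second_increment_le d1 hT L0 MU0 MF0 hU1 hU2 hF0 hF1 hF2 hL h0 hsm su ht s2 c1 rp cr.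
have -> : xi + (2 * r) *: a + r *: a = xi + (3 * r) *: a.
  by rewrite -addrA -scalerDl; congr (_ + _ *: _); ring.
have -> : xi + (2 * r) *: a - r *: a = xi + r *: a.
  by rewrite -addrA -scalerBl; congr (_ + _ *: _); ring.
by rewrite real_normK ?num_real.
Qed.
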